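(* Let $\mathcal Y=\mathcal T^*+\boldsymbol\Xi\in\mathbb R^{d_1\times\cdots\times d_m}$, where $\mathcal T^*$ has Tucker rank $\mathbf r$ and incoherence parameter $\mu^*=\mu(\mathcal T^* )$, and the entries of $\boldsymbol\Xi$ are i.i.d. copies of $\xi$ satisfying the Noise Condition I (see context) with constants $\varepsilon,\gamma,b_0$. There exist absolute constants $c,c_1,c_2>0$ such that with probability exceeding $1-c\sum_{k=1}^md_k(d_k^-)^{-1-\min\{1,\varepsilon\}}-\exp(-\mathsf{DoF}_m/2)$ the following hold. (1) For all $\mathcal T\in\mathbb R^{d_1\times\cdots\times d_m}$ and any gradient $\mathcal G\in\partial\|\mathcal T-\mathcal Y\|_{H_p}$, $$\|\mathcal P_{\mathbb T}(\mathcal G)\|_{\mathrm F}\le(d^* )^{1/2},\qquad\|\mathcal T-\mathcal Y\|_{H_p}-\|\mathcal T^*-\mathcal Y\|_{H_p}\ge\|\mathcal T-\mathcal T^*\|_\infty^{-1}\|\mathcal T-\mathcal T^*\|_{\mathrm F}^2-6d^*\gamma-d^*\delta,$$ where $\mathbb T$ is the tangent space of $\mathbb M_{\mathbf r}$ at $\mathcal T$ (the first inequality being for those $\mathcal T$ of Tucker rank $\mathbf r$, where $\mathbb T$ is defined). Furthermore, if $\mathcal T$ is $\mu$-incoherent (of Tucker rank $\mathbf r$), then for each $k\in[m]$ and $j\in[d_k]$, $$\|\mathcal M_k(\mathcal P_{\mathbb T}(\mathcal G))\|_{2,\infty}\le(3\mu r_kd_k^-)^{1/2},$$ $$\|\mathcal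 M_k(\mathcal T-\mathcal Y)_{j,\cdot}\|_{H_p}-\|\mathcal M_k(\mathcal T^*-\mathcal Y)_{j,\cdot}\|_{H_p}\ge\|\mathcal M_k(\mathcal T-\mathcal T^* )_{j,\cdot}\|_\infty^{-1}\|\mathcal M_k(\mathcal T-\mathcal T^* )_{j,\cdot}\|_{\mathrm F}^2-6d_k^-\gamma-d_k^-\delta.$$ (2) For all $\mathcal T\in\mathbb M_{\mathbf r}$ satisfying $\|\mathcal T-\mathcal T^*\|_\infty\le C_{m,\mu^*,r^*}(6\gamma+\delta)$ and $\|\mathcal T-\mathcal T^*\|_{\mathrm F}\ge c_1b_0\sqrt{\mathsf{DoF}_m}$, and $\mathcal G\in\partial\|\mathcal T-\mathcal Y\|_{H_p}$, $$\|\mathcal P_{\mathbb T}(\mathcal G)\|_{\mathrm F}\le c_2\delta^{-1}\sqrt{m+1}\,\|\mathcal T-\mathcal T^*\|_{\mathrm F},\qquad\|\mathcal T-\mathcal Y\|_{H_p}-\|\mathcal T^*-\mathcal Y\|_{H_p}\ge(4b_0)^{-1}\|\mathcal T-\mathcal T^*\|_{\mathrm F}^2.$$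
   Context: Notation. $d^*=d_1\cdots d_m$, $d_k^-=d^*/d_k$, $r^*=r_1\cdots r_m$, $\mathsf{DoF}_m=r_1\cdots r_m+\sum_jd_jr_j$. $\mathcal M_k(\mathcal T)\in\mathbb R^{d_k\times d_k^-}$ is the mode-$k$ matricization and $\mathbf A_{j,\cdot}$ the $j$-th row of $\mathbf A$. $\mathbb M_{\mathbf r}$ is the set of tensors with $\mathrm{rank}(\mathcal M_k(\mathcal T))\le r_k$ for all $k$; Tucker rank $\mathbf r$ means equality for all $k$, and then $\mathcal T=\mathcal C\cdot[\![\mathbf U_1,\dots,\mathbf U_m]\!]:=\mathcal C\times_1\mathbf U_1\cdots\times_m\mathbf U_m$ with core $\mathcal C\in\mathbb R^{r_1\times\cdots\times r_m}$ and $\mathbf U_k\in\mathbb R^{d_k\times r_k}$ with orthonormal columns. $\mu(\mathcal T)=\max_k\|\mathbf U_k\|_{2,\infty}^2d_k/r_k$; $\mathcal T$ is $\mu$-incoherent if $\mu(\mathcal T)\le\mu$. $\|\cdot\|_{2,\infty}$: maximal Euclidean row norm; $\|\cdot\|_{\mathrm F},\|\cdot\|_\infty$: entrywise $\ell_2$ and $\ell_\infty$ norms. Expressions of the form $\|\mathcal A\|_\infty^{-1}\|\mathcal A\|_{\mathrm F}^2$ are read as $0$ when $\mathcal A=0$. Pseudo-Huber loss: $\|\mathcal A\|_{H_p}=\sum_\omega\sqrt{[\mathcal A]_\omega^2+\delta^2}$ (sum over all entries of a tensor, or of a row vector) with parameter $\delta>0$; $\partial\|\mathcal T-\mathcal Y\|_{H_p}$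 is with respect to $\mathcal T$. $\mathcal P_{\mathbb T}$ is the orthogonal projection onto the tangent space: for $\mathcal T=\mathcal C\cdot[\![\mathbf U_1,\dots,\mathbf U_m]\!]$, $\mathcal P_{\mathbb T}(\mathcal G)=\mathcal G\times_1\mathbf U_1\mathbf U_1^\top\cdots\times_m\mathbf U_m\mathbf U_m^\top+\sum_k\mathcal C\times_{i\ne k}\mathbf U_i\times_k\mathbf W_k$, $\mathbf W_k=(\mathbf I-\mathbf U_k\mathbf U_k^\top)\mathcal M_k(\mathcal G)(\otimes_{i\ne k}\mathbf U_i)\mathcal M_k(\mathcal C)^\dagger$ (Kronecker product ordered so that $\mathcal M_k(\mathcal T)=\mathbf U_k\mathcal M_k(\mathcal C)(\otimes_{i\neq k}\mathbf U_i)^\top$). Noise Condition I: there is $\varepsilon>0$ with $\gamma:=(\mathbb E|\xi|^{2+\varepsilon})^{1/(2+\varepsilon)}<\infty$; $\xi$ has a density $h_\xi$ with $h_\xi(x)=h_\xi(-x)$; and there is $b_0>0$ such that $h_\xi(x)\ge b_0^{-1}$ for all $|x|\le C_{m,\mu^*,r^*}(6\gamma+\delta)$, where $C_{m,\mu^*,r^*}=72(5m+1)^23^m\mu^{*m}r^*$.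
   Formalization: The constant c_1 in part (2) may depend on the tensor order m (c and c_2 remain absolute), because with c_1 independent of m the last inequality of (2) fails for rank-one tensors of large order, where the noise supremum is of order sqrt(m d log m). *)

(* Defs.v *)
From HB Require Import structures.
From mathcomp Require Import all_boot all_order all_algebra.
From mathcomp Require Import all_classical all_reals all_analysis.

Set Implicit Arguments.
Unset Strict Implicit.
Unset Printing Implicit Defensive.

Import Order.TTheory GRing.Theory Num.Theory.

Local Open Scope classical_set_scope.
Local Open Scope ring_scope.

(** ** Norms of finitely indexed families

    They are applied both to tensors and to single rows [A j] of a matrix. *)

Section Norms.
Variables (R : realType) (I : finType).
Implicit Type a : I -> R.

Definition normF a : R := Num.sqrt (\sum_i a i ^+ 2).

Definition norm_sup a : R := \big[Num.max/0]_i `|a i|.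

Definition pseudo_huber (delta : R) a : R :=
  \sum_i Num.sqrt (a i ^+ 2 + delta ^+ 2).

End Norms.

Definition norm_2sup (R : realType) (n p : nat) (A : 'M[R]_(n, p)) : R :=
  \big[Num.max/0]_(j < n) normF (A j).

(** ** Tensors *)

Definition tidx (m : nat) (d : 'I_m -> nat) : finType :=
  {dffun forall k : 'I_m, 'I_(d k)}.

Definition tensor (R : Type) (m : nat) (d : 'I_m -> nat) := {ffun tidx d -> R}.

(* Multi-indices over the modes different from [k]: column indices of the
   mode-[k] matricization. *)
Definition cidx (m : nat) (d : 'I_m -> nat) (k : 'I_m) : finType :=
  {dffun forall i : {i : 'I_m | i != k}, 'I_(d (val i))}.

(* The multi-index with [k]-th entry [j] and remaining entries [c]. *)
Definition insert_idx (m : nat) (d : 'I_m -> nat) (k : 'I_m)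
    (j : 'I_(d k)) (c : cidx d k) : tidx d :=
  finfun (fun i : 'I_m =>
    match eq_comparable i k with
    | left eik => ecast x ('I_(d x)) (esym eik) j
    | right nik => c (exist (fun x => x != k) i (introN eqP nik))
    end).

(* d^* *)
Definition dim_prod (m : nat) (d : 'I_m -> nat) : nat := (\prod_k d k)%N.

(* d_k^- *)
Definition codim (m : nat) (d : 'I_m -> nat) (k : 'I_m) : nat :=
  (\prod_(i < m | i != k) d i)%N.

Definition DoF (m : nat) (d r : 'I_m -> nat) : nat :=
  (\prod_k r k + \sum_k d k * r k)%N.

(* [#|cidx d k|] equals [codim d k], see [card_cidx] below. *)
Definition matricize (R : Type) (m : nat) (d : 'I_m -> nat) (k : 'I_m)
    (T : tensor R d) : 'M[R]_(d k, #|cidx d k|) :=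
  \matrix_(j, c) T (insert_idx j (enum_val c)).

(* C x_1 A_1 ... x_m A_m, written entrywise. *)
Definition multilinear_mul (R : realType) (m : nat) (d e : 'I_m -> nat)
    (C : tensor R e) (A : forall k, 'M[R]_(d k, e k)) : tensor R d :=
  [ffun w : tidx d => \sum_(v : tidx e) C v * \prod_k A k (w k) (v k)].

(* The Kronecker product of the A_i over i != k, rows and columns being
   enumerated as in [matricize]. *)
Definition kron_except (R : realType) (m : nat) (d e : 'I_m -> nat) (k : 'I_m)
    (A : forall k, 'M[R]_(d k, e k)) : 'M[R]_(#|cidx d k|, #|cidx e k|) :=
  \matrix_(a, b) \prod_(i : {i : 'I_m | i != k})
    A (val i) ((enum_val a : cidx d k) i) ((enum_val b : cidx e k) i).

(** ** Tucker rank, Tucker decomposition, incoherence *)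

Definition rank_le (R : realType) (m : nat) (d r : 'I_m -> nat)
    (T : tensor R d) : Prop :=
  forall k, (\rank (matricize k T) <= r k)%N.

Definition tucker_rank (R : realType) (m : nat) (d r : 'I_m -> nat)
    (T : tensor R d) : Prop :=
  forall k, \rank (matricize k T) = r k.

Definition tucker_decomp (R : realType) (m : nat) (d r : 'I_m -> nat)
    (T : tensor R d) (C : tensor R r) (U : forall k, 'M[R]_(d k, r k)) : Prop :=
  (forall k, (U k)^T *m U k = 1%:M) /\ T = multilinear_mul C U.

(* The incoherence parameter mu(T), as a function of the factors [U] of a
   Tucker decomposition of [T]; when [T] has Tucker rank [r] all its
   decompositions yield the same value. *)
Definition incoherence (R : realType) (m : nat) (d r : 'I_m -> nat)
    (U : forall k, 'M[R]_(d k, r k)) : R :=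
  \big[Num.max/0]_k (norm_2sup (U k) ^+ 2 * (d k)%:R / (r k)%:R).

(** ** Projection onto the tangent space *)

Definition is_pinv (R : realType) (n p : nat)
    (A : 'M[R]_(n, p)) (B : 'M[R]_(p, n)) : Prop :=
  [/\ A *m B *m A = A, B *m A *m B = B,
      (A *m B)^T = A *m B & (B *m A)^T = B *m A].

(* The Moore-Penrose inverse. *)
Definition pinv (R : realType) (n p : nat) (A : 'M[R]_(n, p)) : 'M[R]_(p, n) :=
  xget 0 [set B | is_pinv A B].

Definition tangent_factor (R : realType) (m : nat) (d r : 'I_m -> nat)
    (C : tensor R r) (U : forall k, 'M[R]_(d k, r k)) (G : tensor R d)
    (k : 'I_m) : 'M[R]_(d k, r k) :=
  (1%:M - U k *m (U k)^T) *m matricize k G *m kron_except k U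
    *m pinv (matricize k C).

(* P_T(G), for T the tangent space at the tensor with Tucker decomposition
   [C], [U]; when this tensor has Tucker rank [r], the value does not depend
   on the chosen decomposition. *)
Definition tangent_proj (R : realType) (m : nat) (d r : 'I_m -> nat)
    (C : tensor R r) (U : forall k, 'M[R]_(d k, r k)) (G : tensor R d)
    : tensor R d :=
  multilinear_mul G (fun k => U k *m (U k)^T) +
  \sum_k multilinear_mul C
    (fun i => if i == k then tangent_factor C U G i else U i).

(** ** Subdifferential of T |-> pseudo_huber (T - Y) *)

Definition huber_subgradient (R : realType) (m : nat) (d : 'I_m -> nat)
    (delta : R) (Y T G : tensor R d) : Prop :=
  forall T' : tensor R d,
    pseudo_huber delta (T - Y) + \sum_w G w * (T' w - T w)
      <= pseudo_huber delta (T' - Y).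

(** ** Noise *)

(* Mutual independence of a finite family of random variables; the product
   rule for a subfamily is the case [B i = setT] outside of it. *)
Definition mutually_independent (R : realType) (disp : measure_display)
    (Omega : measurableType disp) (P : probability Omega R)
    (I : finType) (X : I -> {RV P >-> R}) : Prop :=
  forall B : I -> set R, (forall i, measurable (B i)) ->
    P [set w | forall i, B i (X i w)] = (\prod_i P (X i @^-1` B i))%E.

Definition iid_copies (R : realType)
    (disp : measure_display) (Omega : measurableType disp)
    (P : probability Omega R) (I : finType) (X : I -> {RV P >-> R})
    (disp0 : measure_display) (Omega0 : measurableType disp0)
    (P0 : probability Omega0 R) (xi : {RV P0 >-> R}) : Prop :=
  mutually_independent X /\
  forall i (B : set R), measurable B -> distribution P (X i) B = distribution P0 xi B.

Definition is_density (R : realType) (disp : measure_display)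
    (Omega : measurableType disp) (P : probability Omega R)
    (xi : {RV P >-> R}) (h : R -> R) : Prop :=
  [/\ measurable_fun setT h, forall x, 0 <= h x &
      forall B : set R, measurable B ->
        distribution P xi B = (\int[lebesgue_measure]_(x in B) (h x)%:E)%E].

Definition noise_radius_const (R : realType) (m : nat) (mu : R) (rstar : nat) : R :=
  72 * (5 * m%:R + 1) ^+ 2 * 3 ^+ m * mu ^+ m * rstar%:R.

(* [radius] is meant to be [noise_radius_const m mu rstar * (6 * gamma + delta)].
   That [gamma] is real forces the moment of order 2 + eps to be finite. *)
Definition noise_condition_I (R : realType) (disp : measure_display)
    (Omega : measurableType disp) (P : probability Omega R)
    (xi : {RV P >-> R}) (eps gamma b0 radius : R) : Prop :=
  [/\ 0 < eps,
      gamma%:E = ('E_P[fun w => (`|xi w| `^ (2 + eps))%R] `^ (2 + eps)^-1)%E,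
      0 < b0 &
      exists h : R -> R,
        [/\ is_density xi h,
            forall x, h x = h (- x) &
            forall x, `|x| <= radius -> b0^-1 <= h x]].

(** ** Consistency of the index encodings *)

Lemma insert_idx_eq (m : nat) (d : 'I_m -> nat) (k : 'I_m)
    (j : 'I_(d k)) (c : cidx d k) : insert_idx j c k = j.
Proof.
rewrite /insert_idx ffunE; case: eq_comparable => [e|/(_ erefl)//].
by rewrite (eq_irrelevance (esym e) (erefl k)).
Qed.

Lemma insert_idx_neq (m : nat) (d : 'I_m -> nat) (k : 'I_m)
    (j : 'I_(d k)) (c : cidx d k) (i : {i : 'I_m | i != k}) :
  insert_idx j c (val i) = c i.
Proof.
rewrite /insert_idx ffunE; case: i => i ni; rewrite [val _]/=.
case: eq_comparable => [e|n]; first by case/eqP: (ni).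
by rewrite (bool_irrelevance (introN eqP n) ni).
Qed.

Lemma insert_idx_bij (m : nat) (d : 'I_m -> nat) (k : 'I_m) :
  bijective (fun p : 'I_(d k) * cidx d k => insert_idx p.1 p.2).
Proof.
exists (fun w : tidx d =>
  (w k, [ffun i : {i : 'I_m | i != k} => w (val i)] : cidx d k)).
  move=> [j c] /=; rewrite insert_idx_eq; congr (_, _).
  by apply/ffunP => i; rewrite ffunE insert_idx_neq.
move=> w /=; apply/ffunP => i; have [->|ni] := eqVneq i k.
  by rewrite insert_idx_eq.
apply: (etrans (insert_idx_neq _ _ (exist (fun x => x != k) i ni))).
by rewrite ffunE.
Qed.

Lemma prod_except (R : Type) (idx : R) (op : Monoid.com_law idx)
    (m : nat) (k : 'I_m) (F : 'I_m -> R) :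
  \big[op/idx]_(i : {i : 'I_m | i != k}) F (val i) =
  \big[op/idx]_(i < m | i != k) F i.
Proof.
rewrite [RHS](reindex_omap val (insub : _ -> option {i : 'I_m | i != k})).
  by apply: eq_bigl => i; rewrite valK eqxx andbT; case: i.
by move=> i ni; rewrite insubT.
Qed.

Lemma card_cidx (m : nat) (d : 'I_m -> nat) (k : 'I_m) :
  #|cidx d k| = codim d k.
Proof.
rewrite card_dep_ffun foldrE big_map big_enum /= /codim.
rewrite -(prod_except _ k d).
by apply: eq_bigr => i _; rewrite card_ord.
Qed.

Lemma matricize_multilinear_mul (R : realType) (m : nat) (d e : 'I_m -> nat)
    (C : tensor R e) (A : forall k, 'M[R]_(d k, e k)) (k : 'I_m) :
  matricize k (multilinear_mul C A) =
  A k *m matricize k C *m (kron_except k A)^T.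
Proof.
apply/matrixP => j c; rewrite !mxE ffunE.
rewrite (reindex (fun p : 'I_(e k) * cidx e k => insert_idx p.1 p.2));
  last exact/onW_bij/insert_idx_bij.
rewrite -(pair_bigA _ (fun a b => C (insert_idx a b) *
  \prod_i A i (insert_idx j (enum_val c) i) (insert_idx a b i))) /=.
rewrite exchange_big (reindex (@enum_val _ (mem (cidx e k)))) /=; last first.
  exact/onW_bij/enum_val_bij.
apply: eq_bigr => b _; rewrite !mxE big_distrl /=; apply: eq_bigr => a _.
rewrite !mxE (bigD1 k) //= !insert_idx_eq mulrA (mulrC (C _)); congr (_ * _).
rewrite -(prod_except _ k (fun i => A i (insert_idx j (enum_val c) i)
  (insert_idx a (enum_val b) i))).
by apply: eq_bigr => i _; rewrite !insert_idx_neq.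
Qed.

(* Main.v *)
(* P = P_T is an orthogonal projection, hence a contraction, and a gradient has
   entries in [-1, 1]; this gives |P G|_F <= sqrt d^*. With Pi the projector
   onto the row space of M_k(T), the mode-k rows satisfy
   M_k(P G) = M_k(G) Pi + U U^T M_k(P G) (1 - Pi), and incoherence bounds U.
   The lower bounds of part (1) only need that every row of the noise has l1 norm
   at most 3 d_k^- gamma, which follows by truncating at d_k^- gamma and applying
   Chernoff to the truncated part.

   For part (2), the differences T - T^* and the vectors P G have Tucker rank at
   most 2 r, hence are parametrized by DoF(2 r) numbers. Chaining over lattice nets
   of the parameters, with Hoeffding increments, bounds uniformly the deviation of
   the loss difference and of the linear statistic <Z, rho'(Xi)>; peeling over dyadic
   shells makes the first bound proportional to |Z|_F^2. The expected loss
   difference is at least 9 |Z|_F^2 / (10 b0): symmetrizing the noise gives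
   nonnegative second differences, which are integrated explicitly where the
   density is at least 1 / b0. *)
Require Import Defs.
From HB Require Import structures.
From mathcomp Require Import all_boot all_order all_algebra.
From mathcomp Require Import all_classical all_reals all_analysis.
From mathcomp Require Import measurable_realfun.
From mathcomp Require Import ring lra zify.

Set Implicit Arguments.
Unset Strict Implicit.
Unset Printing Implicit Defensive.

Import Order.TTheory GRing.Theory Num.Theory.

Local Open Scope classical_set_scope.
Local Open Scope ring_scope.

(** * Tensor algebra and the tangent projection *)

(** The bounds quantify over uncountably many tensors, and no supremum is shown measurable: every
    probabilistic step yields one measurable exceptional set, and the inequalities hold at each
    outcome outside it. In part (2) [G] depends on the noise also through [T]. It is split into the
    loss gradient at [Tstar], centred by symmetry of the noise, and a remainder of norm at most
    [delta^-1] times that of [T - Tstar]. The nets live on the parameters (core and factors), in a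
    norm for which the parametrization is Lipschitz with constant [m + 1] whatever the ranks;
    covering numbers come from counting integer points instead of comparing volumes. Doubling the
    ranks multiplies [DoF] by at most [2 ^ m], whence the [2 ^+ m] inside [c1]. The radius acts
    twice: being at least [72 * delta] it yields the factor 9/10 in the expected loss difference,
    and through the total mass of the density it forces [b0] above [delta], which turns a lower
    bound on the distance to [Tstar] in units of [b0] into one in units of [delta]. *)

Section Dot.
Variables (R : realType) (I : finType).
Implicit Types x y z : I -> R.

Definition dot x y : R := \sum_i x i * y i.

Lemma dotC x y : dot x y = dot y x.
Proof. by apply: eq_bigr => i _; rewrite mulrC. Qed.

Lemma dot_ge0 x : 0 <= dot x x.
Proof. by apply: sumr_ge0 => i _; rewrite -expr2 sqr_ge0. Qed.

Lemma normF_dot x : normF x = Num.sqrt (dot x x).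
Proof. by congr Num.sqrt; apply: eq_bigr => i _; rewrite expr2. Qed.

Lemma normF_ge0 x : 0 <= normF x.
Proof. exact: sqrtr_ge0. Qed.

Lemma normF_sq x : normF x ^+ 2 = dot x x.
Proof. by rewrite normF_dot sqr_sqrtr // dot_ge0. Qed.

Lemma dotDl x y z : dot (fun i => x i + y i) z = dot x z + dot y z.
Proof. by rewrite -big_split; apply: eq_bigr => i _; rewrite mulrDl. Qed.

Lemma dotDr x y z : dot z (fun i => x i + y i) = dot z x + dot z y.
Proof. by rewrite dotC dotDl !(dotC z). Qed.

Lemma dotZl a x y : dot (fun i => a * x i) y = a * dot x y.
Proof. by rewrite mulr_sumr; apply: eq_bigr => i _; rewrite mulrA. Qed.

Lemma dotZr a x y : dot y (fun i => a * x i) = a * dot y x.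
Proof. by rewrite dotC dotZl dotC. Qed.

Lemma CauchySchwarz x y : dot x y ^+ 2 <= dot x x * dot y y.
Proof.
have [y0|yn0] := eqVneq (dot y y) 0.
  suff -> : dot x y = 0 by rewrite expr0n y0 mulr0.
  apply: big1 => i _; suff -> : y i = 0 by rewrite mulr0.
  move/eqP: y0; rewrite psumr_eq0 => [|j _]; last by rewrite -expr2 sqr_ge0.
  by move/allP/(_ i (mem_index_enum i)) => /= /eqP; nra.
have ypos : 0 < dot y y by rewrite lt_neqAle eq_sym yn0 dot_ge0.
have := dot_ge0 (fun i => dot y y * x i + (- dot x y) * y i).
rewrite dotDl !dotDr !dotZl !dotZr (dotC y x).
move=> h; rewrite -subr_ge0 -(pmulr_rge0 _ ypos); apply: le_trans h _.
by rewrite le_eqVlt; apply/orP; left; apply/eqP; ring.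
Qed.

Lemma dot_le x y : `|dot x y| <= normF x * normF y.
Proof.
rewrite -(ler_pXn2r (ltn0Sn 1)) ?nnegrE ?mulr_ge0 ?normF_ge0 //.
by rewrite real_normK ?num_real // exprMn !normF_sq CauchySchwarz.
Qed.

Lemma normF_eq x y : x =1 y -> normF x = normF y.
Proof. by move=> e; congr Num.sqrt; apply: eq_bigr => i _; rewrite e. Qed.

Lemma normFD x y : normF (fun i => x i + y i) <= normF x + normF y.
Proof.
rewrite -(ler_pXn2r (ltn0Sn 1)) ?nnegrE ?addr_ge0 ?normF_ge0 //.
rewrite normF_sq dotDl !dotDr sqrrD !normF_sq (dotC y x).
by have := le_trans (ler_norm _) (dot_le x y); lra.
Qed.

Lemma normFZ a x : normF (fun i => a * x i) = `|a| * normF x.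
Proof.
by rewrite !normF_dot dotZl dotZr mulrA -expr2 sqrtrM ?sqr_ge0 // sqrtr_sqr.
Qed.

Lemma normF_le x (t : R) : 0 <= t -> (normF x <= t) = (dot x x <= t ^+ 2).
Proof.
move=> t0; rewrite -normF_sq ler_pXn2r // ?nnegrE ?normF_ge0 //.
Qed.

Lemma coord_le_normF x i : `|x i| <= normF x.
Proof.
rewrite -(ler_pXn2r (ltn0Sn 1)) ?nnegrE ?normF_ge0 // normF_sq /dot (bigD1 i) //=.
rewrite real_normK ?num_real // -expr2 lerDl sumr_ge0 // => j _.
by rewrite -expr2 sqr_ge0.
Qed.

Lemma normF_unit_bounded x : (forall i, `|x i| <= 1) -> normF x <= Num.sqrt #|I|%:R.
Proof.
move=> h; apply: ler_wsqrtr; rewrite -sum1_card natr_sum; apply: ler_sum => i _.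
by rewrite -(real_normK (num_real _)) expr_le1.
Qed.

Lemma normF_le_sum x : normF x <= \sum_i `|x i|.
Proof.
rewrite normF_le ?sumr_ge0 // expr2 mulr_suml; apply: ler_sum => i _.
rewrite (le_trans (ler_norm _)) // normrM ler_wpM2l //.
by rewrite (bigD1 i) //= lerDl sumr_ge0.
Qed.

End Dot.

Section MatrixDot.
Variable R : realType.

Definition mdot n p (A B : 'M[R]_(n, p)) : R := \sum_i \sum_j A i j * B i j.

Lemma mdot_dot n p (A B : 'M[R]_(n, p)) :
  mdot A B = dot (fun q : 'I_n * 'I_p => A q.1 q.2) (fun q => B q.1 q.2).
Proof. by rewrite /mdot pair_bigA. Qed.

Lemma mdot_tr n p (A B : 'M[R]_(n, p)) : mdot A B = \tr (A^T *m B).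
Proof.
rewrite /mdot exchange_big; apply: eq_bigr => j _; rewrite mxE.
by apply: eq_bigr => i _; rewrite mxE.
Qed.

Lemma mdotC n p (A B : 'M[R]_(n, p)) : mdot A B = mdot B A.
Proof. by rewrite !mdot_dot dotC. Qed.

Lemma mdot_ge0 n p (A : 'M[R]_(n, p)) : 0 <= mdot A A.
Proof. by rewrite mdot_dot dot_ge0. Qed.

Lemma mdotT n p (A B : 'M[R]_(n, p)) : mdot A^T B^T = mdot A B.
Proof.
rewrite /mdot exchange_big; apply: eq_bigr => i _; apply: eq_bigr => j _.
by rewrite !mxE.
Qed.

Lemma mdotDl n p (A B C : 'M[R]_(n, p)) : mdot (A + B) C = mdot A C + mdot B C.
Proof. by rewrite !mdot_tr linearD mulmxDl mxtraceD. Qed.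

Lemma mdotDr n p (A B C : 'M[R]_(n, p)) : mdot C (A + B) = mdot C A + mdot C B.
Proof. by rewrite !mdot_tr mulmxDr mxtraceD. Qed.

Lemma mdotZl n p a (A B : 'M[R]_(n, p)) : mdot (a *: A) B = a * mdot A B.
Proof. by rewrite !mdot_tr linearZ /= -scalemxAl mxtraceZ. Qed.

Lemma mdotZr n p a (A B : 'M[R]_(n, p)) : mdot B (a *: A) = a * mdot B A.
Proof. by rewrite mdotC mdotZl mdotC. Qed.

Lemma mdot0l n p (A : 'M[R]_(n, p)) : mdot 0 A = 0.
Proof. by rewrite mdot_tr trmx0 mul0mx mxtrace0. Qed.

Lemma mdotMl n p q (P : 'M[R]_(n, q)) (A : 'M[R]_(q, p)) (B : 'M[R]_(n, p)) :
  mdot (P *m A) B = mdot A (P^T *m B).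
Proof. by rewrite !mdot_tr trmx_mul mulmxA. Qed.

Lemma mdotMr n p q (A : 'M[R]_(n, q)) (Q : 'M[R]_(q, p)) (B : 'M[R]_(n, p)) :
  mdot (A *m Q) B = mdot A (B *m Q^T).
Proof. by rewrite !mdot_tr trmx_mul -mulmxA mxtrace_mulC mulmxA. Qed.

Lemma mdot_rows n p (A B : 'M[R]_(n, p)) : mdot A B = \sum_i mdot (row i A) (row i B).
Proof.
apply: eq_bigr => i _; rewrite /mdot big_ord1; apply: eq_bigr => j _.
by rewrite !mxE.
Qed.

Lemma normF_row n p (A : 'M[R]_(n, p)) i : normF (A i) = Num.sqrt (mdot (row i A) (row i A)).
Proof.
rewrite normF_dot; congr Num.sqrt; rewrite /mdot big_ord1.
by apply: eq_bigr => j _; rewrite !mxE.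
Qed.

Definition mnorm n p (A : 'M[R]_(n, p)) : R := Num.sqrt (mdot A A).

Lemma mnorm_ge0 n p (A : 'M[R]_(n, p)) : 0 <= mnorm A.
Proof. exact: sqrtr_ge0. Qed.

Lemma mnorm_sq n p (A : 'M[R]_(n, p)) : mnorm A ^+ 2 = mdot A A.
Proof. by rewrite sqr_sqrtr ?mdot_ge0. Qed.

Lemma mnorm_normF n p (A : 'M[R]_(n, p)) :
  mnorm A = normF (fun q : 'I_n * 'I_p => A q.1 q.2).
Proof. by rewrite normF_dot -mdot_dot. Qed.

Lemma mdot_le n p (A B : 'M[R]_(n, p)) : mdot A B <= mnorm A * mnorm B.
Proof. by rewrite !mnorm_normF mdot_dot (le_trans (ler_norm _)) ?dot_le. Qed.

Lemma mnormD n p (A B : 'M[R]_(n, p)) : mnorm (A + B) <= mnorm A + mnorm B.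
Proof.
rewrite !mnorm_normF; apply: le_trans (normFD _ _).
by rewrite le_eqVlt; apply/orP; left; apply/eqP/normF_eq => q; rewrite mxE.
Qed.

Lemma mnormZ n p a (A : 'M[R]_(n, p)) : mnorm (a *: A) = `|a| * mnorm A.
Proof.
by rewrite !mnorm_normF -normFZ; apply: normF_eq => q; rewrite mxE.
Qed.

Lemma mnorm_mul n p q (A : 'M[R]_(n, p)) (B : 'M[R]_(p, q)) :
  mnorm (A *m B) <= mnorm A * mnorm B.
Proof.
rewrite -(ler_pXn2r (ltn0Sn 1)) ?nnegrE ?mulr_ge0 ?mnorm_ge0 // exprMn !mnorm_sq.
rewrite -(mdotT B B) /mdot mulr_suml; apply: ler_sum => i _.
rewrite mulr_sumr; apply: ler_sum => j _; rewrite -expr2 mxE.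
apply: le_trans (CauchySchwarz (fun k => A i k) (fun k => B k j)) _.
by apply: ler_pM; rewrite ?dot_ge0 //; apply: ler_sum => k _; rewrite ?mxE.
Qed.

Lemma mnorm_contract n p q (A : 'M[R]_(n, p)) (P : 'M[R]_(n, q)) :
  P^T *m P = 1%:M -> mnorm (P^T *m A) <= mnorm A.
Proof.
move=> PP; apply: ler_wsqrtr.
set B := P^T *m A.
have h : mdot (P *m B) A = mdot B B by rewrite mdotMl.
have h2 : mdot (P *m B) (P *m B) = mdot B B by rewrite mdotMl mulmxA PP mul1mx.
have := mdot_ge0 (A + (- 1) *: (P *m B)).
rewrite mdotDl !mdotDr.
rewrite !mdotZl !mdotZr h2 (mdotC A) h.
lra.
Qed.

End MatrixDot.

(** The index types depend on [i], so the sums are first moved to the tagged union, where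
    distributivity over ordinary functions applies, and then brought back through [fprod]. *)
Lemma prod_sum_dffun (R : comNzRingType) (I : finType) (T : I -> finType)
    (F : forall i, T i -> R) :
  \prod_i \sum_(j : T i) F i j = \sum_(v : {dffun forall i, T i}) \prod_i F i (v i).
Proof.
have -> : \prod_i \sum_(j : T i) F i j =
    \prod_i \sum_(u in tagged_with T i) untag 0 (F i) u.
  by apply: eq_bigr => i _; rewrite (big_tag (fun i => F i)).
rewrite bigA_distr_big_dep.
transitivity (\sum_(t : fprod T) \prod_i [ffun j => F i j] (t i)).
  rewrite (big_fprod (times := *%R) 1 _ (fun i : I => [ffun j : T i => F i j])).
  apply: eq_bigr => g _; apply: eq_bigr => i _.
  by rewrite /untag; case: eqP => // p; rewrite ffunE.
rewrite [RHS](reindex (@dffun_of_fprod _ T)) /=; last first.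
  exact/onW_bij/dffun_of_fprod_bij.
by apply: eq_bigr => t _; apply: eq_bigr => i _; rewrite !ffunE.
Qed.

(** * Multilinear products, Kronecker products and matricizations *)

Section Multilinear.
Variables (R : realType) (m : nat).
Implicit Types d e f : 'I_m -> nat.

Lemma mlm_comp d e f (C : tensor R f) (A : forall k, 'M[R]_(e k, f k))
    (B : forall k, 'M[R]_(d k, e k)) :
  multilinear_mul (multilinear_mul C A) B = multilinear_mul C (fun k => B k *m A k).
Proof.
apply/ffunP => w; rewrite !ffunE.
under eq_bigr do rewrite ffunE mulr_suml.
rewrite exchange_big; apply: eq_bigr => v _ /=.
under eq_bigr do rewrite -mulrA -big_split /=.
rewrite -mulr_sumr; congr (_ * _).
under [RHS]eq_bigr do rewrite mxE.
rewrite (prod_sum_dffun (fun k j => B k (w k) j * A k j (v k))).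
by apply: eq_bigr => u _; apply: eq_bigr => k _; rewrite mulrC.
Qed.

Lemma mlm_adj d e (C : tensor R e) (A : forall k, 'M[R]_(d k, e k)) (X : tensor R d) :
  dot (multilinear_mul C A) X = dot C (multilinear_mul X (fun k => (A k)^T)).
Proof.
rewrite /dot; under eq_bigr do rewrite ffunE mulr_suml.
rewrite exchange_big; apply: eq_bigr => v _; rewrite ffunE mulr_sumr.
apply: eq_bigr => w _; rewrite -mulrA; congr (_ * _); rewrite mulrC; congr (_ * _).
by apply: eq_bigr => k _; rewrite mxE.
Qed.

Lemma mlm1 d (C : tensor R d) : multilinear_mul C (fun k => 1%:M) = C.
Proof.
apply/ffunP => w; rewrite ffunE (bigD1 w) //= big1 ?mulr1 => [|k _]; last first.
  by rewrite mxE eqxx.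
rewrite big1 ?addr0 // => v vw.
have [k vk] : exists k, v k != w k.
  by apply/existsP; apply: contraNT vw => /existsPn h; apply/eqP/ffunP => k; apply/eqP/negbNE/h.
by rewrite (bigD1 k) //= mxE eq_sym (negbTE vk) mul0r mulr0.
Qed.

Lemma mlmDl d e (C C' : tensor R e) (A : forall k, 'M[R]_(d k, e k)) :
  multilinear_mul (C + C') A = multilinear_mul C A + multilinear_mul C' A.
Proof.
apply/ffunP => w; rewrite !ffunE -big_split; apply: eq_bigr => v _.
by rewrite ffunE mulrDl.
Qed.

Lemma mlmZl d e (a : R) (C : tensor R e) (A : forall k, 'M[R]_(d k, e k)) :
  multilinear_mul [ffun v => a * C v] A = [ffun w => a * multilinear_mul C A w].
Proof.
apply/ffunP => w; rewrite !ffunE mulr_sumr; apply: eq_bigr => v _.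
by rewrite ffunE mulrA.
Qed.

Lemma eq_mlm d e (C : tensor R e) (A B : forall k, 'M[R]_(d k, e k)) :
  (forall k, A k = B k) -> multilinear_mul C A = multilinear_mul C B.
Proof.
move=> h; apply/ffunP => w; rewrite !ffunE; apply: eq_bigr => v _.
by congr (_ * _); apply: eq_bigr => k _; rewrite h.
Qed.

Lemma mlm_mode_sub d e (C : tensor R e) (A B D : forall k, 'M[R]_(d k, e k)) (l : 'I_m) :
  (forall k, k != l -> A k = B k) -> (forall k, k != l -> D k = B k) ->
  D l = A l - B l ->
  multilinear_mul C A - multilinear_mul C B = multilinear_mul C D.
Proof.
move=> hA hD hl; apply/ffunP => w; rewrite !ffunE -sumrB; apply: eq_bigr => v _.
rewrite -mulrBr; congr (_ * _).
rewrite (bigD1 l) //= [X in _ - X](bigD1 l) //= [RHS](bigD1 l) //= hl !mxE mulrBl.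
congr (_ * _ - _ * _); first by apply: eq_bigr => k kl; rewrite hA // hD.
by apply: eq_bigr => k kl; rewrite hD.
Qed.

Lemma kron_mul d e f (k : 'I_m) (B : forall k, 'M[R]_(d k, e k))
    (A : forall k, 'M[R]_(e k, f k)) :
  kron_except k B *m kron_except k A = kron_except k (fun i => B i *m A i).
Proof.
apply/matrixP => a b; rewrite !mxE.
under [RHS]eq_bigr do rewrite mxE.
rewrite (prod_sum_dffun (fun (i : {i | i != k}) j => B (val i) ((enum_val a : cidx d k) i) j
   * A (val i) j ((enum_val b : cidx f k) i))).
rewrite [RHS](reindex (@enum_val _ (mem (cidx e k)))) /=; last first.
  exact/onW_bij/enum_val_bij.
by apply: eq_bigr => c _; rewrite !mxE -big_split.
Qed.

Lemma kron_tr d e (k : 'I_m) (A : forall k, 'M[R]_(d k, e k)) :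
  (kron_except k A)^T = kron_except k (fun i => (A i)^T).
Proof.
by apply/matrixP => a b; rewrite !mxE; apply: eq_bigr => i _; rewrite mxE.
Qed.

Lemma eq_kron d e (k : 'I_m) (A B : forall k, 'M[R]_(d k, e k)) :
  (forall i, i != k -> A i = B i) -> kron_except k A = kron_except k B.
Proof.
move=> h; apply/matrixP => a b; rewrite !mxE; apply: eq_bigr => i _.
by rewrite h //; case: i.
Qed.

Lemma kron1 d (k : 'I_m) : kron_except k (fun i => (1%:M : 'M[R]_(d i))) = 1%:M.
Proof.
apply/matrixP => a b; rewrite !mxE; have [->|ab] := eqVneq a b.
  by rewrite big1 // => i _; rewrite mxE eqxx.
have [i hi] : exists i, (enum_val a : cidx d k) i != (enum_val b : cidx d k) i.
  apply/existsP; apply: contraNT ab => /existsPn h; apply/eqP/enum_val_inj/ffunP => i.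
  exact/eqP/negbNE/h.
by rewrite (bigD1 i) //= mxE (negbTE hi) mul0r.
Qed.

Lemma kron_mode0 d e (k l : 'I_m) (A : forall k, 'M[R]_(d k, e k)) :
  l != k -> A l = 0 -> kron_except k A = 0.
Proof.
move=> lk h; apply/matrixP => a b; rewrite !mxE.
by rewrite (bigD1 (exist (fun x => x != k) l lk)) //= h mxE mul0r.
Qed.

Lemma dot_matricize d (k : 'I_m) (S T : tensor R d) :
  dot S T = mdot (matricize k S) (matricize k T).
Proof.
rewrite /dot (reindex (fun p : 'I_(d k) * cidx d k => insert_idx p.1 p.2));
  last exact/onW_bij/insert_idx_bij.
rewrite -(pair_bigA _ (fun j c => S (insert_idx j c) * T (insert_idx j c))) /=.
apply: eq_bigr => j _; rewrite (reindex (@enum_val _ (mem (cidx d k)))) /=; last first.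
  exact/onW_bij/enum_val_bij.
by apply: eq_bigr => b _; rewrite !mxE.
Qed.

Lemma matricize_inj d (k : 'I_m) : injective (@matricize R m d k).
Proof.
move=> S T /matrixP h; apply/ffunP => w.
have [g _ hg] := @insert_idx_bij m d k.
rewrite -(hg w); have := h (g w).1 (enum_rank (g w).2).
by rewrite !mxE !enum_rankK.
Qed.

Lemma matricizeD d (k : 'I_m) (S T : tensor R d) :
  matricize k (S + T) = matricize k S + matricize k T.
Proof. by apply/matrixP => a b; rewrite !mxE ffunE. Qed.

Lemma matricizeB d (k : 'I_m) (S T : tensor R d) :
  matricize k (S - T) = matricize k S - matricize k T.
Proof. by apply/matrixP => a b; rewrite !mxE !ffunE. Qed.

Lemma matricize_sum d (k : 'I_m) (J : finType) (P : pred J) (F : J -> tensor R d) :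
  matricize k (\sum_(j | P j) F j) = \sum_(j | P j) matricize k (F j).
Proof.
elim/big_rec2: _ => [|j x y _ <-]; last by rewrite matricizeD.
by apply/matrixP => a b; rewrite !mxE ffunE.
Qed.

End Multilinear.

(** * Operator norm bounds and partial isometries *)

Section OperatorBound.
Variable R : realType.

(** An operator norm bound tested on matrices of every width in Frobenius norm, so that it applies
    directly to matricizations, whose columns are indexed by the other modes. The sign of [t] is
    part of it because the inequality alone does not give it when [X] can only be zero. *)
Definition opb (t : R) n p (A : 'M[R]_(n, p)) : Prop :=
  0 <= t /\ forall q (X : 'M[R]_(p, q)), mnorm (A *m X) <= t * mnorm X.

(** The squared norm of [A^T *m Y] is the inner product of [Y] with [A *m (A^T *m Y)], hence at most
    [mnorm Y * (t * mnorm (A^T *m Y))]; one factor cancels. *)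
Lemma opb_tr t n p (A : 'M[R]_(n, p)) : opb t A -> opb t A^T.
Proof.
move=> [t0 h]; split=> // q Y.
have h1 : mnorm (A^T *m Y) ^+ 2 <= mnorm Y * (t * mnorm (A^T *m Y)).
  rewrite mnorm_sq mdotMl trmxK; apply: le_trans (mdot_le _ _) _.
  by rewrite ler_wpM2l ?mnorm_ge0 ?h.
have [->|n0] := eqVneq (mnorm (A^T *m Y)) 0; first by rewrite mulr_ge0 ?mnorm_ge0.
have np : 0 < mnorm (A^T *m Y) by rewrite lt_neqAle eq_sym n0 mnorm_ge0.
by rewrite -(ler_pM2r np) -expr2 (le_trans h1) // mulrCA mulrA.
Qed.

Lemma opb_mul s t n p q (A : 'M[R]_(n, p)) (B : 'M[R]_(p, q)) :
  opb s A -> opb t B -> opb (s * t) (A *m B).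
Proof.
move=> [s0 hA] [t0 hB]; split=> [|r X]; first exact: mulr_ge0.
rewrite -mulmxA; apply: le_trans (hA _ _) _.
by rewrite -mulrA ler_wpM2l.
Qed.

Lemma opb_le s t n p (A : 'M[R]_(n, p)) : s <= t -> opb s A -> opb t A.
Proof.
move=> st [s0 h]; split=> [|q X]; first exact: le_trans st.
by apply: le_trans (h _ _) _; rewrite ler_wpM2r ?mnorm_ge0.
Qed.

Lemma opb_mnorm n p (A : 'M[R]_(n, p)) : opb (mnorm A) A.
Proof. by split=> [|q X]; [exact: mnorm_ge0 | exact: mnorm_mul]. Qed.

Lemma opbZ t a n p (A : 'M[R]_(n, p)) : 0 <= a -> opb t A -> opb (a * t) (a *: A).
Proof.
move=> a0 [t0 h]; split=> [|q X]; first exact: mulr_ge0.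
by rewrite -scalemxAl mnormZ ger0_norm // -mulrA ler_wpM2l.
Qed.

Lemma opbB s t n p (A B : 'M[R]_(n, p)) : opb s A -> opb t B -> opb (s + t) (A - B).
Proof.
move=> [s0 hA] [t0 hB]; split=> [|q X]; first exact: addr_ge0.
rewrite mulmxBl -scaleN1r; apply: le_trans (mnormD _ _) _.
by rewrite mnormZ normrN1 mul1r mulrDl lerD.
Qed.

Lemma opb_entry t n p (A : 'M[R]_(n, p)) i j : opb t A -> `|A i j| <= t.
Proof.
move=> [t0 h]; have := h 1 (delta_mx j 0).
rewrite -colE => h1; apply: le_trans (_ : mnorm (col j A) <= _).
  have := coord_le_normF (fun q : 'I_n * 'I_1 => col j A q.1 q.2) (i, 0).
  by rewrite -mnorm_normF mxE.
apply: le_trans h1 _; rewrite -[leRHS]mulr1 ler_wpM2l // -[leRHS]sqrtr1 ler_wsqrtr //.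
rewrite /mdot (bigD1 j) //= big_ord1 !mxE !eqxx mulr1 big1 ?addr0 // => i' ij.
by rewrite big_ord1 !mxE (negbTE ij) mulr0.
Qed.

(** The identity makes [U^T *m U] an orthogonal projector [Q], and the squared norm of [U *m X] is
    that of [Q *m X], at most that of [X] by Pythagoras. *)
Lemma partial_isometry_opb n p (U : 'M[R]_(n, p)) : U *m U^T *m U = U -> opb 1 U.
Proof.
move=> h; split=> // q X; rewrite mul1r; apply: ler_wsqrtr.
rewrite mdotMl mulmxA; set Q := U^T *m U.
have Qt : Q^T = Q by rewrite /Q trmx_mul trmxK.
have QQ : Q *m Q = Q by rewrite /Q -mulmxA (mulmxA U) h.
have e : mdot (Q *m X) (Q *m X) = mdot X (Q *m X) by rewrite mdotMl Qt mulmxA QQ.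
have := mdot_ge0 (X + (-1) *: (Q *m X)).
by rewrite mdotDl !mdotDr !mdotZl !mdotZr e (mdotC _ X); lra.
Qed.

(** Gram-Schmidt from the last column to the first, where a column already in the span of its
    successors is replaced by a zero column. This gives as many columns as [B] has even if they are
    dependent or outnumber the rows, as may happen for the doubled ranks [2 * r k]; orthonormal
    columns would then not exist. *)
Lemma partial_isometry_exists n p (B : 'M[R]_(n, p)) :
  exists U : 'M[R]_(n, p), U *m U^T *m U = U /\ U *m U^T *m B = B.
Proof.
elim: p B => [|p IH].
  by move=> B; exists 0; split; apply/matrixP => i [].
rewrite -[p.+1]add1n => B.
have [U [hU hB]] := IH (rsubmx B).
set b := lsubmx B.
have Beq : B = row_mx b (rsubmx B) by rewrite hsubmxK.
set P := U *m U^T.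
have Pt : P^T = P by rewrite /P trmx_mul trmxK.
have PP : P *m P = P by rewrite /P mulmxA hU.
pose c := b - P *m b.
have Pc : P *m c = 0 by rewrite /c mulmxBr mulmxA PP subrr.
have cU : c^T *m U = 0.
  by rewrite /c linearB /= trmx_mul Pt mulmxBl -mulmxA hU subrr.
have [c0|cn0] := eqVneq (mdot c c) 0.
  have cz : c = 0.
    apply/matrixP => i j; rewrite ord1 [RHS]mxE; apply/eqP.
    rewrite -normr_le0.
    have := coord_le_normF (fun q : 'I_n * 'I_1 => c q.1 q.2) (i, 0).
    by rewrite -mnorm_normF /mnorm c0 sqrtr0.
  have bP : P *m b = b by apply/esym/eqP; rewrite -subr_eq0 -/c cz.
  exists (row_mx (0 : 'cV_n) U); rewrite tr_row_mx mul_row_col mul0mx add0r -/P.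
  rewrite mul_mx_row mulmx0 hU; split=> //.
  by rewrite [X in _ *m X]Beq mul_mx_row hB bP -Beq.
set a := mdot c c in cn0.
have apos : 0 < a by rewrite lt_neqAle eq_sym cn0 mdot_ge0.
have cc : c^T *m c = a%:M.
  by rewrite [LHS]mx11_scalar /a mdot_tr /mxtrace big_ord1.
pose u := (Num.sqrt a)^-1 *: c.
have uu : u *m u^T = a^-1 *: (c *m c^T).
  rewrite /u linearZ /= -scalemxAl -scalemxAr scalerA; congr (_ *: _).
  by rewrite -expr2 exprVn sqr_sqrtr // ltW.
have Pu : P *m u = 0 by rewrite -scalemxAr Pc scaler0.
have uut x : c^T *m x = 0 -> u *m u^T *m (x : 'M[R]_(n, p)) = 0.
  by move=> h; rewrite uu -scalemxAl -mulmxA h mulmx0 scaler0.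
have cP : c^T *m P = 0 by rewrite -Pt -trmx_mul Pc trmx0.
have uuc : u *m u^T *m c = c.
  by rewrite uu -scalemxAl -mulmxA cc mul_mx_scalar scalerA mulVf // scale1r.
exists (row_mx u U); rewrite tr_row_mx mul_row_col -/P; split.
  rewrite mul_mx_row !mulmxDl Pu addr0 hU uut // add0r.
  by congr row_mx; rewrite {2}/u -scalemxAr uuc.
rewrite [X in _ *m X]Beq [RHS]Beq mul_mx_row !mulmxDl hB.
congr row_mx; last by rewrite uut ?add0r // -hB -/P mulmxA cP mul0mx.
have bE : b = c + P *m b by rewrite subrK.
by rewrite {1}bE mulmxDr uuc mulmxA uu -scalemxAl -mulmxA cP mulmx0 scaler0 mul0mx addr0 -bE.
Qed.

(** A rank factorization places the columns of [A] in the span of [e] vectors, to which the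
    Gram-Schmidt construction is applied. *)
Lemma rank_partial_isometry n p e (A : 'M[R]_(n, p)) : (\rank A <= e)%N ->
  exists U : 'M[R]_(n, e), U *m U^T *m U = U /\ U *m U^T *m A = A.
Proof.
move=> re; have [U [hU hB]] := partial_isometry_exists (col_ebase A *m pid_mx (\rank A) : 'M[R]_(n, e)).
exists U; split=> //.
have e1 : A = (col_ebase A *m pid_mx (\rank A) : 'M[R]_(n, e)) *m (pid_mx (\rank A) *m row_ebase A).
  rewrite -{1}[A]mulmx_ebase -!mulmxA; congr (_ *m _); rewrite mulmxA; congr (_ *m _).
  by rewrite mul_pid_mx minnn (minn_idPr re).
by rewrite [in LHS]e1 mulmxA hB -e1.
Qed.

End OperatorBound.

Section MultilinearNorm.
Variables (R : realType) (m : nat).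
Implicit Types d e : 'I_m -> nat.

Lemma normF_matricize d (k : 'I_m) (T : tensor R d) : normF T = mnorm (matricize k T).
Proof. by rewrite normF_dot (dot_matricize k). Qed.

Lemma normF_ffunD (I : finType) (x y : {ffun I -> R}) : normF (x + y) <= normF x + normF y.
Proof.
apply: le_trans (normFD x y); rewrite le_eqVlt; apply/orP; left; apply/eqP.
by apply: normF_eq => i; rewrite ffunE.
Qed.

Lemma normF_ffunN (I : finType) (x : {ffun I -> R}) : normF (- x) = normF x.
Proof.
by rewrite !normF_dot; congr Num.sqrt; apply: eq_bigr => i _; rewrite ffunE mulrNN.
Qed.

Lemma normF_ffunB (I : finType) (x y : {ffun I -> R}) : normF (x - y) <= normF x + normF y.
Proof. by rewrite -(normF_ffunN y) normF_ffunD. Qed.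

Lemma normF_dist (I : finType) (x y z : {ffun I -> R}) :
  normF (x - z) <= normF (x - y) + normF (y - z).
Proof. by rewrite -{1}(subrK y x) -addrA normF_ffunD. Qed.

(** Restricting the product to a list of modes allows induction on the modes; a single mode is an
    ordinary matrix product after matricization. The factors are square so that the tensor format
    never changes along the way. *)
Definition on_modes d (s : seq 'I_m) (A : forall k, 'M[R]_(d k)) (k : 'I_m) : 'M[R]_(d k) :=
  if k \in s then A k else 1%:M.

Lemma matricize_mode d (C : tensor R d) (l : 'I_m) (A : forall k, 'M[R]_(d k)) :
  matricize l (multilinear_mul C (on_modes [:: l] A)) = A l *m matricize l C.
Proof.
rewrite matricize_multilinear_mul (@eq_kron _ _ _ _ l _ (fun k => 1%:M)).
  by rewrite kron1 trmx1 mulmx1 /on_modes mem_seq1 eqxx.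
by move=> i il; rewrite /on_modes mem_seq1 (negbTE il).
Qed.

Lemma on_modes_cons d (C : tensor R d) l s (A : forall k, 'M[R]_(d k)) : l \notin s ->
  multilinear_mul C (on_modes (l :: s) A) =
  multilinear_mul (multilinear_mul C (on_modes s A)) (on_modes [:: l] A).
Proof.
move=> ls; rewrite mlm_comp; apply: eq_mlm => k; rewrite /on_modes inE mem_seq1.
by have [->|] := eqVneq k l; rewrite ?(negbTE ls) ?mulmx1 ?mul1mx.
Qed.

Lemma on_modes_all d (A : forall k, 'M[R]_(d k)) k : on_modes (enum 'I_m) A k = A k.
Proof. by rewrite /on_modes mem_enum. Qed.

Lemma mlm_fix d (C : tensor R d) (P : forall k, 'M[R]_(d k)) :
  (forall k, P k *m matricize k C = matricize k C) -> multilinear_mul C P = C.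
Proof.
move=> h; rewrite -(eq_mlm C (on_modes_all P)).
elim: (enum _) (enum_uniq 'I_m) => [|l s IH] /=; first by rewrite -{2}(mlm1 C).
case/andP=> ls us; rewrite on_modes_cons // IH //.
by apply: (@matricize_inj _ _ _ l); rewrite matricize_mode.
Qed.

Lemma normF_mlm_square d (C : tensor R d) (A : forall k, 'M[R]_(d k)) (t : 'I_m -> R) :
  (forall k, opb (t k) (A k)) -> normF (multilinear_mul C A) <= (\prod_k t k) * normF C.
Proof.
move=> h; rewrite -(eq_mlm C (on_modes_all A)) -big_enum /=.
elim: (enum _) (enum_uniq 'I_m) => [|l s IH] /=.
  by rewrite big_nil mul1r -{2}(mlm1 C).
case/andP=> ls us; rewrite on_modes_cons // big_cons (normF_matricize l) matricize_mode.
have [t0 hl] := h l; apply: le_trans (hl _ _) _.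
by rewrite -normF_matricize -mulrA ler_wpM2l // IH.
Qed.

(** Rectangular factors reduce to square ones: by adjunction the squared norm is the inner product
    of [C] with its product by the matrices [(A k)^T *m A k], which have the bounds [t k * t k]. *)
Lemma normF_mlm d e (C : tensor R e) (A : forall k, 'M[R]_(d k, e k)) (t : 'I_m -> R) :
  (forall k, opb (t k) (A k)) -> normF (multilinear_mul C A) <= (\prod_k t k) * normF C.
Proof.
move=> h; have t0 k : 0 <= t k by have [] := h k.
rewrite normF_le ?mulr_ge0 ?prodr_ge0 ?normF_ge0 //.
rewrite mlm_adj mlm_comp; apply: le_trans (ler_norm _) _; apply: le_trans (dot_le _ _) _.
rewrite exprMn (expr2 (normF C)) mulrC mulrA ler_wpM2r ?normF_ge0 //.
rewrite expr2 -big_split /=; apply: normF_mlm_square => k.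
exact: opb_mul (opb_tr (h k)) (h k).
Qed.

Lemma normF_mlm_le1 d e (C : tensor R e) (A : forall k, 'M[R]_(d k, e k)) :
  (forall k, opb 1 (A k)) -> normF (multilinear_mul C A) <= normF C.
Proof. by move=> /normF_mlm/le_trans -> //; rewrite big1 // mul1r. Qed.

(** The core is [Z] multiplied by the transposed partial isometries, which are contractions;
    multiplying back fixes [Z] because each projector fixes the columns of its matricization. *)
Lemma rank_le_decomp d e (Z : tensor R d) : rank_le e Z ->
  exists (C : tensor R e) (U : forall k, 'M[R]_(d k, e k)),
  [/\ multilinear_mul C U = Z, forall k, opb 1 (U k) & normF C <= normF Z].
Proof.
move=> hr; pose U k := projT1 (cid (rank_partial_isometry (hr k))).
have hU k : U k *m (U k)^T *m U k = U k /\ U k *m (U k)^T *m matricize k Z = matricize k Z.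
  exact: projT2 (cid (rank_partial_isometry (hr k))).
have oU k : opb 1 (U k) by apply: partial_isometry_opb; have [] := hU k.
exists (multilinear_mul Z (fun k => (U k)^T)), U; split=> //.
  by rewrite mlm_comp mlm_fix // => k; have [] := hU k.
by apply: normF_mlm_le1 => k; apply: opb_tr.
Qed.

(** Telescoping: replacing the core costs [eta], and so does each of the [m] factors, because all
    the others stay contractions. *)
Lemma mlm_lipschitz d e (C C' : tensor R e) (U U' : forall k, 'M[R]_(d k, e k)) (eta : R) :
  normF C' <= 1 -> (forall k, opb 1 (U k)) -> (forall k, opb 1 (U' k)) ->
  normF (C - C') <= eta -> (forall k, opb eta (U k - U' k)) ->
  normF (multilinear_mul C U - multilinear_mul C' U') <= (m%:R + 1) * eta.
Proof.
move=> C1 oU oU' hC hU.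
(* Hybrid factors: the first [j] modes already use [U'], the others still [U]. *)
pose H j := fun k : 'I_m => if (k < j)%N then U' k else U k.
have oH j k : opb 1 (H j k) by rewrite /H; case: ifP.
have step j : (j <= m)%N ->
    normF (multilinear_mul C' (H 0%N) - multilinear_mul C' (H j)) <= j%:R * eta.
  elim: j => [_|j IH jm].
    by rewrite subrr mul0r normF_dot /dot big1 ?sqrtr0 // => i _; rewrite ffunE mulr0.
  pose l := Ordinal jm.
  apply: le_trans (normF_dist _ (multilinear_mul C' (H j)) _) _.
  rewrite -natr1 mulrDl mul1r; apply: lerD; first exact/IH/ltnW.
  pose D k := if k == l then U k - U' k else H j k.
  rewrite (@mlm_mode_sub _ _ _ _ C' (H j) (H j.+1) D l); first last.
  - by rewrite /D eqxx /H /= ltnn ltnSn.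
  - move=> k kl; rewrite /D (negbTE kl) /H ltnS (leq_eqVlt k).
    by have -> : (k == j :> nat) = false by apply/negbTE; apply: contra kl => /eqP e'; apply/eqP/val_inj.
  - move=> k kl; rewrite /H ltnS (leq_eqVlt k).
    by have -> : (k == j :> nat) = false by apply/negbTE; apply: contra kl => /eqP e'; apply/eqP/val_inj.
  apply: le_trans (@normF_mlm _ _ _ _ (fun k => if k == l then eta else 1) _) _.
    by move=> k; rewrite /D; case: eqP.
  rewrite (bigD1 l) //= eqxx big1 ?mulr1 => [|k kl]; last by rewrite (negbTE kl).
  have e0 : 0 <= eta by have [] := hU l.
  by rewrite -[leRHS]mulr1 ler_wpM2l.
have -> : multilinear_mul C U - multilinear_mul C' U' =
    multilinear_mul (C - C') U + (multilinear_mul C' (H 0%N) - multilinear_mul C' (H m)).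
  have e1 : multilinear_mul C' (H 0%N) = multilinear_mul C' U by apply: eq_mlm.
  have e2 : multilinear_mul C' (H m) = multilinear_mul C' U'.
    by apply: eq_mlm => k; rewrite /H ltn_ord.
  have e3 := mlmDl (C - C') C' U; rewrite subrK in e3.
  by rewrite e1 e2 e3 addrA.
apply: le_trans (normF_ffunD _ _) _; rewrite addrC mulrDl mul1r.
apply: lerD; first exact: step.
by apply: le_trans (normF_mlm_le1 _ oU) _.
Qed.

End MultilinearNorm.

(** * Moore-Penrose inverse and tangent projection *)

Section Pinv.
Variable R : realType.

Lemma mnorm_eq0 n p (A : 'M[R]_(n, p)) : mdot A A = 0 -> A = 0.
Proof.
move=> A0; apply/matrixP => i j; rewrite [RHS]mxE; apply/eqP; rewrite -normr_le0.
have := coord_le_normF (fun q : 'I_n * 'I_p => A q.1 q.2) (i, j).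
by rewrite -mnorm_normF /mnorm A0 sqrtr0.
Qed.

(** For full row rank [B *m B^T] is invertible, since the Frobenius norm is definite, and
    [B^T *m invmx (B *m B^T)] satisfies the four Penrose equations. Existence is all that the choice
    operator in [pinv] asks for. *)
Lemma pinv_row_free n p (B : 'M[R]_(n, p)) : row_free B -> is_pinv B (Defs.pinv B).
Proof.
move=> fB; apply: (@xgetPex _ 0 [set B' | is_pinv B B']).
have uB : B *m B^T \in unitmx.
  rewrite -row_free_unit; apply: inj_row_free => v vB.
  suff /eqP : v *m B = 0 by rewrite mulmx_free_eq0 // => /eqP.
  by apply: mnorm_eq0; rewrite mdotMr -mulmxA vB mdotC mdot0l.
exists (B^T *m invmx (B *m B^T)).
have BB : B *m (B^T *m invmx (B *m B^T)) = 1%:M by rewrite mulmxA mulmxV.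
split.
- by rewrite BB mul1mx.
- by rewrite -mulmxA BB mulmx1.
- by rewrite BB trmx1.
- by rewrite !trmx_mul trmxK trmx_inv trmx_mul trmxK mulmxA.
Qed.

End Pinv.

Section Tangent.
Variables (R : realType) (m : nat) (d r : 'I_m -> nat).
Variables (T : tensor R d) (C : tensor R r) (U : forall k, 'M[R]_(d k, r k)).
Hypotheses (rT : tucker_rank r T) (dT : tucker_decomp T C U).
Variable G : tensor R d.

Local Notation Q k := (U k *m (U k)^T).
Local Notation K k := (kron_except k U).
Local Notation B k := (matricize k C).
Local Notation X k := (matricize k G).
Local Notation Bp k := (Defs.pinv (matricize k C)).
Local Notation P := (tangent_proj C U G).

Definition row_projector k : 'M[R]_(#|cidx d k|) :=
  K k *m (Bp k *m B k) *m (K k)^T.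
Local Notation Pi := row_projector.

Let UU k : (U k)^T *m U k = 1%:M.
Proof. by have [] := dT. Qed.

Let KK k : (K k)^T *m K k = 1%:M.
Proof. by rewrite kron_tr kron_mul -[RHS](kron1 R r); apply: eq_kron. Qed.

(** Here the Tucker rank being exactly [r] enters: the matricization of [T] has rank [r k] and
    factors through that of [C], which has only [r k] rows. *)
Let pB k : is_pinv (B k) (Bp k).
Proof.
apply: pinv_row_free; rewrite /row_free eqn_leq rank_leq_row /=.
have := rT k; have [_ ->] := dT.
rewrite matricize_multilinear_mul => {1}<-.
by apply: leq_trans (mxrankM_maxl _ _) (mxrankM_maxr _ _).
Qed.

Let PiK k : (Pi k)^T = Pi k.
Proof.
by have [_ _ _ h] := pB k; rewrite /Pi trmx_mul trmxK trmx_mul h !mulmxA.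
Qed.

Let PiPi k : Pi k *m Pi k = Pi k.
Proof.
have [h _ _ _] := pB k.
by rewrite /Pi -!mulmxA (mulmxA (K k)^T) KK mul1mx (mulmxA (B k)) (mulmxA (B k *m _)) h.
Qed.

Let main := multilinear_mul G (fun k => Q k).
Let term l := multilinear_mul C
    (fun i => if i == l then tangent_factor C U G i else U i).

Let PE : P = main + \sum_l term l. Proof. by []. Qed.

Let UW l : (U l)^T *m tangent_factor C U G l = 0.
Proof.
by rewrite /tangent_factor !mulmxA mulmxBr mulmx1 mulmxA UU mul1mx subrr !mul0mx.
Qed.

Let Mmain k : matricize k main = U k *m ((U k)^T *m X k *m (K k *m (K k)^T)).
Proof.
rewrite matricize_multilinear_mul kron_tr -!mulmxA; congr (_ *m (_ *m (_ *m _))).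
rewrite kron_tr kron_mul; apply: eq_kron => i _.
by rewrite trmx_mul trmxK.
Qed.

Let Mterm k : matricize k (term k) = (1%:M - Q k) *m X k *m Pi k.
Proof.
rewrite matricize_multilinear_mul eqxx (@eq_kron _ _ _ _ k _ U); last first.
  by move=> i /negbTE ->.
by rewrite /tangent_factor /Pi !mulmxA.
Qed.

(** The mode-[l] Kronecker factor of the product is the transpose of
    [(U l)^T *m tangent_factor C U G l], which vanishes. *)
Let Mother k l : l != k -> matricize k (term l) *m Pi k = 0.
Proof.
move=> lk; rewrite matricize_multilinear_mul -mulmxA kron_tr /Pi !mulmxA.
rewrite -(mulmxA _ (kron_except _ _) (K k)) kron_mul (@kron_mode0 _ _ _ _ k l) //.
  by rewrite mulmx0 !mul0mx.
by rewrite eqxx -[LHS]trmxK trmx_mul trmxK UW trmx0.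
Qed.

(** The main term supplies [Q k *m X k *m Pi k] and the term of mode [k] supplies its complement
    [(1%:M - Q k) *m X k *m Pi k]. *)
Lemma matricize_tangent_proj_row k : matricize k P *m Pi k = X k *m Pi k.
Proof.
rewrite PE matricizeD matricize_sum (bigD1 k) //= !mulmxDl mulmx_suml big1.
  rewrite addr0 Mterm Mmain -(mulmxA _ (Pi k)) PiPi -!mulmxA.
  have -> : K k *m ((K k)^T *m Pi k) = Pi k.
    by rewrite /Pi !mulmxA -(mulmxA (K k) _ (K k)) KK mulmx1.
  by rewrite mulmxBl mul1mx -mulmxA addrC subrK.
by move=> l lk; apply: Mother.
Qed.

(** All summands except the one of mode [k] keep [U k] as their mode-[k] factor. Both the rank bound
    [2 * r k] and the incoherence bound on rows rest on this splitting. *)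
Lemma matricize_tangent_proj_col k :
  exists Z, matricize k P = U k *m Z + (1%:M - Q k) *m X k *m Pi k.
Proof.
exists ((U k)^T *m X k *m (K k *m (K k)^T) + \sum_(l | l != k) B k *m
  (kron_except k (fun i => if i == l then tangent_factor C U G i else U i))^T).
rewrite PE matricizeD matricize_sum (bigD1 k) //= Mmain Mterm mulmxDr -!addrA.
congr (_ + _); rewrite addrC; congr (_ + _); rewrite mulmx_sumr.
apply: eq_bigr => l lk; rewrite matricize_multilinear_mul eq_sym (negbTE lk).
by rewrite mulmxA.
Qed.

Lemma mlm_sum e (A : forall k, 'M[R]_(e k, d k)) (J : finType) (F : J -> tensor R d) :
  multilinear_mul (\sum_j F j) A = \sum_j multilinear_mul (F j) A.
Proof.
elim/big_rec2: _ => [|j x y _ <-]; last by rewrite mlmDl.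
by apply/ffunP => w; rewrite !ffunE big1 // => v _; rewrite ffunE mul0r.
Qed.

Lemma dot_ffunDr (x y : tensor R d) (z : tidx d -> R) : dot z (x + y) = dot z x + dot z y.
Proof. by rewrite -dotDr; apply: eq_bigr => i _; rewrite ffunE. Qed.

Lemma dot_sumr (J : finType) (F : J -> tensor R d) (z : tidx d -> R) : dot z (\sum_j F j) = \sum_j dot z (F j).
Proof.
elim/big_rec2: _ => [|j x y _ <-]; last by rewrite dot_ffunDr.
by apply: big1 => i _; rewrite ffunE mulr0.
Qed.

(** The tensor [P] is a sum of terms, and against each of them [P] and [G] have the same inner
    product. This identity already gives contraction and the splitting of the gradient used
    later. *)
Lemma dot_tangent_proj : dot P P = dot P G.
Proof.
have QT k : (Q k)^T = Q k by rewrite trmx_mul trmxK.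
have hmain : dot P main = dot G main.
  rewrite dotC mlm_adj PE mlmDl mlm_sum big1 ?addr0.
    rewrite dotC mlm_comp (@eq_mlm _ _ _ _ G _ (fun k => Q k)) => [|k]; first exact: dotC.
    by rewrite QT mulmxA -(mulmxA (U k)) UU mulmx1.
  move=> l _; rewrite mlm_comp; apply/ffunP => w; rewrite !ffunE big1 // => v _.
  by rewrite (bigD1 l) //= eqxx QT -mulmxA UW mulmx0 mxE mul0r mulr0.
have hterm l : dot P (term l) = dot G (term l).
  by rewrite !(dot_matricize l) Mterm -{1 2}PiK -!mdotMr matricize_tangent_proj_row.
have e (Z : tensor R d) : dot Z P = dot Z main + \sum_l dot Z (term l).
  by rewrite PE dot_ffunDr dot_sumr.
by rewrite e hmain (eq_bigr _ (fun l _ => hterm l)) -e dotC.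
Qed.

Lemma normF_tangent_proj : normF P <= normF G.
Proof.
have [->|P0] := eqVneq (normF P) 0; first exact: normF_ge0.
have Pp : 0 < normF P by rewrite lt_neqAle eq_sym P0 normF_ge0.
rewrite -(ler_pM2l Pp) -expr2 normF_sq dot_tangent_proj.
exact: le_trans (ler_norm _) (dot_le _ _).
Qed.

Lemma rank_le_tangent_proj : rank_le (fun k => 2 * r k)%N P.
Proof.
move=> k; have [Z ->] := matricize_tangent_proj_col k.
apply: leq_trans (mxrank_add _ _) _; rewrite mul2n -addnn; apply: leq_add.
  by apply: leq_trans (mxrankM_maxl _ _) (rank_leq_col _).
rewrite /Pi !mulmxA -(mulmxA _ (B k)).
apply: leq_trans (mxrankM_maxr _ _) _.
by apply: leq_trans (mxrankM_maxl _ _) (rank_leq_row _).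
Qed.

Lemma incoherence_row mu k j : incoherence U <= mu -> (0 < r k)%N ->
  mdot (row j (U k)) (row j (U k)) <= mu * (r k)%:R / (d k)%:R.
Proof.
move=> hmu rk; have dk : (0 < d k)%N by apply: leq_ltn_trans (ltn_ord j).
rewrite ler_pdivlMr ?ltr0n // -ler_pdivrMr ?ltr0n //; apply: le_trans hmu.
apply: le_trans (le_bigmax _ _ k); rewrite ler_pM2r ?invr_gt0 ?ltr0n // ler_pM2r ?ltr0n //.
rewrite -mnorm_sq ler_pXn2r ?nnegrE ?mnorm_ge0 //.
  by rewrite /mnorm -normF_row; apply: (le_bigmax _ (fun j => normF (U k j))).
exact: bigmax_ge_id.
Qed.

(** The squared row norms of [U k] sum to [r k], so the largest of its [d k] rows reaches the
    average [r k / d k]. *)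
Lemma incoherence_ge1 k : (0 < r k)%N -> 1 <= incoherence U.
Proof.
move=> rk; have h : mdot (U k) (U k) = (r k)%:R.
  by rewrite mdot_tr UU mxtrace1.
have rR : 0 < (r k)%:R :> R by rewrite ltr0n.
have dk : (0 < d k)%N.
  rewrite lt0n; apply/negP => /eqP d0; move: rR; rewrite -h /mdot big1 ?ltxx //.
  by case=> i hi _; exfalso; rewrite d0 in hi.
have dR : 0 < (d k)%:R :> R by rewrite ltr0n.
rewrite -(ler_pM2r rR) mul1r -{1}h mdot_rows.
apply: le_trans (ler_sum _ (fun j _ => incoherence_row j (lexx _) rk)) _.
rewrite sumr_const card_ord -[leLHS]mulr_natr mulfVK //; exact: lt0r_neq0.
Qed.

(** The row splits orthogonally along [Pi k]. The squared parts are at most [codim d k] and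
    [mu * r k * codim d k]; the second uses incoherence against the full norm of [P]. Since
    [mu * r k] is at least 1, three times the second bound covers the sum. *)
Lemma tangent_proj_row_bound mu k j : (forall w, `|G w| <= 1) -> incoherence U <= mu ->
  (0 < r k)%N ->
  normF (matricize k P j) <= Num.sqrt (3 * mu * (r k)%:R * (codim d k)%:R).
Proof.
move=> G1 hmu rk; rewrite normF_row; apply: ler_wsqrtr.
have dk : (0 < d k)%N by apply: leq_ltn_trans (ltn_ord j).
have mu1 : 1 <= mu by apply: le_trans hmu; apply: incoherence_ge1 rk.
have r1 : 1 <= (r k)%:R :> R by rewrite ler1n.
pose Y := matricize k P *m (1%:M - Pi k).
have YE : Y = Q k *m Y.
  have [Z hZ] := matricize_tangent_proj_col k.
  have PiN : Pi k *m (1%:M - Pi k) = 0 by rewrite mulmxBr mulmx1 PiPi subrr.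
  rewrite /Y hZ mulmxDl -(mulmxA _ (Pi k)) PiN mulmx0 addr0.
  by rewrite !mulmxA -(mulmxA (U k) (U k)^T (U k)) UU mulmx1.
have PY : matricize k P = X k *m Pi k + Y.
  by rewrite -matricize_tangent_proj_row /Y mulmxBr mulmx1 addrC subrK.
have oPi : opb 1 (Pi k).
  by apply: partial_isometry_opb; rewrite PiK !PiPi.
have oPi' : opb 1 (1%:M - Pi k).
  have eT : (1%:M - Pi k)^T = 1%:M - Pi k by rewrite linearB /= trmx1 PiK.
  have eI : (1%:M - Pi k) *m (1%:M - Pi k) = 1%:M - Pi k.
    by rewrite mulmxBl mul1mx mulmxBr mulmx1 PiPi subrr subr0.
  by apply: partial_isometry_opb; rewrite eT !eI.
have contr q (A : 'M[R]_(q, _)) (S : 'M[R]_(#|cidx d k|)) : opb 1 S -> mdot (A *m S) (A *m S) <= mdot A A.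
  move=> oS; rewrite -mdotT -(mdotT A A) -!mnorm_sq ler_pXn2r ?nnegrE ?mnorm_ge0 //.
  by rewrite trmx_mul; have [_ h] := opb_tr oS; apply: le_trans (h _ _) _; rewrite mul1r.
have -> : mdot (row j (matricize k P)) (row j (matricize k P)) =
   mdot (row j (X k *m Pi k)) (row j (X k *m Pi k)) + mdot (row j Y) (row j Y).
  rewrite PY raddfD /= mdotDl !mdotDr.
  have -> : mdot (row j (X k *m Pi k)) (row j Y) = 0.
    rewrite !row_mul mdotMr -mulmxA PiK mulmxBl mul1mx PiPi subrr mulmx0.
    by rewrite mdotC mdot0l.
  rewrite (mdotC (row j Y)).
  have -> : mdot (row j (X k *m Pi k)) (row j Y) = 0.
    rewrite !row_mul mdotMr -mulmxA PiK mulmxBl mul1mx PiPi subrr mulmx0.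
    by rewrite mdotC mdot0l.
  by rewrite addr0 add0r.
have b1 : mdot (row j (X k *m Pi k)) (row j (X k *m Pi k)) <= (codim d k)%:R.
  rewrite row_mul; apply: le_trans (contr _ _ _ oPi) _.
  rewrite -mnorm_sq /mnorm -normF_row -card_cidx -[leRHS]sqr_sqrtr //.
  rewrite ler_pXn2r ?nnegrE ?sqrtr_ge0 ?normF_ge0 //.
  have := @normF_unit_bounded _ _ (X k j); rewrite card_ord; apply => i.
  by rewrite mxE.
have b2 : mdot (row j Y) (row j Y) <= mu * (r k)%:R * (codim d k)%:R.
  rewrite YE !row_mul -mulmxA -mnorm_sq.
  set u := row j (U k).
  have h1 : mnorm (row j (U k) *m ((U k)^T *m Y)) <= mnorm u * mnorm Y.
    apply: le_trans (mnorm_mul _ _) _; rewrite ler_wpM2l ?mnorm_ge0 //.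
    exact: mnorm_contract.
  apply: (@le_trans _ _ ((mnorm u * mnorm Y) ^+ 2)).
    by rewrite ler_pXn2r ?nnegrE ?mulr_ge0 ?mnorm_ge0.
  rewrite exprMn !mnorm_sq.
  have -> : mu * (r k)%:R * (codim d k)%:R = mu * (r k)%:R / (d k)%:R * (dim_prod d)%:R.
    rewrite /dim_prod (bigD1 k) //= natrM mulrA mulfVK // pnatr_eq0; lia.
  apply: ler_pM; rewrite ?mdot_ge0 ?incoherence_row //.
  apply: le_trans (contr _ _ _ oPi') _; rewrite -dot_matricize -normF_sq.
  have -> : (dim_prod d)%:R = Num.sqrt (dim_prod d)%:R ^+ 2 :> R by rewrite sqr_sqrtr.
  rewrite ler_pXn2r ?nnegrE ?sqrtr_ge0 ?normF_ge0 //.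
  apply: le_trans normF_tangent_proj _; apply: le_trans (normF_unit_bounded G1) _.
  rewrite card_dep_ffun foldrE big_map big_enum /=.
  by rewrite (eq_bigr _ (fun i _ => card_ord _)).
apply: le_trans (lerD b1 b2) _; rewrite -(mulrA 3).
have t1 : 1 <= mu * (r k)%:R by apply: mulr_ege1.
move: (mu * _) t1 => t t1; have c0 : 0 <= (codim d k)%:R :> R by [].
by nra.
Qed.

End Tangent.

(** * Lattice nets *)
Section Net.
Variables (R : realType) (I : finType) (nb : R -> {ffun I -> R} -> Prop) (K : R).
Hypothesis nbB : forall s t x y, nb s x -> nb t y -> nb (s + t) (x - y).
Hypothesis nbZ : forall a t x, 0 <= a -> nb t x -> nb (a * t) [ffun i => a * x i].
Hypothesis nbW : forall s t x, s <= t -> nb s x -> nb t x.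
Hypothesis nb_bounded : forall t x i, nb t x -> `|x i| <= t.
Hypothesis nb_small : forall x : {ffun I -> R}, (forall i, `|x i| <= 1) -> nb K x.

Let nb00 : nb 0 0.
Proof.
have := @nbZ 0 K 0 (lexx _) (nb_small _); rewrite mul0r.
suff -> : [ffun i => 0 * (0 : {ffun I -> R}) i] = 0 :> {ffun I -> R}.
  by apply => i; rewrite ffunE normr0 ler01.
by apply/ffunP => i; rewrite !ffunE mul0r.
Qed.

Let nbN t x : nb t x -> nb t (- x).
Proof. by move=> /(nbB nb00); rewrite add0r sub0r. Qed.

Let nbD s t x y : nb s x -> nb t y -> nb (s + t) (x + y).
Proof. by move=> hx /nbN/(nbB hx); rewrite opprK. Qed.

Section Lattice.
Variable M : nat.

(** Integer points of a box, stored with the shift [M] to form a finite type. Throughout, [nb t x]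
    reads as an abstract norm of [x] being at most [t]; counting lattice points of its balls
    replaces Lebesgue volume. *)
Definition lattice_pt (w : {ffun I -> 'I_(2 * M).+1}) : {ffun I -> R} :=
  [ffun i => (w i : nat)%:R - M%:R].

Lemma lattice_ptE w i : lattice_pt w i = (w i : nat)%:R - M%:R.
Proof. by rewrite ffunE. Qed.

Definition lattice_ball t : {set {ffun I -> 'I_(2 * M).+1}} :=
  [set w | `[< nb t (lattice_pt w) >]].

Lemma in_lattice_ball t w : reflect (nb t (lattice_pt w)) (w \in lattice_ball t).
Proof. by rewrite inE; apply: asboolP. Qed.

(* Two lattice points of the double ball in the same class modulo 4 differ by
   4 times a lattice point of the ball. *)
Lemma lattice_ball_double t :
  (#|lattice_ball (2 * t)| <= 4 ^ #|I| * #|lattice_ball t|)%N.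
Proof.
pose f (w : {ffun I -> 'I_(2 * M).+1}) : {ffun I -> 'I_4} := [ffun i => inord (w i %% 4)].
rewrite -sum1_card (partition_big f predT) //=.
rewrite -[X in (_ <= X ^ _ * _)%N](card_ord 4) -card_ffun -sum_nat_const.
apply: leq_sum => c _; rewrite sum1_card.
set F := (X in (#|X| <= _)%N).
have [w0 w0F|F0] := pickP F; last by rewrite (eq_card0 F0).
pose g (w : {ffun I -> 'I_(2 * M).+1}) : {ffun I -> 'I_(2 * M).+1} :=
  [ffun i => inord ((w i + 4 * M - w0 i) %/ 4)].
have gE w i : w \in F -> (4 * g w i = w i + 4 * M - w0 i)%N.
  move=> wF; have /andP[_ /eqP fw] := wF; have /andP[_ /eqP fw0] := w0F.
  have : (w i %% 4 = w0 i %% 4)%N.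
    have /ffunP/(_ i) : f w = f w0 by rewrite fw fw0.
    by rewrite !ffunE => /(congr1 val) /=; rewrite !inordK // ltn_mod.
  have := ltn_ord (w i); have := ltn_ord (w0 i); rewrite ffunE.
  move: (nat_of_ord (w i)) (nat_of_ord (w0 i)) => a b ha hb e.
  by rewrite inordK; lia.
have ginj : {in F &, injective g}.
  move=> u v uF vF e; apply/ffunP => i; apply: val_inj => /=.
  have := gE u i uF; have := gE v i vF; rewrite e.
  move: (ltn_ord (u i)) (ltn_ord (v i)) (ltn_ord (w0 i)).
  by move: (nat_of_ord (u i)) (nat_of_ord (v i)) (nat_of_ord (w0 i)) (nat_of_ord _); lia.
rewrite -(card_in_imset ginj); apply: subset_leq_card; apply/fintype.subsetP => _ /imsetP[w wF ->].
apply/in_lattice_ball.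
have /andP[/in_lattice_ball hw _] := wF; have /andP[/in_lattice_ball hw0 _] := w0F.
have q0 : 0 <= 4^-1 :> R by lra.
have := nbZ q0 (nbB hw hw0); rewrite (_ : 4^-1 * (2 * t + 2 * t) = t); last by field.
congr nb; apply/ffunP => i; rewrite !ffunE.
have := gE w i wF; have := ltn_ord (w0 i) => h /(congr1 (fun n => n%:R : R)).
rewrite natrM natrB; last by lia.
by rewrite natrD natrM ffunE; lra.
Qed.

Lemma lattice_ball_double_iter t j :
  (#|lattice_ball (2 ^+ j * t)| <= 4 ^ (#|I| * j) * #|lattice_ball t|)%N.
Proof.
elim: j => [|j IH]; first by rewrite expr0 mul1r muln0 expn0 mul1n.
rewrite exprS -mulrA; apply: leq_trans (lattice_ball_double _) _.
by rewrite mulnS expnD -mulnA leq_pmul2l ?expn_gt0.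
Qed.

(** A maximal [2 * t]-separated subset [X] of the ball of radius [a] covers it by maximality. The
    points [x - b], with [b] in the ball of radius [t], are distinct for distinct pairs by
    separation, which gives the count; [a + t <= M] keeps them inside the box. *)
Lemma lattice_packing a t : 0 <= t -> a + t <= M%:R ->
  exists X : {set {ffun I -> 'I_(2 * M).+1}},
    (#|X| * #|lattice_ball t| <= #|lattice_ball (a + t)|)%N /\
    forall w, w \in lattice_ball a ->
      exists2 x, x \in X & nb (2 * t) (lattice_pt w - lattice_pt x).
Proof.
move=> t0 atM.
pose far (x y : {ffun I -> 'I_(2 * M).+1}) := ~~ `[< nb (2 * t) (lattice_pt x - lattice_pt y) >].
pose sep (X : {set {ffun I -> 'I_(2 * M).+1}}) :=
  (X \subset lattice_ball a) && [forall x in X, forall y in X, (x != y) ==> far x y].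
have [X /maxsetP[/andP[XA /forall_inP sepX0] maxX]] : {X | maxset sep X}.
  apply: ex_maxset; exists finset.set0; rewrite /sep finset.sub0set /=.
  by apply/forall_inP => x; rewrite finset.inE.
have sepX x y : x \in X -> y \in X -> x != y -> far x y.
  by move=> xX yX; have /forall_inP/(_ y yX)/implyP := sepX0 x xX.
exists X; split.
  pose g (p : {ffun I -> 'I_(2 * M).+1} * {ffun I -> 'I_(2 * M).+1}) : {ffun I -> 'I_(2 * M).+1} :=
    [ffun i => inord (p.1 i + M - p.2 i)].
  have inX p : (p \in finset.setX X (lattice_ball t)) = (p.1 \in X) && (p.2 \in lattice_ball t).
    by case: p => x b; rewrite finset.in_setX.
  have aux (u v l : nat) : (u <= v + l -> u + l - v < (2 * l).+1)%N by lia.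
  have gE p i : p \in finset.setX X (lattice_ball t) -> (g p i + p.2 i = p.1 i + M)%N.
    case: p => x b; rewrite finset.in_setX /= => /andP[xX /in_lattice_ball hb].
    have /in_lattice_ball hx := fintype.subsetP XA _ xX.
    have h := le_trans (nb_bounded i (nbB hx hb)) atM.
    rewrite !ffunE in h; rewrite ffunE /=.
    have h1 : ((b i : nat) <= x i + M)%N.
      by rewrite -(ler_nat R) natrD; move: h; rewrite ler_norml => /andP[]; lra.
    have h2 : ((x i : nat) <= b i + M)%N.
      by rewrite -(ler_nat R) natrD; move: h; rewrite ler_norml => /andP[]; lra.
    rewrite inordK; first by rewrite subnK.
    exact: aux h2.
  have gR p : p \in finset.setX X (lattice_ball t) ->
      lattice_pt (g p) = lattice_pt p.1 - lattice_pt p.2.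
    move=> hp; apply/ffunP => i; rewrite [RHS]ffunE [X in _ = _ + X]ffunE !lattice_ptE.
    by have /(congr1 (fun n => n%:R : R)) /= := gE p i hp; rewrite !natrD; lra.
  have ginj : {in finset.setX X (lattice_ball t) &, injective g}.
    move=> p q hp hq e.
    have e1 : p.1 = q.1.
      apply/eqP; apply: contraT => pq.
      move: (hp) (hq); rewrite !inX => /andP[p1 /in_lattice_ball p2] /andP[q1 /in_lattice_ball q2].
      have /asboolPn[] := sepX _ _ p1 q1 pq.
      suff -> : lattice_pt p.1 - lattice_pt q.1 = lattice_pt p.2 - lattice_pt q.2.
        by rewrite -[2]natr1 mulrDl mul1r; apply: nbB.
      have /ffunP h := etrans (esym (gR p hp)) (etrans (congr1 lattice_pt e) (gR q hq)).
      by apply/ffunP => i; have := h i; rewrite !ffunE; lra.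
    rewrite [p]surjective_pairing [q]surjective_pairing e1; congr (_, _).
    apply/ffunP => i; apply: val_inj => /=.
    by move: (gE p i hp); rewrite e e1 -(gE q i hq) => /addnI.
  rewrite -finset.cardsX -(card_in_imset ginj); apply: subset_leq_card.
  apply/fintype.subsetP => _ /imsetP[p hp ->]; apply/in_lattice_ball; rewrite gR //.
  move: hp; rewrite inX => /andP[p1 /in_lattice_ball p2].
  by apply: nbB => //; apply/in_lattice_ball; apply: (fintype.subsetP XA).
move=> w wA; apply: contrapT => hno.
have wfar x : x \in X -> ~ nb (2 * t) (lattice_pt w - lattice_pt x).
  by move=> xX h; apply: hno; exists x.
have wX : w \notin X.
  apply/negP => wX; apply: (wfar w wX); rewrite subrr.
  by apply: nbW nb00; rewrite mulr_ge0.
have sepwX : sep (finset.setU (finset.set1 w) X).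
  apply/andP; split.
    by apply/fintype.subsetP => x; rewrite finset.in_setU1 => /orP[/eqP->//|/(fintype.subsetP XA)].
  apply/forall_inP => x xX; apply/forall_inP => y yX; apply/implyP => xy.
  apply/asboolPn => h; move: xX yX; rewrite !finset.in_setU1.
  case/orP=> [/eqP ex|xX]; case/orP=> [/eqP ey|yX].
  - by rewrite ex ey eqxx in xy.
  - by apply: (wfar y yX); rewrite -ex.
  - by apply: (wfar x xX); rewrite -ey -opprB; apply: nbN.
  - by have /asboolPn := sepX x y xX yX xy.
by move: wX; rewrite -(maxX _ sepwX) ?finset.setU11 // finset.subsetU1.
Qed.

End Lattice.

(** The unit ball is scaled by [n], rounded to lattice points at a cost [K] in norm, and covered by
    a packing. What matters for chaining is that the exponent of the net size is linear in [k]. *)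
Lemma net_exists (k : nat) : 0 <= K -> exists S : seq {ffun I -> R},
  [/\ (size S <= 4 ^ (#|I| * (k + 5)))%N,
     forall y, y \in S -> nb 1 y &
     forall x, nb 1 x -> exists2 y, y \in S & nb (2 ^- k) (x - y)].
Proof.
move=> K0.
(* The final distance is [2 * (2 * t + K) / n]. The choice of [t] below makes [4 * t / n] half of
   [2 ^- k], and this [n] makes [2 * K / n] at most the other half. *)
pose n := (Num.truncn (2 ^+ k * (4 * K + 1))).+1.
have nK : 2 ^+ k * (4 * K + 1) <= n%:R by apply/ltW/truncnS_gt.
have pk : 1 <= 2 ^+ k :> R by apply: exprn_ege1; lra.
have nR : 1 <= n%:R :> R by rewrite ler1n.
pose t : R := n%:R * 2 ^- (k + 3).
have tE : n%:R = 2 ^+ (k + 3) * t :> R by rewrite /t mulrC mulfVK // lt0r_neq0 // exprn_gt0.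
have t0 : 0 <= t by rewrite mulr_ge0 // invr_ge0 exprn_ge0.
have tn : t <= n%:R.
  by rewrite tE -[leLHS]mul1r ler_wpM2r // exprn_ege1 //; lra.
have Kn : K <= n%:R by nra.
have t8 : n%:R = 8 * (2 ^+ k * t) by rewrite tE exprD; ring.
have bd : n%:R + K + t <= (3 * n)%:R by rewrite natrM; lra.
have [X [cX covX]] := lattice_packing t0 bd.
(* Packing centres may lie outside the unit ball. Each is exchanged for a point of the unit ball
   near it, or for 0 if there is none, at the price of doubling the distance. *)
pose near x : set {ffun I -> R} :=
  [set p | nb 1 p /\ nb (2 * t + K) ([ffun i => n%:R * p i] - @lattice_pt (3 * n) x)].
exists [seq xget 0 (near x) | x <- enum X]; split.
- rewrite size_map -cardE.
  have V1 : (0 < #|lattice_ball (3 * n) t|)%N.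
    pose w0 : {ffun I -> 'I_(2 * (3 * n)).+1} := [ffun=> inord (3 * n)].
    have w00 : lattice_pt w0 = 0.
      apply/ffunP => i; rewrite lattice_ptE !ffunE inordK ?subrr // ltnS.
      by rewrite leq_pmull.
    by apply/card_gt0P; exists w0; apply/in_lattice_ball; rewrite w00; apply: nbW nb00.
  rewrite -(leq_pmul2r V1); apply: leq_trans cX _.
  (* The radius [2 ^+ (k + 5) * t] equals [4 * n], which exceeds [n + K + t]. *)
  apply: leq_trans (lattice_ball_double_iter _ _ _).
  apply: subset_leq_card; apply/fintype.subsetP => w /in_lattice_ball hw.
  apply/in_lattice_ball; apply: nbW hw; rewrite exprD (_ : 2 ^+ 5 = 32); last by ring.
  have : t <= 2 ^+ k * t by rewrite -[leLHS]mul1r ler_wpM2r.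
  by rewrite mulrAC; lra.
- move=> _ /mapP[x _ ->]; case: (xgetP 0 (near x)) => [p _ [] //|_].
  exact: nbW nb00.
- move=> p hp.
  pose w : {ffun I -> 'I_(2 * (3 * n)).+1} := [ffun i => inord (Num.truncn (n%:R * p i + (3 * n)%:R))].
  have hw i : `|n%:R * p i - lattice_pt w i| <= 1.
    have := nb_bounded i hp; rewrite ler_norml => /andP[p1 p2].
    have q0 : 0 <= n%:R * p i + (3 * n)%:R by rewrite natrM; nra.
    have := truncn_itv q0 => /andP[]; rewrite !ffunE.
    set z := Num.truncn _ => z1 z2.
    rewrite inordK; last by rewrite ltnS -(ler_nat R) (le_trans z1) // !natrM; nra.
    by rewrite -natr1 in z2; rewrite ler_norml; apply/andP; split; lra.
  pose np : {ffun I -> R} := [ffun i => n%:R * p i].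
  have h1 : nb K (np - lattice_pt w).
    by apply: nb_small => i; have := hw i; rewrite !ffunE.
  have hnp : nb (n%:R * 1) np by apply: nbZ hp.
  have wA : w \in lattice_ball (3 * n) (n%:R + K).
    apply/in_lattice_ball; have := nbB hnp h1; rewrite mulr1.
    by rewrite subKr.
  have [x xX hx] := covX _ wA.
  have hnear : near x p.
    split=> //; rewrite -/np.
    have -> : np - lattice_pt x = (np - lattice_pt w) + (lattice_pt w - lattice_pt x).
      by apply/ffunP => i; rewrite !ffunE; ring.
    by rewrite (addrC (2 * t)); apply: nbD.
  exists (xget 0 (near x)); first by apply: map_f; rewrite mem_enum.
  have [q1 q2] := xgetPex 0 (ex_intro _ p hnear : exists x0, near x x0).
  have [_ p2] := hnear.
  set q := xget _ _ in q1 q2 *.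
  have n0 : 0 <= n%:R^-1 :> R by rewrite invr_ge0.
  have := nbZ n0 (nbB p2 q2).
  have -> : [ffun i => n%:R^-1 * (([ffun i => n%:R * p i] - @lattice_pt (3 * n) x) -
      ([ffun i => n%:R * q i] - @lattice_pt (3 * n) x)) i] = p - q.
    apply/ffunP => i; rewrite !ffunE.
    have : n%:R != 0 :> R by rewrite pnatr_eq0.
    by move=> ?; field.
  apply: nbW; rewrite ler_pdivrMl ?ltr0n // ler_pdivlMr ?exprn_gt0 //.
  have : 2 ^+ k * (4 * K) <= n%:R by lra.
  by move: t8; move: (2 ^+ k : R) => z t8 hz; rewrite mulrC; nra.
Qed.

End Net.

(** * Means, concentration and tails *)
Section Transfer.
Local Open Scope ereal_scope.
Variables (R : realType) (d1 d2 : measure_display).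
Variables (T1 : measurableType d1) (T2 : measurableType d2).
Variables (mu : {measure set T1 -> \bar R}) (nu : {measure set T2 -> \bar R}).
Variables (X : T1 -> T2) (w : T1 -> R).
Hypotheses (mX : measurable_fun setT X) (mw : measurable_fun setT w).
Hypothesis w0 : forall x, (0 <= w x)%R.
Hypothesis nuE : forall B, measurable B -> nu B = \int[mu]_(x in X @^-1` B) (w x)%:E.

Import HBNNSimple.

Lemma integral_transfer_nnsfun (h : {nnsfun T2 >-> R}) :
  \int[nu]_y (h y)%:E = \int[mu]_x ((h (X x))%:E * (w x)%:E).
Proof.
have mXB B : measurable B -> measurable (X @^-1` B).
  by move=> mB; rewrite -[_ @^-1` _]setTI; apply: mX.
have mh r : measurable (h @^-1` [set r]) by [].
transitivity (\sum_(k \in range h) \int[nu]_y (k * \1_(h @^-1` [set k]) y)%:E).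
  under eq_integral do rewrite fimfunE -fsumEFin//.
  rewrite ge0_integral_fsum//.
  - by move=> y; exact/measurable_EFinP/measurable_funM.
  - by move=> y x _; rewrite nnfun_muleindic_ge0.
transitivity (\sum_(k \in range h) \int[mu]_x ((k * \1_(h @^-1` [set k]) (X x))%:E * (w x)%:E)); last first.
  rewrite -ge0_integral_fsum//.
  - apply: eq_integral => x _.
    by rewrite [in RHS]fimfunE -fsumEFin// ge0_mule_fsuml // => k; rewrite EFinM nnfun_muleindic_ge0.
  - move=> k; apply: emeasurable_funM; last exact/measurable_EFinP.
    apply/measurable_EFinP; apply: measurable_funM => //.
    by apply: measurableT_comp => //; apply: measurable_indic.
  - by move=> k x _; rewrite mule_ge0 ?lee_fin ?w0 // -lee_fin EFinM nnfun_muleindic_ge0.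
apply: eq_fsbigr => k _; rewrite integralZl_indic_nnsfun// integral_indic// setIT nuE //.
transitivity (\int[mu]_x (k%:E * ((\1_(X @^-1` (h @^-1` [set k])) x)%:E * (w x)%:E))); last first.
  by apply: eq_integral => x _; rewrite EFinM muleA.
have [k0|k0] := ltP k 0%R.
  rewrite (_ : h @^-1` [set k] = set0); last by rewrite preimage_nnfun0.
  rewrite preimage_set0 integral_set0 mule0 integral0_eq // => x _.
  by rewrite indic0 mul0e mule0.
rewrite ge0_integralZl //.
- congr (_ * _); rewrite [LHS]integral_mkcond; apply: eq_integral => x _.
  rewrite patchE indicE; case: ifPn => _; by rewrite ?mul1e ?mul0e.
- apply: emeasurable_funM; last exact/measurable_EFinP.
  by apply/measurable_EFinP; apply: measurable_indic; exact: mXB.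
- by move=> x _; rewrite mule_ge0 ?lee_fin.
Qed.

(** Change of variables for the image under [X] of the measure with density [w]. It serves
    independence, with [w] the product of the remaining factors, and the noise density, with [X] the
    identity and [w] the density. *)
Lemma ge0_integral_transfer (f : T2 -> \bar R) :
  measurable_fun setT f -> (forall y, 0 <= f y) ->
  \int[nu]_y f y = \int[mu]_x (f (X x) * (w x)%:E).
Proof.
move=> mf f0.
pose f_ := nnsfun_approx measurableT mf.
have cvgf y : EFin \o f_^~ y @ \oo --> f y.
  by apply: cvg_nnsfun_approx => // x _; apply: f0.
transitivity (limn (fun n => \int[nu]_y (f_ n y)%:E)).
  rewrite -monotone_convergence//.
  - by apply: eq_integral => y _; apply/esym/cvg_lim => //; apply: cvgf.
  - by move=> n; exact/measurable_EFinP/measurable_funP.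
  - by move=> n y _; rewrite lee_fin.
  - by move=> y _ m n mn; rewrite lee_fin; exact/lefP/nd_nnsfun_approx.
under eq_fun do rewrite integral_transfer_nnsfun.
rewrite -monotone_convergence//.
- apply: eq_integral => x _; apply/cvg_lim => //.
  by apply: cvgeZr => //; apply: cvgf.
- move=> n; apply: emeasurable_funM; last exact/measurable_EFinP.
  by apply/measurable_EFinP; apply: measurableT_comp => //.
- by move=> n x _; rewrite mule_ge0 ?lee_fin.
- move=> x _ m n mn; apply: lee_wpmul2r; rewrite lee_fin ?w0 //.
  exact/lefP/nd_nnsfun_approx.
Qed.

End Transfer.

Section Mean.
Variables (R : realType) (disp : measure_display) (T : measurableType disp).
Variable P : probability T R.

Definition mean (f : T -> R) : R := \int[P]_x f x.

(** Real means are only computed for bounded functions: the loss enters through differences, which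
    are bounded by the shift. Integrability is then automatic. *)
Definition mbdd (f : T -> R) : Prop :=
  measurable_fun setT f /\ exists M, forall x, `|f x| <= M.

Lemma mbdd_integrable f : mbdd f -> P.-integrable setT (EFin \o f).
Proof.
move=> [mf [M hM]]; apply: measurable_bounded_integrable => //.
  by rewrite ltey_eq fin_num_measure.
by exists M; split; [exact: num_real|move=> x Mx y _; exact: le_trans (ltW Mx)].
Qed.

Lemma meanE f : mbdd f -> (mean f)%:E = (\int[P]_x (f x)%:E)%E.
Proof. by move=> /mbdd_integrable h; rewrite /mean /Rintegral fineK // integrable_fin_num. Qed.

Lemma mbddD f g : mbdd f -> mbdd g -> mbdd (fun x => f x + g x).
Proof.
move=> [mf [M hM]] [mg [N hN]]; split; first exact: measurable_funD.
by exists (M + N) => x; rewrite (le_trans (ler_normD _ _)) ?lerD.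
Qed.

Lemma mbddM f g : mbdd f -> mbdd g -> mbdd (fun x => f x * g x).
Proof.
move=> [mf [M hM]] [mg [N hN]]; split; first exact: measurable_funM.
by exists (M * N) => x; rewrite normrM ler_pM.
Qed.

Lemma mbdd_cst c : mbdd (fun=> c).
Proof. by split; [exact: measurable_cst|exists `|c|]. Qed.

Lemma mbddZ c f : mbdd f -> mbdd (fun x => c * f x).
Proof. exact/mbddM/mbdd_cst. Qed.

Lemma mbddB f g : mbdd f -> mbdd g -> mbdd (fun x => f x - g x).
Proof.
move=> hf /(mbddZ (-1)) /(mbddD hf).
by under [X in mbdd X -> _]eq_fun do rewrite mulN1r.
Qed.

Lemma mbdd_expR f : mbdd f -> mbdd (fun x => expR (f x)).
Proof.
move=> [mf [M hM]]; split; first exact: measurableT_comp.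
exists (expR M) => x; rewrite ger0_norm ?expR_ge0 // ler_expR.
exact: le_trans (ler_norm _) (hM x).
Qed.

Lemma mean_cst c : mean (fun=> c) = c.
Proof. by have := expectation_cst P c; rewrite unlock /mean /Rintegral => ->. Qed.

Lemma meanD f g : mbdd f -> mbdd g -> mean (fun x => f x + g x) = mean f + mean g.
Proof. by move=> /mbdd_integrable hf /mbdd_integrable hg; apply: RintegralD. Qed.

Lemma meanZ c f : mbdd f -> mean (fun x => c * f x) = c * mean f.
Proof. by move=> /mbdd_integrable hf; apply: RintegralZl. Qed.

Lemma meanB f g : mbdd f -> mbdd g -> mean (fun x => f x - g x) = mean f - mean g.
Proof. by move=> /mbdd_integrable hf /mbdd_integrable hg; apply: RintegralB. Qed.

Lemma mean_le f g : mbdd f -> mbdd g -> (forall x, f x <= g x) -> mean f <= mean g.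
Proof.
by move=> /mbdd_integrable hf /mbdd_integrable hg fg; apply: le_Rintegral.
Qed.

Lemma mean_ge0 f : (forall x, 0 <= f x) -> 0 <= mean f.
Proof. by move=> h; apply: Rintegral_ge0. Qed.

Lemma mean_norm_le f M : mbdd f -> (forall x, `|f x| <= M) -> `|mean f| <= M.
Proof.
move=> hf hM; rewrite ler_norml; apply/andP; split.
  by rewrite -(mean_cst (- M)); apply: mean_le => //; [exact: mbdd_cst|move=> x; have := hM x; rewrite ler_norml => /andP[]].
by rewrite -(mean_cst M); apply: mean_le => //; [exact: mbdd_cst|move=> x; exact: le_trans (ler_norm _) (hM x)].
Qed.

Lemma mean_indic (A : set T) : measurable A -> mean \1_A = fine (P A).
Proof. by move=> mA; rewrite /mean /Rintegral integral_indic // setIT. Qed.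

Lemma prob_le_mean (A : set T) f : measurable A -> mbdd f -> (forall x, 0 <= f x) ->
  (forall x, A x -> 1 <= f x) -> (P A <= (mean f)%:E)%E.
Proof.
move=> mA hf f0 f1; rewrite -(fineK (fin_num_measure P _ mA)) lee_fin -mean_indic //.
apply: mean_le => //.
  split; first exact: measurable_indic.
  by exists 1 => x; rewrite indicE; case: (_ \in _); rewrite ?normr1 ?normr0.
by move=> x; rewrite indicE; case: (boolP (x \in A)) => // /set_mem /f1.
Qed.

End Mean.

(** * Product rule for bounded functions of independent variables *)

Section Independence.
Variables (R : realType) (disp : measure_display) (Omega : measurableType disp).
Variable P : probability Omega R.
Variables (I : finType) (X : I -> {RV P >-> R}) (L : probability R R).
Hypothesis indX : mutually_independent X.
Hypothesis lawX : forall i (B : set R), measurable B -> distribution P (X i) B = L B.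

Lemma mbdd_prod d (T : measurableType d) (J : finType) (Q : pred J) (g : J -> T -> R) :
  (forall j, mbdd (g j)) -> mbdd (fun w => \prod_(j | Q j) g j w).
Proof.
move=> hg; elim: (index_enum J) => [|j s IH].
  by under [X in mbdd X]eq_fun do rewrite big_nil; apply: mbdd_cst.
under [X in mbdd X]eq_fun do rewrite big_cons.
by case: (Q j) => //; apply: mbddM.
Qed.

Lemma mbdd_sum d (T : measurableType d) (J : finType) (g : J -> T -> R) :
  (forall j, mbdd (g j)) -> mbdd (fun w => \sum_j g j w).
Proof.
move=> hg; elim: (index_enum J) => [|j s IH].
  by under [X in mbdd X]eq_fun do rewrite big_nil; apply: mbdd_cst.
by under [X in mbdd X]eq_fun do rewrite big_cons; apply: mbddD.
Qed.

Lemma mbdd_indic d (T : measurableType d) (A : set T) : measurable A -> mbdd (\1_A : T -> R).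
Proof.
move=> mA; split; first exact: measurable_indic.
by exists 1 => x; rewrite indicE; case: (_ \in _); rewrite ?normr1 ?normr0.
Qed.

Lemma mbdd_comp (i : I) (f : R -> R) : mbdd f -> mbdd (fun w => f (X i w)).
Proof. by move=> [mf [M hM]]; split; [exact: measurableT_comp|exists M]. Qed.

Lemma indep_mean_indic (B : I -> set R) : (forall i, measurable (B i)) ->
  mean P (fun w => \prod_i \1_(B i) (X i w)) = \prod_i mean L \1_(B i).
Proof.
move=> mB.
have -> : (fun w => \prod_i \1_(B i) (X i w)) = \1_[set w | forall i, B i (X i w)] :> (Omega -> R).
  apply/funext => w; rewrite indicE; case: (boolP (w \in _)) => [/set_mem h|/negP h].
    by rewrite big1 // => i _; rewrite indicE mem_set //; exact: h.
  have [i hi] : exists i, ~ B i (X i w).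
    by apply/existsNP => h'; apply: h; apply/mem_set.
  by rewrite (bigD1 i) //= indicE memNset // mul0r.
have mA : measurable [set w | forall i, B i (X i w)].
  have -> : [set w | forall i, B i (X i w)] = \bigcap_(i in [set: I]) (X i @^-1` B i).
    by apply/seteqP; split=> w h i; [move=> _; exact: h|exact: h].
  apply: fin_bigcap_measurable; first exact: finite_finset.
  by move=> i _; rewrite -[_ @^-1` _]setTI; exact: measurable_funP.
rewrite mean_indic // indX //.
have e i : P (X i @^-1` B i) = (mean L \1_(B i))%:E.
  rewrite mean_indic // fineK ?fin_num_measure //; exact: lawX.
by rewrite (eq_bigr _ (fun i _ => e i)) -(big_morph _ (@EFinM R) (erefl _)).
Qed.

(** Independence is the product rule for indicators. The indicators are replaced by the functions
    [f i] one coordinate at a time, the remaining sets [B i] staying arbitrary so that the induction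
    can use them. *)
Lemma indep_mean_prod (f : I -> R -> R) :
  (forall i, mbdd (f i)) -> (forall i y, 0 <= f i y) ->
  mean P (fun w => \prod_i f i (X i w)) = \prod_i mean L (f i).
Proof.
move=> hf f0.
pose F (s : seq I) (B : I -> set R) i : R -> R := if i \in s then f i else \1_(B i).
have hF s B i : (forall i, measurable (B i)) -> mbdd (F s B i).
  by move=> mB; rewrite /F; case: ifP => // _; apply: mbdd_indic.
have F0 s B i y : 0 <= F s B i y.
  by rewrite /F; case: ifP => // _; rewrite indicE.
suff H s : uniq s -> forall B, (forall i, measurable (B i)) ->
    mean P (fun w => \prod_i F s B i (X i w)) = \prod_i mean L (F s B i).
  have := H (enum I) (enum_uniq I) (fun=> setT) (fun=> measurableT).
  have e i : F (enum I) (fun=> setT) i = f i by rewrite /F mem_enum.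
  under [X in mean P X]eq_fun do under eq_bigr do rewrite e.
  by move=> ->; apply: eq_bigr => i _; rewrite e.
elim: s => [_ B mB|i0 s IH /= /andP[i0s us] B mB]; first exact: indep_mean_indic.
pose w om := \prod_(i | i != i0) F (i0 :: s) B i (X i om).
pose c := \prod_(i | i != i0) mean L (F (i0 :: s) B i).
have w0 om : 0 <= w om by apply: prodr_ge0.
have bw : mbdd w by apply: mbdd_prod => i; apply: mbdd_comp; apply: hF.
have c0 : 0 <= c by apply: prodr_ge0 => i _; apply: mean_ge0.
have hA (A : set R) : measurable A -> mean P (fun om => \1_A (X i0 om) * w om) = mean L \1_A * c.
  move=> mA; pose B' i := if i == i0 then A else B i.
  have mB' i : measurable (B' i) by rewrite /B'; case: ifP.
  have e1 : F s B' i0 = \1_A by rewrite /F (negbTE i0s) /B' eqxx.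
  have e2 i : i != i0 -> F s B' i = F (i0 :: s) B i.
    by move=> ii0; rewrite /F inE (negbTE ii0) /B' (negbTE ii0).
  have := IH us B' mB'; rewrite (bigD1 i0) //= e1.
  under [X in mean P X]eq_fun do rewrite (bigD1 i0) //= e1.
  under [X in mean P X]eq_fun do under eq_bigr => i ii0 do rewrite (e2 i ii0).
  by move=> ->; congr (_ * _); apply: eq_bigr => i ii0; rewrite e2.
(* With the other factors gathered in the weight [w], the induction hypothesis says that the image
   under [X i0] of [P] weighted by [w] is [c] times [L]. *)
have nuE A : measurable A ->
    mscale (NngNum c0) L A = (\int[P]_(om in X i0 @^-1` A) (w om)%:E)%E.
  move=> mA; rewrite /mscale /= -(fineK (fin_num_measure L _ mA)) -mean_indic //.
  rewrite -EFinM mulrC -hA // meanE; last first.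
    by apply: mbddM => //; apply: mbdd_comp; apply: mbdd_indic.
  rewrite [RHS]integral_mkcond; apply: eq_integral => om _.
  rewrite patchE indicE (_ : (om \in X i0 @^-1` A) = (X i0 om \in A)) //.
  by case: (_ \in _); rewrite ?mul1r ?mul0r.
have mf : measurable_fun setT (EFin \o f i0) by apply/measurable_EFinP; have [] := hf i0.
have key := ge0_integral_transfer (@measurable_funPT _ _ _ _ (X i0)) (proj1 bw) w0 nuE mf.
have e0 : F (i0 :: s) B i0 = f i0 by rewrite /F inE eqxx.
rewrite (bigD1 i0) //= e0.
under [X in mean P X]eq_fun do rewrite (bigD1 i0) //= e0.
rewrite -/c; apply: EFin_inj; rewrite EFinM !meanE //; last first.
  by apply: mbddM => //; apply: mbdd_comp.
rewrite -[LHS]/(\int[P]_om ((f i0 (X i0 om))%:E * (w om)%:E))%E -key; last first.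
  by move=> y; rewrite lee_fin.
rewrite ge0_integral_mscale //; first exact: muleC.
by move=> y _; rewrite lee_fin.
Qed.

End Independence.

(** * Exponential inequalities and Hoeffding's bound *)

Section ExpBounds.
Variable R : realType.

(** Termwise comparison of the exponential series: from order 2 on, [u ^+ j] is at most
    [(u / U) ^+ 2 * U ^+ j]. *)
Lemma expR_taylor2_le (u U : R) : 0 <= u -> u <= U -> 0 < U ->
  expR u <= 1 + u + (u / U) ^+ 2 * expR U.
Proof.
move=> u0 uU U0.
have U0' := ltW U0.
apply: limr_le; first exact: is_cvg_series_exp_coeff.
near=> n.
have [k ->] : exists k, n = k.+2.
  by exists n.-2; rewrite !prednK // ?ltn_predRL; near: n; exact: nbhs_infty_ge.
apply: (@le_trans _ _ (1 + u + (u / U) ^+ 2 * series (exp_coeff U) k.+2)); last first.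
  rewrite lerD2l ler_wpM2l ?sqr_ge0 //.
  apply: nondecreasing_cvgn_le; last exact: is_cvg_series_exp_coeff.
  apply/nondecreasing_seqP => i; rewrite /series /= big_nat_recr //= lerDl.
  exact: exp_coeff_ge0.
rewrite /series /= big_nat_recl // big_nat_recl // addrA; apply: lerD.
  by rewrite /exp_coeff /= expr0 expr1 fact0 divr1 divr1.
rewrite [X in _ <= _ * X]big_nat_recl // big_nat_recl // addrA.
apply: (@le_trans _ _ ((u / U) ^+ 2 * \sum_(0 <= i < k) exp_coeff U i.+2)); last first.
  by rewrite ler_wpM2l ?sqr_ge0 // lerDr addr_ge0 // exp_coeff_ge0.
rewrite mulr_sumr; apply: ler_sum => i _.
rewrite /exp_coeff /= mulrA ler_wpM2r ?invr_ge0 //.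
have -> : (u / U) ^+ 2 * U ^+ i.+2 = u ^+ 2 * U ^+ i.
  by rewrite !(exprS U); field; rewrite gt_eqF.
by rewrite 2!exprS mulrA -expr2 ler_wpM2l ?sqr_ge0 // lerXn2r.
Unshelve. all: end_near. Qed.

(** The linear term has mean zero for a centred variable, so this pointwise inequality yields a
    sub-Gaussian moment generating function at once. Up to [x = 1 / 2] it follows from
    [expR x * (1 - x) <= 1], beyond from [x <= 2 * x ^+ 2]. *)
Lemma expR_le_subgauss (x : R) : expR x <= x + expR (2 * x ^+ 2).
Proof.
have hx2 : 1 + 2 * x ^+ 2 <= expR (2 * x ^+ 2) by apply: expR_ge1Dx.
have [x0|x0] := ltP x 0.
  have e1 : expR x <= 1 + x + x ^+ 2.
    rewrite -[x in expR x]opprK expRN -div1r ler_pdivrMr ?expR_gt0 //.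
    have h := expR_ge1Dx (- x).
    apply: (@le_trans _ _ ((1 + x + x ^+ 2) * (1 + - x))); first by nra.
    by apply: ler_wpM2l => //; nra.
  by apply: le_trans e1 _; nra.
have [x2|x2] := leP x 2^-1; last first.
  apply: (@le_trans _ _ (expR (2 * x ^+ 2))); last by lra.
  by rewrite ler_expR; nra.
have e1 : expR x <= 1 + x + 2 * x ^+ 2.
  rewrite -[x in expR x]opprK expRN -div1r ler_pdivrMr ?expR_gt0 //.
  have h := expR_ge1Dx (- x).
  apply: (@le_trans _ _ ((1 + x + 2 * x ^+ 2) * (1 + - x))); first by nra.
  by apply: ler_wpM2l => //; nra.
by apply: le_trans e1 _; lra.
Qed.

Lemma expR1_le4 : expR 1 <= 4 :> R.
Proof.
have h : 2^-1 <= expR (- 2^-1) :> R.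
  by apply: le_trans (expR_ge1Dx _); lra.
have e : expR 1 * (expR (- 2^-1) * expR (- 2^-1)) = 1 :> R.
  by rewrite -!expRD -[RHS]expR0; congr expR; lra.
have E0 := expR_ge0 (1 : R).
have z4 : 4^-1 <= expR (- 2^-1) * expR (- 2^-1) :> R by nra.
by have := ler_wpM2l E0 z4; rewrite e; lra.
Qed.

End ExpBounds.

Section Tails.
Variables (R : realType) (disp : measure_display) (Omega : measurableType disp).
Variable P : probability Omega R.
Variables (I : finType) (X : I -> {RV P >-> R}) (L : probability R R).
Hypothesis indX : mutually_independent X.
Hypothesis lawX : forall i (B : set R), measurable B -> distribution P (X i) B = L B.

Lemma measurable_gtT d (T : measurableType d) (f : T -> R) c :
  measurable_fun setT f -> measurable [set w | c < f w].
Proof.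
move=> mf; rewrite (_ : [set w | _] = f @^-1` `]c, +oo[).
  by rewrite -[_ @^-1` _]setTI; apply: mf.
by apply/seteqP; split=> w /=; rewrite in_itv /= andbT.
Qed.

Lemma mean_exp_subgauss (g : R -> R) a (lam : R) : measurable_fun setT g -> (forall y, `|g y| <= a) ->
  mean L (fun y => expR (lam * (g y - mean L g))) <= expR (8 * lam ^+ 2 * a ^+ 2).
Proof.
move=> mg ga.
have bg : mbdd g by split=> //; exists a.
have bc : mbdd (fun y => g y - mean L g) by apply: mbddB => //; apply: mbdd_cst.
have bl := mbddZ lam bc.
have Ec : mean L (fun y => lam * (g y - mean L g)) = 0.
  by rewrite meanZ // meanB ?mean_cst ?subrr ?mulr0 //; apply: mbdd_cst.
have h : forall y, expR (lam * (g y - mean L g)) <=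
    lam * (g y - mean L g) + expR (8 * lam ^+ 2 * a ^+ 2).
  move=> y; apply: le_trans (expR_le_subgauss _) _; rewrite lerD2l ler_expR.
  have : (g y - mean L g) ^+ 2 <= (2 * a) ^+ 2.
    rewrite -(real_normK (num_real _)); rewrite lerXn2r ?nnegrE //.
      by have := le_trans (normr_ge0 _) (ga y); lra.
    apply: le_trans (ler_normB _ _) _.
    by have := ga y; have := mean_norm_le L bg ga; lra.
  rewrite exprMn => h; have := sqr_ge0 lam; nra.
apply: le_trans (mean_le L _ _ h) _.
- exact: mbdd_expR.
- by apply: mbddD => //; apply: mbdd_cst.
by rewrite meanD ?Ec ?mean_cst ?add0r //; apply: mbdd_cst.
Qed.

Lemma hoeffding (g : I -> R -> R) (a : I -> R) A t :
  (forall i, measurable_fun setT (g i)) -> (forall i y, `|g i y| <= a i) ->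
  \sum_i a i ^+ 2 <= A ^+ 2 -> 0 < A -> 0 <= t ->
  (P [set w | (t * A < \sum_i (g i (X i w) - mean L (g i)))%R] <= (expR (- (t ^+ 2 / 32)))%:E)%E.
Proof.
move=> mg ga aA A0 t0.
have bg i : mbdd (g i) by split=> //; exists (a i).
have bgc i : mbdd (fun y => g i y - mean L (g i)) by apply: mbddB => //; apply: mbdd_cst.
pose S w := \sum_i (g i (X i w) - mean L (g i)).
have bS : mbdd S by apply: mbdd_sum => i; apply: (mbdd_comp X i (bgc i)).
(* Minimizer of [- lam * t * A + 8 * lam ^+ 2 * A ^+ 2], with minimum [- t ^+ 2 / 32]. *)
pose lam := t / (16 * A).
have lam0 : 0 <= lam by rewrite divr_ge0 // mulr_ge0 // ltW.
apply: (@le_trans _ _ (mean P (fun w => expR (lam * S w) * expR (- (lam * (t * A)))))%:E).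
  apply: prob_le_mean.
  - by apply: measurable_gtT; case: bS.
  - by apply: mbddM; [apply/mbdd_expR/mbddZ|apply: mbdd_cst].
  - by move=> w; rewrite mulr_ge0 ?expR_ge0.
  - move=> w /= hw; rewrite -expRD -expR0 ler_expR -mulrBr mulr_ge0 // subr_ge0.
    exact: ltW.
rewrite lee_fin.
have -> : (fun w => expR (lam * S w) * expR (- (lam * (t * A)))) =
   (fun w => expR (- (lam * (t * A))) * \prod_i expR (lam * (g i (X i w) - mean L (g i)))).
  by apply/funext => w; rewrite mulrC -expR_sum -mulr_sumr.
rewrite meanZ; last first.
  by apply: mbdd_prod => i; apply: (mbdd_comp X i (mbdd_expR (mbddZ _ (bgc i)))).
rewrite (indep_mean_prod indX lawX (f := fun i y => expR (lam * (g i y - mean L (g i))))); last 2 first.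
- by move=> i; apply: mbdd_expR; apply: mbddZ.
- by move=> i y; rewrite expR_ge0.
apply: (@le_trans _ _ (expR (- (lam * (t * A))) * \prod_i expR (8 * lam ^+ 2 * a i ^+ 2))).
  rewrite ler_wpM2l ?expR_ge0 //; apply: ler_prod => i _; apply/andP; split.
    by apply: mean_ge0 => y; rewrite expR_ge0.
  exact: mean_exp_subgauss.
rewrite -expR_sum -expRD ler_expR -mulr_sumr.
apply: (@le_trans _ _ (- (lam * (t * A)) + 8 * lam ^+ 2 * A ^+ 2)).
  by rewrite lerD2l ler_wpM2l // mulr_ge0 // sqr_ge0.
rewrite le_eqVlt; apply/orP; left; apply/eqP; rewrite /lam; field.
by rewrite gt_eqF.
Qed.

End Tails.

Section UnionBound.
Variables (R : realType) (disp : measure_display) (Omega : measurableType disp).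
Variable P : probability Omega R.

(** The union is handed over as an opaque measurable set with its probability bound, the form in
    which all later events are combined. Repetitions in [s] only weaken the bound, so nets may be
    plain sequences. *)
Lemma union_bound (J : eqType) (s : seq J) (A : J -> set Omega) (p : J -> R) :
  (forall j, measurable (A j)) -> (forall j, j \in s -> (P (A j) <= (p j)%:E)%E) ->
  exists B : set Omega, [/\ measurable B, (P B <= (\sum_(j <- s) p j)%:E)%E &
    forall w j, j \in s -> A j w -> B w].
Proof.
move=> mA; elim: s => [|j s IH] hp.
  by exists set0; split=> //; rewrite big_nil measure0.
have [|B [mB PB hB]] := IH; first by move=> i si; apply: hp; rewrite inE si orbT.
exists (A j `|` B); split; first exact: measurableU.
- rewrite big_cons EFinD; apply: le_trans (measureU2 _ (mA j) mB) _.
  by rewrite leeD // hp // inE eqxx.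
- move=> w i; rewrite inE => /orP[/eqP->|si] h; first by left.
  by right; apply: hB h.
Qed.

End UnionBound.

(** * Moments and the l1 norm of the noise rows *)

Section Moments.
Variables (R : realType) (L : probability R R) (p gamma : R).
Hypotheses (p2 : 2 < p) (gamma0 : 0 < gamma).
Hypothesis momp : (\int[L]_y (`|y| `^ p)%:E = (gamma `^ p)%:E)%E.

Lemma measurable_normp : measurable_fun [set: R] (fun y : R => `|y| `^ p).
Proof.
apply: (measurableT_comp (measurable_powR p)).
exact: normr_measurable.
Qed.

(** Young's inequality with weight [th = 2 / p] bounds [y ^+ 2] pointwise by a multiple of the
    [p]-th power of its modulus plus [(1 - th) * gamma ^+ 2]. The scaling by [gamma] makes the two
    integrals add up to exactly [gamma ^+ 2]. *)
Lemma second_moment : (\int[L]_y (y ^+ 2)%:E <= (gamma ^+ 2)%:E)%E.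
Proof.
have hp2 := p2; have gamma0' := ltW gamma0; have p0 : 0 < p by lra.
pose th := 2 / p.
have th1 : th < 1 by rewrite /th ltr_pdivrMr // mul1r.
have th0 : 0 < th by rewrite divr_gt0.
have g1 : gamma `^ p * gamma `^ (2 - p) = gamma ^+ 2.
  rewrite -powRD; last by rewrite (gt_eqF gamma0) implybT.
  by rewrite (_ : p + (2 - p) = 2%:R) ?powR_mulrn //; lra.
have young y : y ^+ 2 <= th * gamma `^ (2 - p) * `|y| `^ p + (1 - th) * gamma ^+ 2.
  have gn0 : gamma != 0 by rewrite gt_eqF.
  pose z := (`|y| / gamma) ^+ 2.
  have z0 : 0 <= z by rewrite sqr_ge0.
  have := @conjugate_powR _ z 1 (th^-1) ((1 - th)^-1) z0 ler01.
  rewrite !invr_gt0 !invrK subr_gt0 => /(_ th0 th1); rewrite addrC subrK => /(_ erefl).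
  rewrite powR1 mulr1 mul1r.
  have -> : z `^ th^-1 = `|y| `^ p * gamma `^ (- p).
    have zE : z = (`|y| / gamma) `^ 2%:R by rewrite powR_mulrn ?divr_ge0 //.
    rewrite zE -powRrM (_ : 2%:R * th^-1 = p); last first.
      by rewrite /th; field; rewrite gt_eqF.
    rewrite powRM ?invr_ge0 //; congr (_ * _).
    by rewrite -powR_inv1 // -powRrM mulN1r.
  move=> h.
  have g2 : gamma `^ (- p) * gamma ^+ 2 = gamma `^ (2 - p).
    rewrite -g1 mulrA -powRD; last by rewrite (gt_eqF gamma0) implybT.
    by rewrite addNr powRr0 mul1r.
  have zE : z * gamma ^+ 2 = y ^+ 2.
    by rewrite /z expr_div_n real_normK ?num_real // mulfVK // expf_neq0.
  have : z * gamma ^+ 2 <= (`|y| `^ p * gamma `^ (- p) * th + (1 - th)) * gamma ^+ 2.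
    by rewrite ler_wpM2r ?sqr_ge0.
  by rewrite zE mulrDl -[_ * th * _]mulrAC -(mulrA (`|y| `^ p)) g2; lra.
have c0 : 0 <= th * gamma `^ (2 - p) by rewrite mulr_ge0 ?powR_ge0 // ltW.
have c1 : 0 <= (1 - th) * gamma ^+ 2 by rewrite mulr_ge0 ?sqr_ge0 //; lra.
apply: (@le_trans _ _ (\int[L]_y ((th * gamma `^ (2 - p))%:E * (`|y| `^ p)%:E +
    ((1 - th) * gamma ^+ 2)%:E))%E).
  apply: ge0_le_integral => //.
  - by move=> y _; rewrite lee_fin sqr_ge0.
  - by apply/measurable_EFinP; apply: measurable_funX.
  - apply/measurable_EFinP; apply: measurable_funD => //.
    apply: measurable_funM => //; exact: measurable_normp.
  - by move=> y _; rewrite -EFinM -EFinD lee_fin.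
have pos1 : forall y, [set: R] y -> (0 <= (th * gamma `^ (2 - p))%:E * (`|y| `^ p)%:E)%E.
  by move=> y _; rewrite -EFinM lee_fin mulr_ge0 // powR_ge0.
have m1 : measurable_fun [set: R] (fun y : R => ((th * gamma `^ (2 - p))%:E * (`|y| `^ p)%:E)%E).
  by apply/measurable_EFinP; apply: measurable_funM => //; exact: measurable_normp.
have pos2 : forall y, [set: R] y -> (0 <= ((1 - th) * gamma ^+ 2)%:E)%E.
  by move=> y _; rewrite lee_fin.
rewrite (ge0_integralD _ measurableT pos1 m1 pos2 (measurable_cst _)).
have pos3 : forall y, [set: R] y -> (0 <= (`|y| `^ p)%:E)%E.
  by move=> y _; rewrite lee_fin powR_ge0.
have m3 : measurable_fun [set: R] (fun y : R => (`|y| `^ p)%:E).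
  by apply/measurable_EFinP; exact: measurable_normp.
rewrite (ge0_integralZl_EFin L measurableT pos3 m3 c0).
have icst c : (\int[L]_y c%:E = c%:E)%E by have := expectation_cst L c; rewrite unlock.
rewrite momp icst -EFinM -EFinD lee_fin.
by rewrite -mulrA (mulrC (gamma `^ (2 - p))) g1; lra.
Qed.

Lemma moment_tail t : 0 < t ->
  (L [set y : R | (t < `|y|)%R] <= ((gamma / t) `^ p)%:E)%E.
Proof.
move=> t0; have t0' := ltW t0.
have hp2 := p2; have gamma0' := ltW gamma0; have p0 : 0 < p by lra.
have mA : measurable [set y : R | t < `|y|] by apply: measurable_gtT; exact: normr_measurable.
have tp : 0 < t `^ p by rewrite powR_gt0.
have h : ((t `^ p)%:E * L [set y : R | (t < `|y|)%R] <= (gamma `^ p)%:E)%E.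
  rewrite -momp -[X in (_ * L X)%E]setIT -integral_indic // -ge0_integralZl //; last 2 first.
  - by apply/measurable_EFinP; exact: measurable_indic.
  - by rewrite lee_fin ltW.
  apply: ge0_le_integral => //.
  - by move=> y _; rewrite mule_ge0 // lee_fin ltW.
  - by apply/measurable_EFinP; apply: measurable_funM => //; apply: measurable_indic.
  - by apply/measurable_EFinP; exact: measurable_normp.
  move=> y _; rewrite -EFinM lee_fin indicE.
  case: (boolP (y \in _)) => [/set_mem /= h|_]; last by rewrite mulr0 powR_ge0.
  by rewrite mulr1 ge0_ler_powR ?nnegrE // ltW.
rewrite powRM ?invr_ge0 // -powR_inv1 // -powRrM mulN1r powRN.
by rewrite EFinM lee_pdivlMr // muleC.
Qed.

End Moments.

Section RowTail.
Variables (R : realType) (disp : measure_display) (Omega : measurableType disp).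
Variable P : probability Omega R.
Variables (I : finType) (X : I -> {RV P >-> R}) (L : probability R R).
Hypothesis indX : mutually_independent X.
Hypothesis lawX : forall i (B : set R), measurable B -> distribution P (X i) B = L B.
Variables (eps gamma : R).
Hypotheses (eps0 : 0 < eps) (gamma0 : 0 < gamma).
Hypothesis momp : (\int[L]_y (`|y| `^ (2 + eps))%:E = (gamma `^ (2 + eps))%:E)%E.

Let tau (t y : R) : R := `|y| * \1_[set y | `|y| <= t] y.

Let mbdd_tau t : 0 <= t -> mbdd (tau t).
Proof.
move=> t0; split.
  apply: measurable_funM; first exact: normr_measurable.
  apply: measurable_indic; rewrite -[X in measurable X]setCK.
  apply: measurableC; rewrite (_ : ~` _ = [set y : R | t < `|y|]).
    by apply: measurable_gtT; exact: normr_measurable.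
  by apply/seteqP; split=> y /=; rewrite ltNge => /negP.
exists t => y; rewrite /tau indicE; case: (boolP (y \in _)) => [/set_mem /= h|_].
  by rewrite mulr1 normr_id.
by rewrite mulr0 normr0.
Qed.

Let tau_ge0 t y : 0 <= tau t y.
Proof. by rewrite /tau mulr_ge0 // indicE. Qed.

Let tau_le t y : 0 <= t -> tau t y <= t.
Proof.
move=> t0; rewrite /tau indicE; case: (boolP (y \in _)) => [/set_mem /= h|_].
  by rewrite mulr1.
by rewrite mulr0.
Qed.

Let tau_eq t y : `|y| <= t -> tau t y = `|y|.
Proof. by move=> h; rewrite /tau indicE mem_set ?mulr1. Qed.

Let tau_abs t y : tau t y <= `|y|.
Proof. by rewrite /tau indicE; case: (_ \in _); rewrite ?mulr1 ?mulr0. Qed.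

Let mean_tau2 t : 0 <= t -> mean L (fun y => tau t y ^+ 2) <= gamma ^+ 2.
Proof.
move=> t0; have hp2 : 2 < 2 + eps by rewrite ltrDl.
have bt : mbdd (fun y => tau t y ^+ 2).
  by under [X in mbdd X]eq_fun do rewrite expr2; apply: mbddM; apply: mbdd_tau.
rewrite -lee_fin meanE //; apply: le_trans (second_moment hp2 gamma0 momp).
apply: ge0_le_integral => //.
- by move=> y _; rewrite lee_fin sqr_ge0.
- by apply/measurable_EFinP; case: bt.
- by apply/measurable_EFinP; apply: measurable_funX.
- move=> y _; rewrite lee_fin -[leRHS](real_normK (num_real _)).
  by rewrite lerXn2r ?nnegrE ?tau_ge0 ?tau_abs.
Qed.

Variable J : {set I}.
Hypothesis J0 : (0 < #|J|)%N.

(* Truncate at [n * gamma], [n = #|J|]: the moment of order [2 + eps] controls the event that some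
   entry exceeds this level, at cost [n ^ (-1 - eps)], and Chernoff with parameter
   [ln n / (n * gamma)] controls the truncated sum, at cost [n ^ -2]. *)
Lemma row_tail : exists B : set Omega, [/\ measurable B,
  (P B <= (5 * #|J|%:R `^ (- 1 - Num.min 1 eps))%:E)%E &
  forall w, ~ B w -> \sum_(i in J) `|X i w| <= 3 * #|J|%:R * gamma].
Proof.
have J0' := J0; set n := #|J| in J0' *; have nR : 1 <= n%:R :> R by rewrite ler1n.
have ep := eps0; have gp := gamma0.
(* For a single entry the logarithm used below vanishes, but the claimed bound is then 5 and any
   event qualifies. *)
have [n1|n1] := leqP n 1.
  exists setT; split=> // [|w []//].
  have -> : n = 1%N by apply/eqP; rewrite eqn_leq n1 J0'.
  rewrite powR1 mulr1; apply: le_trans (probability_le1 _ _) _ => //.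
  by rewrite lee_fin; lra.
pose l := ln n%:R : R.
have l0 : 0 < l by rewrite ln_gt0 // ltr1n.
have n0 : 0 < n%:R :> R by lra.
have El : expR l = n%:R by rewrite lnK // posrE.
pose y0 := n%:R * gamma; have y00 : 0 < y0 by rewrite mulr_gt0.
have y00' := ltW y00.
pose lam := l / y0; have lam0 : 0 <= lam by rewrite divr_ge0 // ltW.
pose tl := tau y0.
(* Second-order expansion at level [l], where [expR l = n]. The linear term is then traded for a
   quadratic one by [2 * gamma * t <= gamma ^+ 2 + t ^+ 2], leaving the second moment as the only
   input. *)
have lamtau y : expR (lam * tl y) <= (1 + lam * gamma / 2) + (lam / (2 * gamma) + (n%:R * gamma ^+ 2)^-1) * tl y ^+ 2.
  have := @expR_taylor2_le _ (lam * tl y) l.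
  rewrite mulr_ge0 ?tau_ge0 // => /(_ erefl).
  have -> : lam * tl y <= l.
    have e : lam * y0 = l by rewrite /lam mulfVK // gt_eqF.
    by rewrite -e ler_wpM2l // tau_le.
  move=> /(_ erefl l0) /le_trans; apply.
  have -> : (lam * tl y / l) ^+ 2 * expR l = (n%:R * gamma ^+ 2)^-1 * tl y ^+ 2.
    by rewrite El /lam /y0; field; rewrite !gt_eqF.
  suff h : lam * tl y <= lam * gamma / 2 + lam / (2 * gamma) * tl y ^+ 2.
    by rewrite mulrDl; move: h; rewrite -!addrA !lerD2l => h; rewrite addrA lerD2r.
  have -> : lam * gamma / 2 + lam / (2 * gamma) * tl y ^+ 2 =
            lam * (gamma / 2 + tl y ^+ 2 / (2 * gamma)).
    by field; rewrite gt_eqF.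
  apply: ler_wpM2l => //; rewrite -subr_ge0.
  have -> : gamma / 2 + tl y ^+ 2 / (2 * gamma) - tl y = (tl y - gamma) ^+ 2 / (2 * gamma).
    by field; rewrite gt_eqF.
  by rewrite divr_ge0 ?sqr_ge0 // mulr_ge0 // ltW.
have btl : mbdd tl by apply: mbdd_tau.
have bt2 : mbdd (fun y => tl y ^+ 2).
  by under [X in mbdd X]eq_fun do rewrite expr2; apply: mbddM.
have bexp : mbdd (fun y => expR (lam * tl y)) by apply/mbdd_expR/mbddZ.
have mexp : mean L (fun y => expR (lam * tl y)) <= expR (lam * gamma + n%:R^-1).
  apply: (@le_trans _ _ (1 + (lam * gamma + n%:R^-1))); last exact: expR_ge1Dx.
  apply: le_trans (mean_le L bexp _ lamtau) _.
    by apply: mbddD; [exact: mbdd_cst|exact: mbddZ].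
  rewrite meanD ?mean_cst ?meanZ //; [|exact: mbdd_cst|exact: mbddZ].
  have c0 : 0 <= lam / (2 * gamma) + (n%:R * gamma ^+ 2)^-1.
    by rewrite addr_ge0 ?divr_ge0 ?invr_ge0 ?mulr_ge0 ?sqr_ge0 // ltW.
  have := ler_wpM2l c0 (mean_tau2 y00').
  have -> : (lam / (2 * gamma) + (n%:R * gamma ^+ 2)^-1) * gamma ^+ 2 = lam * gamma / 2 + n%:R^-1.
    by field; rewrite !gt_eqF.
  by rewrite -/tl => h; lra.
pose S w := \sum_(i in J) tl (X i w).
have bS : mbdd S.
  have -> : S = (fun w => \sum_i (if i \in J then tl (X i w) else 0)).
    by apply/funext => w; rewrite /S big_mkcond.
  apply: mbdd_sum => i; case: (i \in J); last exact: mbdd_cst.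
  exact: (mbdd_comp X i btl).
have PS : (P [set w | (3 * n%:R * gamma < S w)%R] <= (expR (1 - 2 * l))%:E)%E.
  apply: (@le_trans _ _ (mean P (fun w => expR (lam * S w) * expR (- (3 * l))))%:E).
    apply: prob_le_mean.
    - by apply: measurable_gtT; case: bS.
    - by apply: mbddM; [apply/mbdd_expR/mbddZ|apply: mbdd_cst].
    - by move=> w; rewrite mulr_ge0 ?expR_ge0.
    - move=> w /= hw; rewrite -expRD -[leLHS]expR0 ler_expR subr_ge0.
      have -> : 3 * l = lam * (3 * n%:R * gamma).
        by rewrite /lam /y0; field; rewrite !gt_eqF.
      by rewrite ler_wpM2l // ltW.
  rewrite lee_fin.
  pose f i (y : R) := if i \in J then expR (lam * tl y) else 1.
  have -> : (fun w => expR (lam * S w) * expR (- (3 * l))) =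
     (fun w => expR (- (3 * l)) * \prod_i f i (X i w)).
    by apply/funext => w; rewrite mulrC /S mulr_sumr expR_sum big_mkcond.
  have bf i : mbdd (f i) by rewrite /f; case: (i \in J) => //; apply: mbdd_cst.
  rewrite meanZ; last by apply: mbdd_prod => i; apply: (mbdd_comp X i (bf i)).
  rewrite (indep_mean_prod indX lawX bf); last first.
    by move=> i y; rewrite /f; case: ifP => // _; rewrite expR_ge0.
  apply: (@le_trans _ _ (expR (- (3 * l)) * \prod_(i in J) expR (lam * gamma + n%:R^-1))).
    rewrite ler_wpM2l ?expR_ge0 // [leRHS]big_mkcond; apply: ler_prod => i _.
    rewrite /f; case: (i \in J); last by rewrite mean_cst ler01 lexx.
    by rewrite mexp andbT; apply: mean_ge0 => y; rewrite expR_ge0.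
  rewrite prodr_const -/n -expRM_natl -expRD ler_expR.
  rewrite le_eqVlt; apply/orP; left; apply/eqP; rewrite /lam /y0; field.
  by rewrite !gt_eqF.
have Ptail i : (P [set w | (y0 < `|X i w|)%R] <= (expR (- (2 + eps) * l))%:E)%E.
  have hp2 : 2 < 2 + eps by rewrite ltrDl.
  have := moment_tail hp2 gamma0 momp y00.
  rewrite -(lawX i); last by apply: measurable_gtT; exact: normr_measurable.
  move=> h; apply: le_trans h _; rewrite lee_fin.
  have -> : gamma / y0 = expR (- l).
    by rewrite expRN El /y0; field; rewrite !gt_eqF.
  by rewrite -expRM ler_expR; lra.
pose A (o : option I) : set Omega :=
  if o is Some i then [set w | y0 < `|X i w|] else [set w | 3 * n%:R * gamma < S w].
pose q (o : option I) : R := if o is Some i then expR (- (2 + eps) * l) else expR (1 - 2 * l).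
have mA o : measurable (A o).
  case: o => [i|]; last by apply: measurable_gtT; case: bS.
  by apply: measurable_gtT; apply: measurableT_comp => //; exact: normr_measurable.
have Aq o : (P (A o) <= (q o)%:E)%E by case: o => [i|] /=.
have [B [mB PB hB]] := union_bound (P := P) (s := None :: [seq Some i | i <- enum J]) mA (fun o _ => Aq o).
exists B; split=> //.
  apply: le_trans PB _; rewrite lee_fin big_cons big_map big_enum /= sumr_const -/n.
  have -> : n%:R `^ (- 1 - Num.min 1 eps) = expR ((- 1 - Num.min 1 eps) * l).
    by rewrite /powR gt_eqF.
  set a := Num.min 1 eps.
  have a1 : a <= 1 by rewrite ge_min lexx.
  have ae : a <= eps by rewrite ge_min lexx orbT.
  have h1 : expR (1 - 2 * l) <= 4 * expR ((-1 - a) * l).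
    rewrite expRD; apply: ler_pM; rewrite ?expR_ge0 ?expR1_le4 //.
    by rewrite ler_expR; nra.
  have h2 : expR (- (2 + eps) * l) *+ n <= expR ((-1 - a) * l).
    by rewrite -[leLHS]mulr_natl -El -expRD ler_expR; nra.
  lra.
move=> w nB.
have hi i : i \in J -> `|X i w| <= y0.
  move=> iJ; rewrite leNgt; apply/negP => h; apply: nB.
  apply: (hB w (Some i)) => //; rewrite inE; apply/orP; right.
  by apply: map_f; rewrite mem_enum.
have -> : \sum_(i in J) `|X i w| = S w.
  by apply: eq_bigr => i iJ; rewrite /tl tau_eq // hi.
rewrite leNgt; apply/negP => h; apply: nB.
by apply: (hB w None); rewrite ?inE.
Qed.

End RowTail.

(** * Pseudo-Huber loss *)
Section Huber.
Variables (R : realType) (delta : R).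
Hypothesis delta0 : 0 < delta.

Definition hub (t : R) : R := Num.sqrt (t ^+ 2 + delta ^+ 2).
Definition dhub (t : R) : R := t / hub t.

Lemma hub_sq t : hub t ^+ 2 = t ^+ 2 + delta ^+ 2.
Proof. by rewrite sqr_sqrtr // addr_ge0 ?sqr_ge0. Qed.

Lemma hub_ge0 t : 0 <= hub t.
Proof. exact: sqrtr_ge0. Qed.

Lemma hub_ge t : delta <= hub t.
Proof.
have d0 := delta0; rewrite -(ger0_norm (ltW delta0)) -sqrtr_sqr ler_wsqrtr //.
by rewrite lerDr sqr_ge0.
Qed.

Lemma hub_gt0 t : 0 < hub t.
Proof. exact: lt_le_trans (hub_ge t). Qed.

Lemma hub_ge_abs t : `|t| <= hub t.
Proof. by rewrite -sqrtr_sqr ler_wsqrtr // lerDl sqr_ge0. Qed.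

Lemma hub_le_abs t : hub t <= `|t| + delta.
Proof.
have d0 := ltW delta0; rewrite -(ler_pXn2r (ltn0Sn 1)) ?nnegrE ?addr_ge0 ?hub_ge0 //.
rewrite hub_sq sqrrD real_normK ?num_real // lerD2r lerDl.
by rewrite mulrn_wge0 // mulr_ge0.
Qed.

Lemma hubN t : hub (- t) = hub t.
Proof. by rewrite /hub sqrrN. Qed.

Lemma hub_lipschitz a b : `|hub a - hub b| <= `|a - b|.
Proof.
wlog ab : a b / hub b <= hub a.
  by move=> H; case: (leP (hub b) (hub a)) => [|/ltW] h; [|rewrite distrC (distrC a)]; apply: H.
rewrite ger0_norm ?subr_ge0 // lerBlDr.
rewrite -(ler_pXn2r (ltn0Sn 1)) ?nnegrE ?addr_ge0 ?hub_ge0 // sqrrD !hub_sq.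
rewrite real_normK ?num_real //.
have h : b * (a - b) <= `|a - b| * hub b.
  rewrite mulrC; apply: le_trans (ler_norm _) _; rewrite normrM ler_wpM2l //.
  exact: hub_ge_abs.
by rewrite -[(`|a - b| * _) *+ 2]mulr_natl; nra.
Qed.

Lemma dhub_le1 t : `|dhub t| <= 1.
Proof.
rewrite /dhub normrM normfV (ger0_norm (hub_ge0 t)) ler_pdivrMr ?hub_gt0 //.
by rewrite mul1r hub_ge_abs.
Qed.

Lemma dhubN t : dhub (- t) = - dhub t.
Proof. by rewrite /dhub hubN mulNr. Qed.

(** The pairs [(t / hub t, delta / hub t)] are unit vectors. The squared distance between two of
    them is at most [(a - b) ^+ 2 / (hub a * hub b)], and [hub] is at least [delta]. *)
Lemma dhub_lipschitz a b : `|dhub a - dhub b| <= delta^-1 * `|a - b|.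
Proof.
have d0 := delta0; have di : 0 <= delta^-1 by rewrite invr_ge0 ltW.
rewrite -(ler_pXn2r (ltn0Sn 1)) ?nnegrE ?mulr_ge0 // exprMn !real_normK ?num_real //.
have ha := hub_gt0 a; have hb := hub_gt0 b.
have e : (dhub a - dhub b) ^+ 2 + (delta / hub a - delta / hub b) ^+ 2 =
   2 - 2 * (a * b + delta ^+ 2) / (hub a * hub b).
  have -> : (dhub a - dhub b) ^+ 2 + (delta / hub a - delta / hub b) ^+ 2 =
      (a ^+ 2 + delta ^+ 2) / hub a ^+ 2 + (b ^+ 2 + delta ^+ 2) / hub b ^+ 2
      - 2 * (a * b + delta ^+ 2) / (hub a * hub b).
    by rewrite /dhub; field; rewrite !gt_eqF.
  by rewrite -!hub_sq !divff ?expf_neq0 ?gt_eqF //; lra.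
have h2 : 2 - 2 * (a * b + delta ^+ 2) / (hub a * hub b) <= (a - b) ^+ 2 / (hub a * hub b).
  rewrite -subr_ge0.
  have -> : (a - b) ^+ 2 / (hub a * hub b) - (2 - 2 * (a * b + delta ^+ 2) / (hub a * hub b))
    = (a ^+ 2 + delta ^+ 2 + (b ^+ 2 + delta ^+ 2) - 2 * (hub a * hub b)) / (hub a * hub b).
    by field; rewrite !gt_eqF.
  rewrite -!hub_sq; apply: divr_ge0; last by rewrite mulr_ge0 ?hub_ge0.
  by have := sqr_ge0 (hub a - hub b); nra.
have h3 : (a - b) ^+ 2 / (hub a * hub b) <= delta^-1 ^+ 2 * (a - b) ^+ 2.
  rewrite mulrC ler_wpM2r ?sqr_ge0 // exprVn lef_pV2 ?posrE ?mulr_gt0 ?exprn_gt0 //.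
  by rewrite expr2 ler_pM ?hub_ge ?ltW.
have := sqr_ge0 (delta / hub a - delta / hub b); lra.
Qed.

(** With curvature [1 / hub a] in place of [1 / delta], the square of the right-hand side is
    [hub (a + t) ^+ 2] plus a square. *)
Lemma hub_quad a t : hub (a + t) <= hub a + dhub a * t + t ^+ 2 / (2 * delta).
Proof.
have d0 := delta0; have ha := hub_gt0 a.
apply: (@le_trans _ _ (hub a + dhub a * t + t ^+ 2 / (2 * hub a))); last first.
  rewrite lerD2l ler_wpM2l ?sqr_ge0 // lef_pV2 ?posrE ?mulr_gt0 //.
  by rewrite ler_wpM2l // hub_ge.
have e : hub a + dhub a * t + t ^+ 2 / (2 * hub a) =
  ((a + t) ^+ 2 + (hub a ^+ 2 + delta ^+ 2)) / (2 * hub a).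
  have -> : (a + t) ^+ 2 = (a ^+ 2 + delta ^+ 2) - delta ^+ 2 + 2 * a * t + t ^+ 2 by ring.
  by rewrite -hub_sq /dhub; field; rewrite gt_eqF.
rewrite -(ler_pXn2r (ltn0Sn 1)) ?nnegrE ?hub_ge0 //; last first.
  by rewrite e divr_ge0 ?addr_ge0 ?sqr_ge0 ?mulr_ge0 ?hub_ge0.
rewrite hub_sq.
have -> : (hub a + dhub a * t + t ^+ 2 / (2 * hub a)) ^+ 2 =
   hub a ^+ 2 + 2 * a * t + t ^+ 2 + (dhub a * t + t ^+ 2 / (2 * hub a)) ^+ 2.
  by rewrite /dhub; field; rewrite gt_eqF.
by rewrite hub_sq; have := sqr_ge0 (dhub a * t + t ^+ 2 / (2 * hub a)); nra.
Qed.

(** Perturbing one entry by [t] and bounding the loss by its tangent parabola gives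
    [(G w - p) * t <= t ^+ 2 / (2 * delta)], where [p] is the derivative; [t = delta * (G w - p)]
    forces [G w = p]. *)
Lemma huber_subgradientE m (d : 'I_m -> nat) (Y T G : tensor R d) w :
  huber_subgradient delta Y T G -> G w = dhub ((T - Y) w).
Proof.
move=> hG; have d0 := delta0.
have key t : G w * t <= dhub ((T - Y) w) * t + t ^+ 2 / (2 * delta).
  have := hG [ffun v => T v + if v == w then t else 0].
  rewrite (bigD1 w) //= big1 => [|v vw]; last by rewrite ffunE (negbTE vw) addr0 subrr mulr0.
  rewrite ffunE eqxx addr0 addrAC subrr add0r /pseudo_huber.
  rewrite (bigD1 w) //= [X in _ <= X](bigD1 w) //= -/(hub _) -/(hub _).
  rewrite (eq_bigr (fun v => Num.sqrt ((T - Y) v ^+ 2 + delta ^+ 2))); last first.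
    by move=> v vw; rewrite !ffunE.
  rewrite [X in _ <= _ + X](eq_bigr (fun v => Num.sqrt ((T - Y) v ^+ 2 + delta ^+ 2))); last first.
    by move=> v vw; rewrite !ffunE (negbTE vw) addr0.
  rewrite addrAC lerD2r.
  have -> : ([ffun v => T v + (if v == w then t else 0)] - Y) w = (T - Y) w + t.
    by rewrite !ffunE eqxx; ring.
  by have := hub_quad ((T - Y) w) t; lra.
apply/eqP; rewrite -subr_eq0; apply/eqP.
set g := G w in key *; set p := dhub _ in key *.
have := key (delta * (g - p)).
have -> : (delta * (g - p)) ^+ 2 / (2 * delta) = delta * (g - p) ^+ 2 / 2.
  by field; rewrite gt_eqF.
move=> h; have : delta * (g - p) ^+ 2 <= 0 by nra.
rewrite pmulr_rle0 // => h'.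
by apply/eqP; rewrite -sqrf_eq0 eq_le h' sqr_ge0.
Qed.

Lemma is_derive_hub (t : R) : is_derive t 1 hub (dhub t).
Proof.
have d0 := delta0.
have p : 0 < t ^+ 2 + delta ^+ 2 by rewrite ltr_wpDl ?sqr_ge0 // exprn_gt0.
have h1 := is_derive1_sqrt p.
have h2 : is_derive t 1 (fun t : R => t ^+ 2 + delta ^+ 2) (2 * t).
  have -> : (fun t : R => t ^+ 2 + delta ^+ 2) = (@idfun R ^+ 2 + cst (delta ^+ 2)) by [].
  by apply: is_derive_eq; rewrite /= addr0 expr1 /GRing.scale /= mulr1.
have h := @is_derive1_comp _ Num.sqrt (fun t : R => t ^+ 2 + delta ^+ 2) t _ _ h1 h2.
rewrite (_ : dhub t = (2 * Num.sqrt (t ^+ 2 + delta ^+ 2))^-1 * (2 * t)) //.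
rewrite /dhub -/(hub t); field.
by rewrite gt_eqF // hub_gt0.
Qed.

(** The classical antiderivative of [hub], in closed form so that integrals over [[- A, A]] become
    boundary values. *)
Definition hub_int (t : R) : R := (t * hub t + delta ^+ 2 * ln (t + hub t)) / 2.

Lemma is_derive_hub_int (t : R) : is_derive t 1 hub_int (hub t).
Proof.
have d0 := delta0; have ht := hub_gt0 t.
have p : 0 < t + hub t.
  have : `|t| < hub t.
    rewrite -(ltr_pXn2r (ltn0Sn 1)) ?nnegrE ?hub_ge0 // hub_sq real_normK ?num_real //.
    by rewrite ltrDl exprn_gt0.
  by have := ler_norm (- t); rewrite normrN; lra.
have h0 := is_derive_hub t.
have h1 : is_derive t 1 (fun t => t + hub t) (1 + dhub t).
  have -> : (fun t => t + hub t) = (@idfun R + hub) by [].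
  exact: is_derive_eq.
have h2 := @is_derive1_comp _ (@ln R) (fun t => t + hub t) t _ _ (is_derive1_ln p) h1.
have -> : hub_int = 2^-1 \*: ((@idfun R * hub) + delta ^+ 2 \*: (@ln R \o (fun t => t + hub t))).
  by apply/funext => u; rewrite /hub_int mulrC.
apply: is_derive_eq; rewrite /GRing.scale /= /dhub mulr1.
have e : delta ^+ 2 = hub t ^+ 2 - t ^+ 2 by rewrite hub_sq; ring.
by rewrite e; field; rewrite !gt_eqF //.
Qed.

End Huber.

(** * Symmetric noise density and the expected loss difference *)

Section Density.
Import numFieldNormedType.Exports.
Variables (R : realType) (L : probability R R) (h : R -> R).
Hypotheses (mh : measurable_fun setT h) (h0 : forall y, 0 <= h y).
Hypothesis hL : forall B : set R, measurable B ->
  L B = (\int[lebesgue_measure]_(y in B) (h y)%:E)%E.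
Hypothesis heven : forall y, h y = h (- y).

Lemma law_opp (B : set R) : measurable B -> L (-%R @^-1` B) = L B.
Proof.
move=> mB.
have mNB : measurable ((-%R : R -> R) @^-1` B).
  by rewrite -[_ @^-1` _]setTI; apply: measurable_funN => //; exact: measurable_id.
rewrite !hL //.
transitivity (\int[lebesgue_measure]_(y in (-%R : R -> R) @^-1` B) (h (- (y : R))%R)%:E)%E.
  by apply: eq_integral => y _; rewrite /= -heven.
have mN : measurable_fun setT (-%R : measurableTypeR R -> measurableTypeR R).
  exact: measurable_funN.
have mhB : measurable_fun B (EFin \o h : measurableTypeR R -> \bar R).
  by apply: measurable_funTS; apply/measurable_EFinP.
have h0' : {in B, forall y, (0 <= (EFin \o h) y)%E} by move=> y _; rewrite /= lee_fin; exact: h0.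
have e := @ge0_integral_pushforward _ _ (measurableTypeR R) (measurableTypeR R) R _ mN
  lebesgue_measure B (EFin \o h) mB mhB h0'.
rewrite -[LHS]e.
by apply: eq_measure_integral => //= D mD DB; exact: lebesgue_measureN.
Qed.

Lemma law_integral_opp (f : R -> \bar R) : measurable_fun setT f -> (forall y, (0 <= f y)%E) ->
  (\int[L]_y f (- (y : R))%R = \int[L]_y f y)%E.
Proof.
move=> mf f0; have mN : measurable_fun setT (-%R : R -> R) by exact: measurable_funN.
rewrite [RHS](eq_measure_integral (pushforward L (-%R : R -> R))).
  by rewrite ge0_integral_pushforward.
by move=> A mA _; exact: (esym (law_opp mA)).
Qed.

Lemma mean_opp (f : R -> R) : mbdd f -> mean L (fun y : R => f (- y)) = mean L f.
Proof.
move=> [mf [M hM]]; have bf : mbdd f by split=> //; exists M.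
have bN : mbdd (fun y : R => f (- y)).
  by split; [apply: (measurableT_comp mf); exact: measurable_funN|exists M].
have bM : mbdd (fun _ : R => M) by apply: mbdd_cst.
apply: (@addIr _ M); rewrite -{1}[M](mean_cst L M) -{2}[M](mean_cst L M) -!meanD //.
apply: EFin_inj; rewrite !meanE; try exact: mbddD.
apply: (@law_integral_opp (fun y : R => (f y + M)%:E)).
  by apply/measurable_EFinP; apply: measurable_funD.
by move=> y; rewrite lee_fin; have := hM y; rewrite ler_norml => /andP[]; lra.
Qed.

Lemma mean_odd (f : R -> R) : mbdd f -> (forall y, f (- y) = - f y) -> mean L f = 0.
Proof.
move=> bf fodd; have := mean_opp bf.
under [X in mean L X]eq_fun do rewrite fodd -mulN1r.
by rewrite meanZ //; lra.
Qed.

Variables (delta b0 A : R).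
Hypotheses (delta0 : 0 < delta) (b00 : 0 < b0) (A72 : 72 * delta <= A).
Hypothesis hb : forall y, `|y| <= A -> b0^-1 <= h y.

(* The density is at least [b0^-1] on an interval of length [2 * A], and its total mass is 1. *)
Lemma b0_ge_radius : 2 * A <= b0.
Proof.
have d0 := delta0; have hA := A72; have A0 : 0 < A by lra.
have h1 : (\int[lebesgue_measure]_(y in `[(- A)%R, A]) (b0^-1)%:E <= 1)%E.
  apply: (@le_trans _ _ (L `[(- A)%R, A]%classic)); last exact: probability_le1.
  rewrite hL //; apply: ge0_le_integral => //.
  - by move=> y _; rewrite lee_fin invr_ge0 ltW.
  - by apply: measurable_funTS; apply/measurable_EFinP.
  - by move=> y /=; rewrite in_itv /= lee_fin -ler_norml => /hb.
move: h1; rewrite integral_cst //= lebesgue_measure_itv /= lte_fin ifT; last by lra.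
rewrite -EFinB -EFinM lee_fin opprK mulrC ler_pdivrMr // mul1r; lra.
Qed.

Lemma hub_measurable : measurable_fun setT (hub delta).
Proof.
apply: measurableT_comp; first exact: (continuous_measurable_fun (@sqrt_continuous R)).
by apply: measurable_funD => //; apply: measurable_funX.
Qed.

(* [huber_mean_lower]'s integrand averaged over [y] and [- y]: convexity makes it nonnegative, so
   the density may be replaced by its lower bound on [[- A, A]]. *)
Let Dl x y := (hub delta (y + x) - hub delta y + (hub delta (y - x) - hub delta y)) / 2.

Let mDl x : mbdd (Dl x).
Proof.
have m1 (z : R) : mbdd (fun y : R => hub delta (y + z) - hub delta y).
  split.
    apply: measurable_funB; last exact: hub_measurable.
    by apply: (measurableT_comp hub_measurable); apply: measurable_funD.
  exists `|z| => y; have := hub_lipschitz delta (y + z) y.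
  by rewrite addrAC subrr add0r.
have -> : Dl x = (fun y : R => 2^-1 * ((hub delta (y + x) - hub delta y) + (hub delta (y + - x) - hub delta y))).
  by apply/funext => y; rewrite /Dl mulrC.
by apply: mbddZ; apply: mbddD; apply: m1.
Qed.

(** Midpoint convexity, checked after squaring: by Cauchy-Schwarz for [(y + x, delta)] and
    [(y - x, delta)], the product of the two outer values is at least
    [y ^+ 2 - x ^+ 2 + delta ^+ 2]. *)
Let Dl_ge0 x y : 0 <= Dl x y.
Proof.
apply: divr_ge0 => //.
have h1 := hub_gt0 delta0 (y + x); have h2 := hub_gt0 delta0 (y - x); have h3 := hub_gt0 delta0 y.
suff : hub delta y *+ 2 <= hub delta (y + x) + hub delta (y - x) by rewrite mulr2n; lra.
rewrite -(ler_pXn2r (ltn0Sn 1)) ?nnegrE ?mulrn_wge0 ?addr_ge0 ?hub_ge0 //.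
have -> : (hub delta y *+ 2) ^+ 2 = 4 * (y ^+ 2 + delta ^+ 2) by rewrite -hub_sq; ring.
have -> : (hub delta (y + x) + hub delta (y - x)) ^+ 2 = ((y + x) ^+ 2 + delta ^+ 2) +
    ((y - x) ^+ 2 + delta ^+ 2) + 2 * (hub delta (y + x) * hub delta (y - x)).
  by rewrite -(hub_sq delta (y + x)) -(hub_sq delta (y - x)); ring.
have : (y ^+ 2 - x ^+ 2 + delta ^+ 2) <= hub delta (y + x) * hub delta (y - x).
  apply: (@le_trans _ _ (Num.sqrt ((y ^+ 2 - x ^+ 2 + delta ^+ 2) ^+ 2))).
    by rewrite sqrtr_sqr ler_norm.
  rewrite /hub -sqrtrM ?addr_ge0 ?sqr_ge0 //; apply: ler_wsqrtr.
  by rewrite -subr_ge0; have := sqr_ge0 (delta * x); nra.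
by move=> h4; lra.
Qed.

Let is_derive_hub_int_affine (c s t : R) :
  is_derive t 1 (fun t : R => hub_int delta (c + s * t)) (hub delta (c + s * t) * s).
Proof.
have h1 : is_derive t 1 (fun t : R => c + s * t) s.
  have -> : (fun t : R => c + s * t) = (cst c + s \*: @idfun R) by [].
  by apply: is_derive_eq; rewrite add0r /GRing.scale /= mulr1.
exact: (@is_derive1_comp _ (hub_int delta) (fun t : R => c + s * t) t _ _
  (is_derive_hub_int delta0 _) h1).
Qed.

(** An antiderivative of [Dl x] in [y]. The explicit factors [1] and [-1] match the affine
    derivative rule, which is also needed for differentiation in [x]. *)
Let hub_int_diff2 x y := (hub_int delta (y + 1 * x) - hub_int delta y +
  (hub_int delta (y + (-1) * x) - hub_int delta y)) / 2.

Let is_derive_diff2_y x (y : R) : is_derive y 1 (hub_int_diff2 x) (Dl x y).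
Proof.
have e (c s : R) : is_derive y 1 (fun y : R => hub_int delta (y + s * c)) (hub delta (y + s * c)).
  have := is_derive_hub_int_affine (s * c) 1 y; rewrite mulr1 mul1r addrC.
  by congr is_derive; apply/funext => u; rewrite mul1r addrC.
have h1 := e x 1; have h2 := e x (-1); have h3 := is_derive_hub_int delta0 y.
have -> : hub_int_diff2 x = 2^-1 \*: (((fun y : R => hub_int delta (y + 1 * x)) - hub_int delta) +
   ((fun y : R => hub_int delta (y + (-1) * x)) - hub_int delta)).
  by apply/funext => u; rewrite /hub_int_diff2 mulrC.
have hh := is_deriveZ 2^-1 (is_deriveD (is_deriveB h1 h3) (is_deriveB h2 h3)).
suff -> : Dl x y = 2^-1 *: ((hub delta (y + 1 * x) - hub delta y) + (hub delta (y + -1 * x) - hub delta y)).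
  exact: hh.
by rewrite /Dl mul1r mulN1r /GRing.scale /= mulrC.
Qed.

Let integral_Dl x : (\int[lebesgue_measure]_(y in `[(- A)%R, A]) (Dl x y)%:E =
  (hub_int_diff2 x A - hub_int_diff2 x (- A))%:E)%E.
Proof.
have d0 := delta0; have hA := A72.
have cF y : {for y, continuous (hub_int_diff2 x)}.
  by apply: differentiable_continuous; apply/derivable1_diffP; case: (is_derive_diff2_y x y).
have chub y : {for y, continuous (hub delta)}.
  by apply: differentiable_continuous; apply/derivable1_diffP; case: (is_derive_hub delta0 y).
have cD : continuous (Dl x).
  move=> y.
  have e c : hub delta (z + c) @[z --> y] --> hub delta (y + c).
    apply: (@continuous_comp _ _ _ (fun z => z + c) (hub delta)); last exact: chub.
    by apply: cvgD; [exact: cvg_id|exact: cvg_cst].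
  apply: cvgM; last exact: cvg_cst.
  apply: cvgD.
    by apply: cvgB; [exact: (e x)|exact: chub].
  by apply: cvgB; [exact: (e (- x))|exact: chub].
rewrite (@continuous_FTC2 _ (Dl x) (hub_int_diff2 x)) ?EFinB //; first by lra.
- exact: continuous_subspaceT.
- split.
  + by move=> y _; case: (is_derive_diff2_y x y).
  + exact: cvg_at_right_filter (cF _).
  + exact: cvg_at_left_filter (cF _).
- by move=> y _; rewrite derive1E; case: (is_derive_diff2_y x y).
Qed.

(** Both sides vanish at 0, so derivatives in [x] are compared. That of the right-hand side is
    [hub (A + x) - hub (A - x)]; multiplied by the sum of these two values it is [4 * A * x], and
    the sum is at most [2 * A + 2 * delta]. The slope [9 / 5] follows as soon as [A] is at least
    [9 * delta]. *)
Let diff2_lower x : 0 <= x -> x <= A -> 9 / 10 * x ^+ 2 <= hub_int_diff2 x A - hub_int_diff2 x (- A).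
Proof.
have d0 := delta0; have hA := A72.
move=> x0 xA; pose K (z : R) := hub_int_diff2 z A - hub_int_diff2 z (- A) - 9 / 10 * z ^+ 2.
have K0 : K 0 = 0 by rewrite /K /hub_int_diff2 !mulr0 !addr0; ring.
suff : 0 <= K x by rewrite /K subr_ge0.
have [->|xn0] := eqVneq x 0; first by rewrite K0.
have xp : 0 < x by rewrite lt_neqAle eq_sym xn0.
have dK (z : R) : is_derive z 1 K (hub delta (A + z) - hub delta (A - z) - 9 / 5 * z).
  have h1 := is_derive_hub_int_affine A 1 z; have h2 := is_derive_hub_int_affine A (-1) z.
  have h3 := is_derive_hub_int_affine (- A) 1 z; have h4 := is_derive_hub_int_affine (- A) (-1) z.
  have -> : K = 2^-1 \*: ((fun t : R => hub_int delta (A + 1 * t)) + (fun t : R => hub_int delta (A + (-1) * t))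
     - ((fun t : R => hub_int delta (- A + 1 * t)) + (fun t : R => hub_int delta (- A + (-1) * t))))
     + cst (hub_int delta (- A) - hub_int delta A) - (9 / 10) \*: (@idfun R ^+ 2).
    apply/funext => u; rewrite /K /hub_int_diff2 /=.
    have sc (a b : R) : a *: (b : R^o) = a * b by [].
    by rewrite !fctE /= !sc; lra.
  have hX : is_derive z 1 (@idfun R ^+ 2) (2 * z).
    by apply: is_derive_eq; rewrite /= expr1 /GRing.scale /= mulr1.
  have hh := is_deriveB (is_deriveD (is_deriveZ 2^-1 (is_deriveB (is_deriveD h1 h2) (is_deriveD h3 h4)))
    (is_derive_cst (hub_int delta (- A) - hub_int delta A) z 1)) (is_deriveZ (9 / 10) hX).
  rewrite (_ : hub delta (A + z) - hub delta (A - z) - 9 / 5 * z =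
    2^-1 *: (hub delta (A + 1 * z) * 1 + hub delta (A + -1 * z) * -1
      - (hub delta (- A + 1 * z) * 1 + hub delta (- A + -1 * z) * -1)) + 0
      - (9 / 10) *: (2 * z)); first exact: hh.
  rewrite /GRing.scale /= !mulr1 !mul1r !mulN1r.
  have -> : hub delta (- A + z) = hub delta (A - z) by rewrite -hubN; congr hub; ring.
  have -> : hub delta (- A - z) = hub delta (A + z) by rewrite -hubN; congr hub; ring.
  lra.
have cK : {within `[0, x], continuous K}.
  apply: continuous_subspaceT => z; apply: differentiable_continuous.
  by apply/derivable1_diffP; case: (dK z).
have [c c0x] := MVT xp (fun z _ => dK z) cK.
rewrite K0 !subr0 => ->; move: c0x; rewrite in_itv /= => /andP[c0 cx].
apply: mulr_ge0 => //; have cA : c <= A by lra.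
rewrite subr_ge0.
have hp := hub_le_abs delta0 (A + c); have hm := hub_le_abs delta0 (A - c).
have sp := hub_sq delta (A + c); have sm := hub_sq delta (A - c).
rewrite ger0_norm in hp; last by lra.
rewrite ger0_norm in hm; last by lra.
have g1 := hub_gt0 delta0 (A + c); have g2 := hub_gt0 delta0 (A - c).
have e : (hub delta (A + c) - hub delta (A - c)) * (hub delta (A + c) + hub delta (A - c)) = 4 * A * c.
  by rewrite -subr_sqr sp sm; ring.
have s1 : hub delta (A + c) + hub delta (A - c) <= 2 * A + 2 * delta by lra.
rewrite -(@ler_pM2r _ (hub delta (A + c) + hub delta (A - c))); last by lra.
rewrite e; apply: (@le_trans _ _ (9 / 5 * c * (2 * A + 2 * delta))).
  by apply: ler_wpM2l => //; lra.
by rewrite -subr_ge0 (_ : _ - _ = c * (4 * A - 18 / 5 * A - 18 / 5 * delta)); [apply: mulr_ge0; lra|field].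
Qed.

Lemma huber_mean_lower x : `|x| <= A ->
  9 / 10 * x ^+ 2 / b0 <= mean L (fun y : R => hub delta (x - y) - hub delta (- y)).
Proof.
move=> xA; have d0 := delta0; have hA := A72; have b0' := b00.
have bg z : mbdd (fun y : R => hub delta (z - y) - hub delta (- y)).
  split.
    apply: measurable_funB; apply: (measurableT_comp hub_measurable).
      by apply: measurable_funB.
    exact: measurable_funN.
  exists `|z| => y; have := hub_lipschitz delta (z - y) (- y).
  by rewrite opprK subrK.
have -> : mean L (fun y : R => hub delta (x - y) - hub delta (- y)) = mean L (Dl `|x|).
  have e1 := mean_opp (bg x).
  have bgN : mbdd (fun y : R => hub delta (x - - y) - hub delta (- - y)).
    have [m1 [M hM]] := bg x; split; last by exists M => y; apply: hM.
    by apply: (measurableT_comp m1); exact: measurable_funN.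
  have e2 : Dl `|x| = (fun y : R => 2^-1 * ((hub delta (x - - y) - hub delta (- - y)) + (hub delta (x - y) - hub delta (- y)))).
    apply/funext => y; rewrite /Dl !opprK hubN mulrC; congr (_ * _).
    rewrite -(opprB y x) hubN (addrC x y).
    have [x0|x0] := leP 0 x; first by rewrite (ger0_norm x0).
    by rewrite (ltr0_norm x0) opprK; lra.
  rewrite e2 (meanZ L 2^-1 (mbddD bgN (bg x))) (meanD L bgN (bg x)) e1.
  by set u := mean _ _; lra.
rewrite -lee_fin meanE; last exact: mDl.
have hL' (B : set R) : measurable B -> L B = (\int[lebesgue_measure]_(y in (@id R) @^-1` B) (h y)%:E)%E.
  by move=> mB; rewrite hL.
rewrite (@ge0_integral_transfer _ _ _ (measurableTypeR R) R lebesgue_measure L (@id R) h _ _ _ hL' (EFin \o Dl `|x|)) //.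
- apply: (@le_trans _ _ (\int[lebesgue_measure]_(y in `[(- A)%R, A]) ((b0^-1)%:E * (Dl `|x| y)%:E))%E).
    rewrite ge0_integralZl_EFin //.
    + rewrite integral_Dl -EFinM lee_fin [leLHS]mulrC; apply: ler_wpM2l.
        by rewrite invr_ge0 ltW.
      by have := diff2_lower (normr_ge0 x) xA; rewrite real_normK ?num_real.
    + by move=> y _; rewrite lee_fin Dl_ge0.
    + by apply: measurable_funTS; apply/measurable_EFinP; case: (mDl `|x|).
    + by rewrite invr_ge0 ltW.
  apply: (@le_trans _ _ (\int[lebesgue_measure]_(y in `[(- A)%R, A]) ((Dl `|x| y)%:E * (h y)%:E))%E).
    apply: ge0_le_integral => //.
    + by move=> y _; rewrite -EFinM lee_fin mulr_ge0 ?Dl_ge0 // invr_ge0 ltW.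
    + apply: measurable_funTS; apply/measurable_EFinP; apply: measurable_funM => //.
      by case: (mDl `|x|).
    + apply: measurable_funTS; apply/measurable_EFinP; apply: measurable_funM => //.
      by case: (mDl `|x|).
    + move=> y /=; rewrite in_itv /= -ler_norml => hy; rewrite -!EFinM lee_fin mulrC.
      by rewrite ler_wpM2l ?Dl_ge0 ?hb.
  apply: ge0_subset_integral => //.
  + apply/measurable_EFinP; apply: measurable_funM => //.
    by case: (mDl `|x|).
  + by move=> y _; rewrite -EFinM lee_fin mulr_ge0 ?Dl_ge0.
- by apply/measurable_EFinP; case: (mDl `|x|).
- by move=> y; rewrite lee_fin Dl_ge0.
Qed.

End Density.

(** * Chaining and peeling *)
Section Process.
Variables (R : realType) (disp : measure_display) (Omega : measurableType disp).
Variable P : probability Omega R.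
Variables (I : finType) (X : I -> {RV P >-> R}) (L : probability R R).
Hypothesis indX : mutually_independent X.
Hypothesis lawX : forall i (B : set R), measurable B -> distribution P (X i) B = L B.

Variable G : R -> R -> R.
Hypothesis G0 : forall x, G 0 x = 0.
Hypothesis mG : forall z, measurable_fun setT (G z).
Hypothesis G_lip : forall z z' x, `|G z x - G z' x| <= `|z - z'|.

(** Two processes are instances: the loss difference, with [G] the increment of [hub], and the
    linear statistic, with [G z x = z * f x]. In both, increments are bounded entrywise by those of
    [Z], as Hoeffding requires. *)
Definition centered_sum (Z : {ffun I -> R}) (w : Omega) : R :=
  \sum_i (G (Z i) (X i w) - mean L (G (Z i))).

Lemma mbdd_G z : mbdd (G z).
Proof.
by split=> //; exists `|z| => x; have := G_lip z 0 x; rewrite G0 !subr0.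
Qed.

Lemma mbdd_centered_sum Z : mbdd (centered_sum Z).
Proof.
apply: mbdd_sum => i; apply: (mbdd_comp X i (f := fun y => G (Z i) y - mean L (G (Z i)))).
by apply: mbddB; [exact: mbdd_G|exact: mbdd_cst].
Qed.

Lemma centered_sum0 w : centered_sum 0 w = 0.
Proof.
rewrite /centered_sum big1 // => i _; rewrite !ffunE G0.
have -> : G 0 = (fun=> 0) by apply/funext.
by rewrite mean_cst subrr.
Qed.

Lemma centered_sumB Z Z' w : centered_sum Z w - centered_sum Z' w =
  \sum_i ((G (Z i) (X i w) - G (Z' i) (X i w)) - mean L (fun y => G (Z i) y - G (Z' i) y)).
Proof.
rewrite /centered_sum -sumrB; apply: eq_bigr => i _.
by rewrite meanB; [ring|exact: mbdd_G|exact: mbdd_G].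
Qed.

Lemma centered_sum_lip (Z Z' : {ffun I -> R}) w :
  `|centered_sum Z w - centered_sum Z' w| <= 2 * #|I|%:R * normF (Z - Z').
Proof.
rewrite centered_sumB; apply: le_trans (ler_norm_sum _ _ _) _.
rewrite [2 * _]mulrC -mulrA mulr_natl -sumr_const; apply: ler_sum => i _.
have b : mbdd (fun y => G (Z i) y - G (Z' i) y) by apply: mbddB; apply: mbdd_G.
have h1 : `|G (Z i) (X i w) - G (Z' i) (X i w)| <= normF (Z - Z').
  by apply: le_trans (G_lip _ _ _) _; have := coord_le_normF (Z - Z') i; rewrite !ffunE.
have h2 : `|mean L (fun y => G (Z i) y - G (Z' i) y)| <= normF (Z - Z').
  apply: mean_norm_le => // y.
  by apply: le_trans (G_lip _ _ _) _; have := coord_le_normF (Z - Z') i; rewrite !ffunE.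
by apply: le_trans (ler_normB _ _) _; rewrite mulr2n mulrDl mul1r lerD.
Qed.

Lemma measurable_increment Z Z' c :
  measurable [set w | c < `|centered_sum Z w - centered_sum Z' w|].
Proof.
apply: measurable_gtT; apply: measurableT_comp => //.
by apply: measurable_funB; case: (mbdd_centered_sum Z); case: (mbdd_centered_sum Z').
Qed.

Lemma increment_tail (Z Z' : {ffun I -> R}) (A t : R) : normF (Z - Z') <= A -> 0 < A -> 0 <= t ->
  (P [set w | (t * A < `|centered_sum Z w - centered_sum Z' w|)%R]
    <= (2 * expR (- (t ^+ 2 / 32)))%:E)%E.
Proof.
move=> ZA A0 t0.
have one (Y Y' : {ffun I -> R}) : normF (Y - Y') <= A ->
    (P [set w | (t * A < centered_sum Y w - centered_sum Y' w)%R] <= (expR (- (t ^+ 2 / 32)))%:E)%E.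
  move=> YA.
  have := @hoeffding R _ _ P I X L indX lawX (fun i y => G (Y i) y - G (Y' i) y)
    (fun i => `|Y i - Y' i|) A t _ _ _ A0 t0.
  under eq_set do rewrite -centered_sumB.
  apply=> [i|i y|]; first by apply: measurable_funB.
    exact: G_lip.
  apply: (@le_trans _ _ (normF (Y - Y') ^+ 2)).
    rewrite normF_sq; apply: ler_sum => i _.
    by rewrite real_normK ?num_real // !ffunE expr2.
  by rewrite lerXn2r ?nnegrE ?normF_ge0 // ltW.
have mE (Y Y' : {ffun I -> R}) : measurable [set w | (t * A < centered_sum Y w - centered_sum Y' w)%R].
  apply: measurable_gtT.
  by apply: measurable_funB; [case: (mbdd_centered_sum Y)|case: (mbdd_centered_sum Y')].
apply: (@le_trans _ _ (P ([set w | (t * A < centered_sum Z w - centered_sum Z' w)%R] `|`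
   [set w | (t * A < centered_sum Z' w - centered_sum Z w)%R]))).
  apply: le_measure; rewrite ?inE; [exact: measurable_increment|exact: measurableU|].
  move=> w /=; case: (ger0P (centered_sum Z w - centered_sum Z' w)) => _; first by left.
  by rewrite opprB; right.
apply: le_trans (measureU2 _ (mE _ _) (mE _ _)) _.
rewrite mulr2n mulrDl !mul1r EFinD; apply: leeD; apply: one => //.
by rewrite -normF_ffunN opprB.
Qed.

Section Chaining.
Variables (V : finType) (nb : R -> {ffun V -> R} -> Prop).
Variable S : nat -> seq {ffun V -> R}.
Hypothesis nbB : forall s t x y, nb s x -> nb t y -> nb (s + t) (x - y).
Hypothesis nbW : forall s t x, s <= t -> nb s x -> nb t x.
Hypothesis S0 : S 0 = [:: 0].
Hypothesis S_size : forall k, (size (S k) <= 4 ^ (#|V| * (k + 5)))%N.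
Hypothesis S_unit : forall k y, y \in S k -> nb 1 y.
Hypothesis S_cover : forall k x, nb 1 x -> exists2 y, y \in S k & nb (2 ^- k) (x - y).
Variables (Zm : {ffun V -> R} -> {ffun I -> R}) (Lp : R).
Hypothesis Zm0 : Zm 0 = 0.
Hypothesis Lp0 : 0 < Lp.
Hypothesis Zm_lip : forall x y eta, nb 1 x -> nb 1 y -> nb eta (x - y) ->
  normF (Zm x - Zm y) <= Lp * eta.
Variables (tau v : R).
Hypotheses (tau1 : 1 <= tau) (v1 : 1 <= v).
Hypothesis tauv : v + 33 * #|V|%:R <= tau ^+ 2 / 32.

Let scale k : R := Lp * (2 * 2 ^- k).

(** At most [4 ^ (11 * #|V| * (k + 1))] pairs occur, and [4 <= expR 3] turns this into the exponent
    [33 * #|V| * (k + 1)]. The threshold grows like [k + 1], its square in Hoeffding's exponent pays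
    for the pairs and for [(k + 1) * v], and the sum over levels still converges. *)
Lemma chaining_level k : exists B : set Omega, [/\ measurable B,
  (P B <= (2 * expR (- (k.+1%:R * v)))%:E)%E &
  forall w, ~ B w -> forall x y, x \in S k -> y \in S k.+1 -> nb (2 * 2 ^- k) (x - y) ->
    `|centered_sum (Zm x) w - centered_sum (Zm y) w| <= k.+1%:R * tau * scale k].
Proof.
have sc0 : 0 < scale k by rewrite !mulr_gt0 // invr_gt0 exprn_gt0.
have kt0 : 0 <= k.+1%:R * tau by rewrite mulr_ge0 //; have := tau1; lra.
(* Pairs that are not close receive the empty event, so the union may run over all pairs of the two
   nets. *)
pose A (xy : {ffun V -> R} * {ffun V -> R}) : set Omega :=
  if `[< nb 1 xy.1 /\ nb 1 xy.2 /\ nb (2 * 2 ^- k) (xy.1 - xy.2) >] then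
    [set w | k.+1%:R * tau * scale k < `|centered_sum (Zm xy.1) w - centered_sum (Zm xy.2) w|]
  else set0.
have mA xy : measurable (A xy).
  by rewrite /A; case: ifP => _ //; apply: measurable_increment.
pose q : R := 2 * expR (- ((k.+1%:R * tau) ^+ 2 / 32)).
have q0 : 0 <= q by rewrite mulr_ge0 ?expR_ge0.
have PA xy : (P (A xy) <= q%:E)%E.
  rewrite /A; case: asboolP => [[h1 [h2 h3]]|_]; last by rewrite measure0 lee_fin.
  by apply: increment_tail => //; apply: Zm_lip.
have [B [mB PB hB]] := union_bound (P := P)
  (s := [seq (x, y) | x <- S k, y <- S k.+1]) mA (fun xy _ => PA xy).
exists B; split=> //.
  apply: le_trans PB _; rewrite lee_fin big_tnth sumr_const card_ord size_allpairs.
  rewrite -[leLHS]mulr_natl /q mulrCA ler_wpM2l //.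
  have h4 : (4 : R) <= expR 3 by apply: le_trans (expR_ge1Dx _); lra.
  apply: (@le_trans _ _ (expR (33 * #|V|%:R * k.+1%:R) * expR (- ((k.+1%:R * tau) ^+ 2 / 32)))).
    rewrite ler_wpM2r ?expR_ge0 //.
    apply: (@le_trans _ _ ((4 ^ (#|V| * (11 * k.+1)))%N%:R)).
      rewrite ler_nat; apply: leq_trans (leq_mul (S_size _) (S_size _)) _.
      rewrite -expnD leq_exp2l // -mulnDr leq_mul2l; apply/orP; right; lia.
    rewrite natrX; apply: (@le_trans _ _ (expR 3 ^+ (#|V| * (11 * k.+1)))).
      by rewrite lerXn2r ?nnegrE ?expR_ge0.
    rewrite -expRM_natl ler_expR !natrM; lra.
  rewrite -expRD ler_expR exprMn.
  have k1 : 1 <= k.+1%:R :> R by rewrite ler1n.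
  have hv := tauv; have hv1 := v1.
  set n := k.+1%:R in k1 *; set M := #|V|%:R in hv *.
  have hn : n * (v + 33 * M) <= n * (tau ^+ 2 / 32) by apply: ler_wpM2l => //; lra.
  have t2 := sqr_ge0 tau; have : n * (tau ^+ 2 / 32) <= n ^+ 2 * (tau ^+ 2 / 32).
    by apply: ler_wpM2r; nra.
  lra.
move=> w nB x y xS yS hxy; rewrite leNgt; apply/negP => h; apply: nB.
apply: (hB w (x, y)); first exact: allpairs_f.
rewrite /A /= asboolT //; split; [exact: (S_unit xS)|split=> //; exact: (S_unit yS)].
Qed.

(* Beyond level [#|I|] the trivial Lipschitz bound takes over, so finitely many levels suffice. *)
Lemma chaining : exists B : set Omega, [/\ measurable B,
  (P B <= (4 * expR (- v))%:E)%E &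
  forall w, ~ B w -> forall x, nb 1 x -> `|centered_sum (Zm x) w| <= 9 * Lp * tau].
Proof.
have ht := tau1; have hv := v1; have hL := Lp0.
pose K := #|I|.+1.
pose Bk k := sval (cid (chaining_level k)).
have hBk k := svalP (cid (chaining_level k)).
have mBk k : measurable (Bk k) by have [] := hBk k.
have PBk k : k \in iota 0 K -> (P (Bk k) <= (2 * expR (- (k.+1%:R * v)))%:E)%E.
  by have [] := hBk k.
have [B [mB PB hB]] := union_bound mBk PBk.
have ev : expR (- v) <= 2^-1.
  have h2 : 2 <= expR v by apply: le_trans (expR_ge1Dx _); lra.
  by rewrite expRN lef_pV2 ?posrE ?expR_gt0.
exists B; split=> //.
  apply: le_trans PB _; rewrite lee_fin -mulr_sumr.
  rewrite (_ : iota 0 K = index_iota 0 K); last by rewrite /index_iota subn0.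
  suff : \sum_(0 <= k < K) expR (- (k.+1%:R * v)) <= 2 * expR (- v) by lra.
  suff H n : \sum_(0 <= k < n) expR (- (k.+1%:R * v)) <= (2 - 2 * 2 ^- n) * expR (- v).
    apply: le_trans (H K) _; rewrite ler_wpM2r ?expR_ge0 //.
    by rewrite gerBl mulr_ge0 // invr_ge0 exprn_ge0.
  have pw k : expR (- (k.+1%:R * v)) <= 2 ^- k * expR (- v).
    rewrite -mulrN expRM_natl exprS mulrC ler_wpM2r ?expR_ge0 // -exprVn.
    by rewrite lerXn2r ?nnegrE ?expR_ge0 // invr_ge0.
  elim: n => [|n IH]; first by rewrite big_geq // expr0 invr1; lra.
  rewrite big_nat_recr //=; apply: le_trans (lerD IH (pw n)) _.
  by rewrite -mulrDl ler_wpM2r ?expR_ge0 // exprS invfM; lra.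
move=> w nB x hx.
(* The bound is the partial sum of [j.+1%:R * tau * scale j] over [j < k]: the sum of
   [(j + 1) * 2 ^- j] is [4 - (2 * k + 4) * 2 ^- k]. *)
have level k y : (k <= K)%N -> y \in S k -> nb (2 ^- k) (x - y) ->
    `|centered_sum (Zm y) w| <= 2 * Lp * tau * (4 - (2 * k%:R + 4) * 2 ^- k).
  elim: k y => [|k IH] y kK yS hy.
    move: yS; rewrite S0 inE => /eqP ->; rewrite Zm0 centered_sum0 normr0.
    by rewrite expr0 invr1 mulr0 add0r mulr1 subrr mulr0.
  have [y' y'S hy'] := S_cover k hx.
  have h1 := IH y' (ltnW kK) y'S hy'.
  have nBk : ~ Bk k w by move=> h; apply: nB; apply: (hB w k) => //; rewrite mem_iota.
  have hyy : nb (2 * 2 ^- k) (y' - y).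
    have -> : y' - y = (x - y) - (x - y') by apply/ffunP => i; rewrite !ffunE; ring.
    apply: nbW (nbB hy hy').
    rewrite exprS invfM; have : 0 <= 2 ^- k :> R by rewrite invr_ge0 exprn_ge0.
    lra.
  have [_ _ /(_ w nBk y' y y'S yS hyy) h2] := hBk k.
  have h3 : `|centered_sum (Zm y) w| <= `|centered_sum (Zm y') w| +
      `|centered_sum (Zm y') w - centered_sum (Zm y) w|.
    rewrite -[X in `|X| <= _](subKr (centered_sum (Zm y') w)).
    exact: ler_normB.
  apply: le_trans h3 (le_trans (lerD h1 h2) _).
  rewrite le_eqVlt; apply/orP; left; apply/eqP.
  rewrite /scale exprS invfM -!natr1; field.
  by rewrite expf_neq0.
have [y yS hy] := S_cover K hx.
have h1 := level K y (leqnn _) yS hy.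
have p0 : 0 <= 2 ^- K :> R by rewrite invr_ge0 exprn_ge0.
have h2 : 2 * Lp * tau * (4 - (2 * K%:R + 4) * 2 ^- K) <= 8 * Lp * tau.
  have : 0 <= 2 * Lp * tau * ((2 * K%:R + 4) * 2 ^- K).
    by rewrite !mulr_ge0 ?addr_ge0 ?mulr_ge0 //; lra.
  lra.
have h3 := centered_sum_lip (Zm x) (Zm y) w.
have h4 : 2 * #|I|%:R * normF (Zm x - Zm y) <= Lp * tau.
  apply: (@le_trans _ _ (2 * #|I|%:R * (Lp * 2 ^- K))).
    by apply: ler_wpM2l; [rewrite mulr_ge0|apply: Zm_lip => //; exact: (S_unit yS)].
  rewrite mulrCA ler_wpM2l //; first by lra.
  apply: le_trans ht; rewrite ler_pdivrMr ?exprn_gt0 // mul1r /K exprS ler_wpM2l //.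
  by rewrite -natrX ler_nat ltnW // ltn_expl.
have -> : centered_sum (Zm x) w = centered_sum (Zm y) w + (centered_sum (Zm x) w - centered_sum (Zm y) w).
  by rewrite addrC subrK.
apply: le_trans (ler_normD _ _) _; lra.
Qed.

End Chaining.
End Process.

(** * Tucker parameters and uniform deviations *)

Section TuckerParameters.
Variables (R : realType) (m : nat) (d e : 'I_m -> nat).

Definition tucker_param : finType :=
  (tidx e + {k : 'I_m & ('I_(d k) * 'I_(e k))%type})%type.

Lemma card_tucker_param : #|tucker_param| = DoF d e.
Proof.
rewrite card_sum card_tagged sumnE big_map big_enum /= /DoF; congr (_ + _)%N.
  rewrite card_dep_ffun foldrE big_map big_enum /=.
  by apply: eq_bigr => k _; rewrite card_ord.
by apply: eq_bigr => k _; rewrite card_prod !card_ord.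
Qed.

Implicit Types p q : {ffun tucker_param -> R}.

Definition param_core p : tensor R e := [ffun v => p (inl v)].

Definition param_factor p k : 'M[R]_(d k, e k) :=
  \matrix_(i, j) p (inr (Tagged (fun k : 'I_m => ('I_(d k) * 'I_(e k))%type) (i, j))).

(** Balls of the maximum of the Frobenius norm of the core and the operator norms of the factors.
    Operator norms keep the Lipschitz constant of the parametrization independent of the ranks. *)
Definition param_ball (t : R) p : Prop :=
  [/\ 0 <= t, normF (param_core p) <= t & forall k, opb t (param_factor p k)].

Lemma param_coreB p q : param_core (p - q) = param_core p - param_core q.
Proof. by apply/ffunP => v; rewrite !ffunE. Qed.

Lemma param_factorB p q k : param_factor (p - q) k = param_factor p k - param_factor q k.
Proof. by apply/matrixP => i j; rewrite !mxE !ffunE. Qed.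

Lemma param_ballB s t p q : param_ball s p -> param_ball t q -> param_ball (s + t) (p - q).
Proof.
move=> [s0 cp fp] [t0 cq fq]; split; first exact: addr_ge0.
  by rewrite param_coreB; apply: le_trans (normF_ffunB _ _) _; apply: lerD.
by move=> k; rewrite param_factorB; apply: opbB.
Qed.

Lemma param_ballZ a t p : 0 <= a -> param_ball t p -> param_ball (a * t) [ffun i => a * p i].
Proof.
move=> a0 [t0 cp fp]; split; first exact: mulr_ge0.
  have -> : normF (param_core [ffun i => a * p i]) = a * normF (param_core p).
    by rewrite -[a in RHS]ger0_norm // -normFZ; apply: normF_eq => v; rewrite !ffunE.
  exact: ler_wpM2l.
move=> k; have -> : param_factor [ffun i => a * p i] k = a *: param_factor p k.
  by apply/matrixP => i j; rewrite !mxE ffunE.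
exact: opbZ.
Qed.

Lemma param_ball_le s t p : s <= t -> param_ball s p -> param_ball t p.
Proof.
move=> st [s0 cp fp]; split; [exact: le_trans st|exact: le_trans st|].
by move=> k; apply: opb_le (fp k).
Qed.

Lemma param_ball_bounded t p i : param_ball t p -> `|p i| <= t.
Proof.
move=> [t0 cp fp]; case: i => [v|[k [i j]]].
  by apply: le_trans cp; have := coord_le_normF (param_core p) v; rewrite ffunE.
by have := opb_entry i j (fp k); rewrite mxE.
Qed.

Lemma param_ball_small p : (forall i, `|p i| <= 1) -> param_ball #|tucker_param|%:R p.
Proof.
move=> p1.
have sub (J : finType) (g : J -> R) (f : J -> tucker_param) : injective f ->
    (forall j, `|g j| <= 1) -> normF g <= #|tucker_param|%:R.
  move=> finj g1; apply: le_trans (normF_le_sum _) _.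
  apply: (@le_trans _ _ #|J|%:R); last by rewrite ler_nat (leq_card f finj).
  by rewrite -sum1_card natr_sum; apply: ler_sum.
split=> //.
  by apply: (sub _ _ (fun v => inl v)) => [x y []|v]; rewrite ?ffunE.
move=> k; apply: opb_le (opb_mnorm _).
rewrite mnorm_normF; apply: (sub _ _ (fun ij => inr (Tagged (fun k : 'I_m => ('I_(d k) * 'I_(e k))%type) ij))).
  by move=> x y [] /eqP; rewrite eq_Tagged => /eqP.
by move=> q; rewrite mxE.
Qed.

(** The scale [rho] is kept outside the parameters, so that the same nets of the unit ball serve
    tensors of every size. *)
Definition param_tensor (rho : R) p : tensor R d :=
  [ffun w => rho * multilinear_mul (param_core p) (param_factor p) w].

Lemma param_tensor0 rho : param_tensor rho 0 = 0.
Proof.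
apply/ffunP => w; rewrite !ffunE big1 ?mulr0 // => v _.
by rewrite !ffunE mul0r.
Qed.

Lemma param_tensor_lip rho p q eta : 0 <= rho -> param_ball 1 p -> param_ball 1 q ->
  param_ball eta (p - q) ->
  normF (param_tensor rho p - param_tensor rho q) <= (m%:R + 1) * rho * eta.
Proof.
move=> rho0 [_ cp fp] [_ cq fq] [_]; rewrite param_coreB => cpq fpq.
have -> : normF (param_tensor rho p - param_tensor rho q) =
   rho * normF (multilinear_mul (param_core p) (param_factor p) -
                multilinear_mul (param_core q) (param_factor q)).
  rewrite -[rho in RHS]ger0_norm // -normFZ; apply: normF_eq => w.
  rewrite /param_tensor; move: (multilinear_mul (param_core p) _) => a.
  by move: (multilinear_mul _ _) => b; rewrite !ffunE; ring.
rewrite (mulrC (m%:R + 1)) -mulrA ler_wpM2l //; apply: mlm_lipschitz => // k.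
by rewrite -param_factorB.
Qed.

Lemma param_tensor_onto rho (Z : tensor R d) : 0 < rho -> rank_le e Z -> normF Z <= rho ->
  exists2 p, param_ball 1 p & param_tensor rho p = Z.
Proof.
move=> rho0 rZ nZ; have [C [U [ZE oU nC]]] := rank_le_decomp rZ.
pose p : {ffun tucker_param -> R} := [ffun i => match i with
  | inl v => rho^-1 * C v
  | inr u => U (tag u) (tagged u).1 (tagged u).2 end].
have cE : param_core p = [ffun v => rho^-1 * C v] by apply/ffunP => v; rewrite !ffunE.
have fE k : param_factor p k = U k by apply/matrixP => i j; rewrite !mxE ffunE.
exists p; first split=> //.
- have -> : normF (param_core p) = rho^-1 * normF C.
    rewrite -[rho^-1]ger0_norm ?invr_ge0 ?ltW // -normFZ.
    by apply: normF_eq => v; rewrite cE ffunE.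
  rewrite mulrC ler_pdivrMr // mul1r; exact: le_trans nC nZ.
- by move=> k; rewrite fE.
apply/ffunP => w; rewrite ffunE cE (eq_mlm _ fE) mlmZl ffunE ZE mulrA mulfV ?mul1r //.
exact: lt0r_neq0.
Qed.

Variables (disp : measure_display) (Omega : measurableType disp) (P : probability Omega R).
Variables (X : tidx d -> {RV P >-> R}) (L : probability R R).
Hypothesis indX : mutually_independent X.
Hypothesis lawX : forall i (B : set R), measurable B -> distribution P (X i) B = L B.
Variable G : R -> R -> R.
Hypothesis G0 : forall x, G 0 x = 0.
Hypothesis mG : forall z, measurable_fun setT (G z).
Hypothesis G_lip : forall z z' x, `|G z x - G z' x| <= `|z - z'|.

Lemma uniform_deviation rho tau v : 0 < rho -> 1 <= tau -> 1 <= v ->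
  v + 33 * (DoF d e)%:R <= tau ^+ 2 / 32 ->
  exists B : set Omega, [/\ measurable B, (P B <= (4 * expR (- v))%:E)%E &
    forall w, ~ B w -> forall Z : tensor R d, rank_le e Z -> normF Z <= rho ->
      `|centered_sum X L G Z w| <= 9 * ((m%:R + 1) * rho) * tau].
Proof.
move=> rho0 tau1 v1 tauv; rewrite -card_tucker_param in tauv.
have K0 : 0 <= #|tucker_param|%:R :> R by [].
have net k := net_exists param_ballB param_ballZ param_ball_le param_ball_bounded param_ball_small k K0.
(* The coarsest net is reduced to 0: it covers the unit ball at scale 1, and the process vanishes
   there, so the chain has a trivial root. *)
pose S k := if k is k'.+1 then sval (cid (net k'.+1)) else [:: 0].
have S0 : S 0 = [:: 0] by [].
have ball0 : param_ball 1 0.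
  apply: param_ball_le (_ : param_ball 0 0); first exact: ler01.
  have := param_ballZ (lexx 0) (param_ball_small (p := 0) _); rewrite mul0r.
  have -> : [ffun i => 0 * (0 : {ffun tucker_param -> R}) i] = 0.
    by apply/ffunP => i; rewrite !ffunE mul0r.
  by apply=> i; rewrite ffunE normr0.
have S_size k : (size (S k) <= 4 ^ (#|tucker_param| * (k + 5)))%N.
  case: k => [|k]; first by rewrite /= expn_gt0.
  by rewrite /S; case: (cid _) => s [].
have S_unit k y : y \in S k -> param_ball 1 y.
  case: k => [|k]; first by rewrite inE => /eqP ->.
  by rewrite /S; case: (cid _) => s [? h ?]; apply: h.
have S_cover k x : param_ball 1 x -> exists2 y, y \in S k & param_ball (2 ^- k) (x - y).
  case: k => [|k]; last by rewrite /S; case: (cid _) => s [? ? h]; apply: h.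
  by exists 0; rewrite ?inE // subr0 expr0 invr1.
have m1 : 0 < m%:R + 1 :> R by rewrite ltr_wpDl.
have Lp0 : 0 < (m%:R + 1) * rho by rewrite mulr_gt0.
have [B [mB PB hB]] := @chaining R _ _ P _ X L indX lawX G G0 mG G_lip _ param_ball S
  param_ballB param_ball_le S0 S_size S_unit S_cover (param_tensor rho) _
  (param_tensor0 rho) Lp0 (fun x y eta => @param_tensor_lip rho x y eta (ltW rho0)) tau v tau1 v1 tauv.
exists B; split=> // w nB Z rZ nZ.
by have [p hp <-] := param_tensor_onto rho0 rZ nZ; apply: hB.
Qed.

End TuckerParameters.

(** Entrywise, [hub] lies between the modulus and the modulus plus [delta], so each gap is at least
    [|a j| - 2 * |v j| - delta]. The factor 2 here times the l1 bound [3 * n * gamma] gives the 6 of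
    the statement. For [a = 0] the inverse of the sup norm is 0, as the convention demands. *)
Lemma huber_gap_lower (R : realType) (J : finType) (delta : R) (u v a : J -> R) :
  0 < delta -> (forall j, a j = u j - v j) ->
  (norm_sup a)^-1 * normF a ^+ 2 - 2 * \sum_j `|v j| - #|J|%:R * delta
    <= pseudo_huber delta u - pseudo_huber delta v.
Proof.
move=> d0 aE.
have supge j : `|a j| <= norm_sup a by apply: (le_bigmax _ (fun j => `|a j|)).
have s0 : 0 <= norm_sup a by apply: bigmax_ge_id.
have h1 : (norm_sup a)^-1 * normF a ^+ 2 <= \sum_j `|a j|.
  have [->|sn0] := eqVneq (norm_sup a) 0; first by rewrite invr0 mul0r sumr_ge0.
  have sp : 0 < norm_sup a by rewrite lt_neqAle eq_sym sn0.
  rewrite mulrC ler_pdivrMr // normF_sq mulr_suml; apply: ler_sum => j _.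
  rewrite -expr2 -(real_normK (num_real _)) expr2; exact: ler_wpM2l.
have h2 j : `|a j| - 2 * `|v j| - delta <= hub delta (u j) - hub delta (v j).
  have hu := hub_ge_abs delta (u j); have hv := hub_le_abs d0 (v j).
  have : `|a j| <= `|u j| + `|v j| by rewrite aE ler_normB.
  lra.
apply: (@le_trans _ _ (\sum_j (`|a j| - 2 * `|v j| - delta))).
  rewrite !sumrB sumr_const -mulr_sumr -[X in _ <= _ - X]mulr_natl.
  by rewrite !lerD2r.
by rewrite /pseudo_huber -sumrB; apply: ler_sum => j _; apply: h2.
Qed.

Section Rows.
Variables (R : realType) (m : nat) (d : 'I_m -> nat) (k : 'I_m) (j : 'I_(d k)).

Definition row_set : {set tidx d} := [set w : tidx d | w k == j]%SET.

Lemma sum_row_set (F : tidx d -> R) :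
  \sum_(w in row_set) F w = \sum_(c < #|cidx d k|) F (insert_idx j (enum_val c)).
Proof.
rewrite (reindex (fun p : 'I_(d k) * cidx d k => insert_idx p.1 p.2)) /=; last first.
  exact/onW_bij/insert_idx_bij.
rewrite (eq_bigl (fun p : 'I_(d k) * cidx d k => (p.1 == j) && true)); last first.
  by move=> p; rewrite finset.inE insert_idx_eq andbT.
rewrite -(pair_big (fun i => i == j) xpredT (fun i c => F (insert_idx i c))) /= big_pred1_eq.
rewrite (reindex (@enum_val _ (mem (cidx d k)))) //=.
exact/onW_bij/enum_val_bij.
Qed.

Lemma card_row_set : #|row_set| = codim d k.
Proof.
rewrite -card_cidx; apply/eqP; rewrite -(eqr_nat R) -sum1_card natr_sum.
by rewrite (sum_row_set (fun=> 1)) sumr_const card_ord.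
Qed.

End Rows.

Lemma sum_tensor_rows (R : realType) m (d : 'I_m -> nat) (k : 'I_m) (F : tidx d -> R) :
  \sum_w F w = \sum_(j < d k) \sum_(w in row_set j) F w.
Proof.
rewrite (partition_big (fun w : tidx d => w k) xpredT) //=.
by apply: eq_bigr => j _; apply: eq_bigl => w; rewrite finset.inE.
Qed.

Lemma integral_ge_on_set (R : realType) d (T : measurableType d) (mu : {measure set T -> \bar R})
    (B : set T) (f : T -> R) (c : R) : measurable B -> measurable_fun setT f ->
  (forall y, 0 <= f y) -> 0 <= c -> (forall y, B y -> c <= f y) ->
  (c%:E * mu B <= \int[mu]_y (f y)%:E)%E.
Proof.
move=> mB mf f0 c0 cf.
rewrite -[X in (_ * mu X)%E]setIT -integral_indic // -ge0_integralZl_EFin //; last first.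
  by apply/measurable_EFinP; exact: measurable_indic.
apply: ge0_le_integral => //.
- by move=> y _; rewrite mule_ge0 // lee_fin.
- by apply/measurable_EFinP; apply: measurable_funM => //; apply: measurable_indic.
- exact/measurable_EFinP.
move=> y _; rewrite -EFinM lee_fin indicE.
by case: (boolP (y \in _)) => [/set_mem /cf|_]; rewrite ?mulr1 ?mulr0.
Qed.

(** * The law of the noise *)

Section NoiseLaw.
Variables (R : realType) (disp0 : measure_display) (Omega0 : measurableType disp0).
Variables (P0 : probability Omega0 R) (xi : {RV P0 >-> R}) (eps gamma b0 radius : R).
Hypothesis noise : noise_condition_I xi eps gamma b0 radius.
Hypothesis radius0 : 0 < radius.

Lemma noise_gamma_ge0 : 0 <= gamma.
Proof. by have [_ h _ _] := noise; rewrite -lee_fin h poweR_ge0. Qed.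

(** The moment is a priori an extended real; the value [+oo] is excluded because its power would be
    [+oo] and not the real number [gamma]. *)
Lemma noise_moment :
  (\int[distribution P0 xi]_y (`|y| `^ (2 + eps))%:E = (gamma `^ (2 + eps))%:E)%E.
Proof.
have [e0 h _ _] := noise.
have p0 : 2 + eps != 0 by rewrite gt_eqF // addr_gt0.
rewrite ge0_integral_distribution; last 2 first.
- apply/measurable_EFinP; exact: measurable_normp.
- by move=> y; rewrite lee_fin powR_ge0.
rewrite unlock in h; set E := (X in X = _).
have {h} : gamma%:E = (E `^ (2 + eps)^-1)%E by exact: h.
have E0 : (0 <= E)%E by apply: integral_ge0 => w _; rewrite lee_fin powR_ge0.
case: E E0 => [x x0||//].
- rewrite poweR_EFin => -[->]; rewrite -powRrM mulVf // powRr1 //.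
- by move=> _; rewrite poweRyr // invr_neq0.
Qed.

(** A zero moment contradicts the mass at least [radius / (2 * b0)] that the density puts on
    [[radius / 2, radius]]. Positivity is needed to truncate the rows at a multiple of [gamma]. *)
Lemma noise_gamma_gt0 : 0 < gamma.
Proof.
have [e0 _ b00 [h [[mh h0 hL] _ hb]]] := noise.
rewrite lt_neqAle noise_gamma_ge0 andbT eq_sym; apply/eqP => g0.
have p0 : 2 + eps != 0 by rewrite gt_eqF // addr_gt0.
have := noise_moment; rewrite g0 powR0 //.
set L := distribution P0 xi; pose B : set R := `[radius / 2, radius]%classic.
have mB : measurable B by exact: measurable_itv.
have r0 := radius0.
have LB : ((b0^-1 * (radius / 2))%:E <= L B)%E.
  rewrite [X in (_ <= X)%E](hL B mB).
  apply: (@le_trans _ _ (\int[lebesgue_measure]_(y in B) (b0^-1)%:E)%E).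
    rewrite integral_cst //= lebesgue_measure_itv /= lte_fin ifT; last by lra.
    by rewrite -EFinB -EFinM lee_fin ler_wpM2l ?invr_ge0 ?(ltW b00) //; lra.
  apply: ge0_le_integral => //.
  - by move=> y _; rewrite lee_fin invr_ge0 ltW.
  - by apply: measurable_funTS; apply/measurable_EFinP.
  - move=> y; rewrite /B /= in_itv /= => /andP[y1 y2]; rewrite lee_fin hb // ger0_norm //; lra.
have : (((radius / 2) `^ (2 + eps))%:E * L B <= \int[L]_y (`|y| `^ (2 + eps))%:E)%E.
  apply: (@integral_ge_on_set _ _ _ (distribution P0 xi) B (fun y : R => `|y| `^ (2 + eps))) => //.
  - exact: measurable_normp.
  - by rewrite powR_ge0.
  move=> y; rewrite /B /= in_itv /= => /andP[y1 y2].
  by rewrite ge0_ler_powR ?nnegrE ?normr_ge0 //; [lra|lra|rewrite ger0_norm; lra].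
move=> h1 h2; rewrite h2 in h1.
have : ((radius / 2) `^ (2 + eps) * (b0^-1 * (radius / 2)) <= 0).
  rewrite -lee_fin; apply: le_trans h1; rewrite EFinM; apply: lee_wpmul2l => //.
  by rewrite lee_fin powR_ge0.
by apply/negP; rewrite -ltNge !mulr_gt0 ?powR_gt0 ?invr_gt0 ?divr_gt0.
Qed.

End NoiseLaw.

(** The core size grows by [2 ^ m] and the factor sizes by 2, which is at most [2 ^ m] for positive
    [m]. *)
Lemma DoF_double m (d r : 'I_m -> nat) : (0 < m)%N ->
  (DoF d (fun k => 2 * r k)%N <= 2 ^ m * DoF d r)%N.
Proof.
move=> m0; rewrite /DoF mulnDr big_split /= prod_nat_const card_ord leq_add2l.
rewrite big_distrr /=; apply: leq_sum => k _.
by rewrite mulnCA leq_mul2r -[X in (X <= _)%N]expn1 leq_exp2l // m0 orbT.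
Qed.

Lemma dyadic_shell (R : realType) (S : nat) (x : R) : 1 <= x -> x < 2 ^+ S ->
  exists2 s, (s < S)%N & 2 ^+ s <= x /\ x <= 2 ^+ s.+1.
Proof.
move=> x1; elim: S => [|S IH] xS; first by move: xS; rewrite expr0 ltNge x1.
have [/IH[s sS h]|h] := ltP x (2 ^+ S); first by exists s => //; apply: ltnW.
by exists S => //; split=> //; apply: ltW.
Qed.

(** * The three exceptional events *)

Section Events.
Variables (R : realType) (m : nat) (d : 'I_m -> nat).
Variables (disp : measure_display) (Omega : measurableType disp) (P : probability Omega R).
Variables (X : tidx d -> {RV P >-> R}) (L : probability R R).
Hypothesis indX : mutually_independent X.
Hypothesis lawX : forall i (B : set R), measurable B -> distribution P (X i) B = L B.

Lemma rows_event (eps gamma : R) : 0 < eps -> 0 < gamma -> (forall k, 0 < d k)%N ->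
  (\int[L]_y (`|y| `^ (2 + eps))%:E = (gamma `^ (2 + eps))%:E)%E ->
  exists B : set Omega, [/\ measurable B,
  (P B <= (5 * \sum_k (d k)%:R * (codim d k)%:R `^ (- 1 - Num.min 1 eps))%:E)%E &
  forall w, ~ B w -> forall (k : 'I_m) (j : 'I_(d k)),
    \sum_(i in row_set j) `|X i w| <= 3 * (codim d k)%:R * gamma].
Proof.
move=> eps0 gamma0 dk momp.
have c0 k (j : 'I_(d k)) : (0 < #|row_set j|)%N.
  by rewrite (card_row_set R) prodn_cond_gt0.
pose Row := {k : 'I_m & 'I_(d k)}.
have H (q : Row) := row_tail indX lawX eps0 gamma0 momp (c0 (tag q) (tagged q)).
pose A q := sval (cid (H q)); have hA q := svalP (cid (H q)).
have mA q : measurable (A q) by have [] := hA q.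
have PA q : q \in enum {: Row} ->
    (P (A q) <= (5 * (codim d (tag q))%:R `^ (- 1 - Num.min 1 eps))%:E)%E.
  by move=> _; have [_ h _] := hA q; move: h; rewrite -/(A q) (card_row_set R).
have [B [mB PB hB]] := union_bound mA PA.
exists B; split=> //.
  apply: le_trans PB _; rewrite lee_fin big_enum /= -mulr_sumr.
  pose c k : R := (codim d k)%:R `^ (- 1 - Num.min 1 eps).
  have -> : \sum_(q : Row) (codim d (tag q))%:R `^ (- 1 - Num.min 1 eps) =
      \sum_k \sum_(j : 'I_(d k)) c k.
    by rewrite (sig_big_dep xpredT (fun k => xpredT) (fun k _ => c k)).
  by rewrite ler_wpM2l //; apply: ler_sum => k _; rewrite sumr_const card_ord mulr_natl.
move=> w nB k j.
have [_ _ h] := hA (Tagged (fun k => 'I_(d k)) j).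
rewrite -(card_row_set R j); apply: h => hw; apply: nB.
by apply: (hB w (Tagged (fun k => 'I_(d k)) j)) => //; rewrite mem_enum.
Qed.

Variables (e : 'I_m -> nat) (tau v : R).
Hypotheses (tau1 : 1 <= tau) (v1 : 1 <= v).
Hypothesis tauv : v + 33 * (DoF d e)%:R <= tau ^+ 2 / 32.

(** The statistic is homogeneous in [Z], so the deviation bound on the unit ball rescales to all
    norms without peeling. *)
Lemma linear_event (f : R -> R) : mbdd f -> (forall y, `|f y| <= 1) -> mean L f = 0 ->
  exists B : set Omega, [/\ measurable B, (P B <= (4 * expR (- v))%:E)%E &
    forall w, ~ B w -> forall Z : tensor R d, rank_le e Z ->
      `|\sum_i Z i * f (X i w)| <= 9 * (m%:R + 1) * tau * normF Z].
Proof.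
move=> bf f1 Ef; pose G (z x : R) := z * f x.
have G0 x : G 0 x = 0 by rewrite /G mul0r.
have mG z : measurable_fun setT (G z) by apply: measurable_funM => //; case: bf.
have G_lip z z' x : `|G z x - G z' x| <= `|z - z'|.
  by rewrite /G -mulrBl normrM -[leRHS]mulr1 ler_wpM2l.
have [B [mB PB hB]] := uniform_deviation indX lawX G0 mG G_lip ltr01 tau1 v1 tauv.
exists B; split=> // w nB Z rZ.
have [Z0|Zn0] := eqVneq (normF Z) 0.
  rewrite Z0 mulr0 big1 ?normr0 // => i _.
  have := coord_le_normF Z i; rewrite Z0 normr_le0 => /eqP ->.
  by rewrite mul0r.
have Zp : 0 < normF Z by rewrite lt_neqAle eq_sym Zn0 normF_ge0.
pose Z' : tensor R d := [ffun i => (normF Z)^-1 * Z i].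
have rZ' : rank_le e Z'.
  move=> k; have -> : matricize k Z' = (normF Z)^-1 *: matricize k Z.
    by apply/matrixP => i j; rewrite !mxE ffunE.
  by rewrite mxrank_scale_nz ?invr_neq0.
have nZ' : normF Z' <= 1.
  have -> : normF Z' = (normF Z)^-1 * normF Z.
    rewrite -[(normF Z)^-1]ger0_norm ?invr_ge0 ?normF_ge0 // -normFZ.
    by apply: normF_eq => i; rewrite ffunE.
  by rewrite mulVf.
have := hB w nB Z' rZ' nZ'.
have -> : centered_sum X L G Z' w = (normF Z)^-1 * \sum_i Z i * f (X i w).
  rewrite /centered_sum mulr_sumr; apply: eq_bigr => i _.
  by rewrite /G meanZ // Ef mulr0 subr0 ffunE mulrA.
rewrite normrM ger0_norm ?invr_ge0 ?normF_ge0 // mulrC ler_pdivrMr //.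
by rewrite mulr1.
Qed.

Variable G : R -> R -> R.
Hypothesis G0 : forall x, G 0 x = 0.
Hypothesis mG : forall z, measurable_fun setT (G z).
Hypothesis G_lip : forall z z' x, `|G z x - G z' x| <= `|z - z'|.

(* Peeling: on the dyadic shell of radius [2^s a] the deviation [2^s tau]
   is affordable, so the failure probabilities sum up geometrically. *)
Lemma peeling_event (a M : R) : 0 < a ->
  exists B : set Omega, [/\ measurable B, (P B <= (8 * expR (- v))%:E)%E &
    forall w, ~ B w -> forall Z : tensor R d, rank_le e Z ->
      a <= normF Z -> normF Z <= M ->
      `|centered_sum X L G Z w| <= 18 * (m%:R + 1) * tau / a * normF Z ^+ 2].
Proof.
move=> a0; have t1 := tau1; have hv1 := v1; have htv := tauv.
(* The a priori bound [M] leaves finitely many shells: [2 ^ S] exceeds [M / a]. *)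
pose S := (Num.truncn (M / a)).+1.
have ge2 s : 1 <= 2 ^+ s :> R by apply: exprn_ege1; lra.
have H s : exists B : set Omega, [/\ measurable B, (P B <= (4 * expR (- (v + s%:R)))%:E)%E &
    forall w, ~ B w -> forall Z : tensor R d, rank_le e Z -> normF Z <= 2 ^+ s.+1 * a ->
      `|centered_sum X L G Z w| <= 9 * ((m%:R + 1) * (2 ^+ s.+1 * a)) * (2 ^+ s * tau)].
  apply: uniform_deviation => //.
  - by rewrite mulr_gt0 // exprn_gt0.
  - by apply: mulr_ege1.
  - by have : 0 <= s%:R :> R by []; lra.
  have D0 : 0 <= (DoF d e)%:R :> R by [].
  (* Level [s] asks for the failure exponent [v + s]; since [1 + s] is at most [4 ^ s], enlarging
     [tau] by [2 ^ s] pays for it. *)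
  have s4 : 1 + s%:R <= (2 ^+ s) ^+ 2 :> R.
    rewrite -exprM mulnC exprM -natrX -natrX -[1]/(1%:R) -natrD ler_nat add1n.
    by rewrite ltn_expl.
  rewrite exprMn -mulrA; have s0 : 0 <= s%:R :> R by [].
  apply: (@le_trans _ _ ((1 + s%:R) * (v + 33 * (DoF d e)%:R))).
    by nra.
  by apply: ler_pM; lra.
pose A s := sval (cid (H s)); have hA s := svalP (cid (H s)).
have mA s : measurable (A s) by have [] := hA s.
have PA s : s \in iota 0 S -> (P (A s) <= (4 * expR (- (v + s%:R)))%:E)%E.
  by have [] := hA s.
have [B [mB PB hB]] := union_bound mA PA.
exists B; split=> //.
  apply: le_trans PB _; rewrite lee_fin -mulr_sumr.
  rewrite (_ : iota 0 S = index_iota 0 S); last by rewrite /index_iota subn0.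
  suff : \sum_(0 <= s < S) expR (- (v + s%:R)) <= 2 * expR (- v) by lra.
  suff Hn n : \sum_(0 <= s < n) expR (- (v + s%:R)) <= (2 - 2 * 2 ^- n) * expR (- v).
    apply: le_trans (Hn S) _; rewrite ler_wpM2r ?expR_ge0 //.
    by rewrite gerBl mulr_ge0 // invr_ge0 exprn_ge0.
  have e1 : expR (- 1) <= 2^-1 :> R.
    have h2 : 2 <= expR 1 :> R by apply: le_trans (expR_ge1Dx _); lra.
    by rewrite expRN lef_pV2 ?posrE ?expR_gt0.
  have pw s : expR (- (v + s%:R)) <= 2 ^- s * expR (- v).
    rewrite opprD expRD mulrC ler_wpM2r ?expR_ge0 // -[X in - X]mulr1 -mulrN.
    by rewrite expRM_natl -exprVn lerXn2r ?nnegrE ?expR_ge0 // invr_ge0.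
  elim: n => [|n IH]; first by rewrite big_geq // expr0 invr1; lra.
  rewrite big_nat_recr //=; apply: le_trans (lerD IH (pw n)) _.
  by rewrite -mulrDl ler_wpM2r ?expR_ge0 // exprS invfM; lra.
move=> w nB Z rZ aZ ZM.
have [|| s sS [s1 s2]] := @dyadic_shell _ S (normF Z / a).
- by rewrite ler_pdivlMr // mul1r.
- apply: le_lt_trans (_ : M / a < _); first by rewrite ler_pM2r ?invr_gt0.
  apply: lt_le_trans (truncnS_gt _) _; rewrite -natrX ler_nat -/S.
  by rewrite ltnW // ltn_expl.
have nAs : ~ A s w by move=> h; apply: nB; apply: (hB w s) => //; rewrite mem_iota.
have [_ _ /(_ w nAs Z rZ) h] := hA s.
rewrite ler_pdivrMr // in s2; apply: le_trans (h s2) _.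
rewrite ler_pdivlMr // in s1.
have m1 : 0 <= m%:R + 1 :> R by rewrite addr_ge0.
have -> : 9 * ((m%:R + 1) * (2 ^+ s.+1 * a)) * (2 ^+ s * tau) =
    18 * (m%:R + 1) * tau / a * (2 ^+ s * a) ^+ 2.
  by rewrite exprS; field; rewrite gt_eqF.
apply: ler_wpM2l; first by rewrite divr_ge0 ?(ltW a0) // !mulr_ge0 //; lra.
by rewrite lerXn2r ?nnegrE ?normF_ge0 // mulr_ge0 ?exprn_ge0 // ltW.
Qed.

End Events.

Lemma card_tidx m (d : 'I_m -> nat) : #|tidx d| = dim_prod d.
Proof.
rewrite card_dep_ffun foldrE big_map big_enum /=.
by apply: eq_bigr => k _; rewrite card_ord.
Qed.

Lemma noise_radius_const_ge (R : realType) m (mu : R) rstar :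
  1 <= mu -> (0 < rstar)%N -> 72 <= noise_radius_const m mu rstar.
Proof.
move=> mu1 r0; rewrite /noise_radius_const -!mulrA -[leLHS]mulr1 ler_wpM2l //.
have m0 : 0 <= m%:R :> R by [].
rewrite !mulr_ege1 ?exprn_ege1 ?ler1n //; lra.
Qed.

Lemma rank_leB (R : realType) m (d r : 'I_m -> nat) (S T : tensor R d) :
  rank_le r S -> rank_le r T -> rank_le (fun k => 2 * r k)%N (S - T).
Proof.
move=> hS hT k; rewrite matricizeB; apply: leq_trans (mxrank_add _ _) _.
by rewrite mxrank_opp mul2n -addnn leq_add.
Qed.

Section HuberProcess.
Variables (R : realType) (delta : R).
Hypothesis delta0 : 0 < delta.

(** With [z] an entry of [T - Tstar] and [x] the noise there, [z - x] and [- x] are the residuals at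
    [T] and at [Tstar]. *)
Definition hub_increment (z x : R) : R := hub delta (z - x) - hub delta (- x).

Lemma hub_increment0 x : hub_increment 0 x = 0.
Proof. by rewrite /hub_increment sub0r subrr. Qed.

Lemma measurable_hub_increment z : measurable_fun setT (hub_increment z).
Proof.
apply: measurable_funB; apply: (measurableT_comp (hub_measurable delta)).
  exact: measurable_funB.
exact: measurable_funN.
Qed.

Lemma hub_increment_lip z z' x : `|hub_increment z x - hub_increment z' x| <= `|z - z'|.
Proof.
rewrite /hub_increment opprB addrA subrK; apply: le_trans (hub_lipschitz _ _ _) _.
by rewrite opprB addrA subrK.
Qed.

Lemma mbdd_dhub : mbdd (fun y : R => dhub delta (- y)).
Proof.
split; last by exists 1 => y; exact: dhub_le1.
have mN : measurable_fun setT (-%R : R -> R) by exact: measurable_funN.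
apply: (measurableT_comp (f := dhub delta)) mN.
have -> : dhub delta = (fun t : R => t * (hub delta t `^ (- 1))).
  by apply/funext => t; rewrite powR_inv1 // hub_ge0.
apply: measurable_funM => //.
exact: (measurableT_comp (measurable_powR (- 1)) (hub_measurable delta)).
Qed.

End HuberProcess.

(** The squared norm of the projection [PT] is its inner product with [G], split along [G - N] and
    [N]. Although [PT] depends on the noise, it has rank at most [2 * r], so the bound uniform over
    such tensors applies to it. *)
Lemma tangent_proj_noise_bound (R : realType) m (d r : 'I_m -> nat)
    (T : tensor R d) (C : tensor R r) (U : forall k, 'M[R]_(d k, r k))
    (G N : tensor R d) (K M : R) :
  tucker_rank r T -> tucker_decomp T C U -> 0 <= K -> normF (G - N) <= M ->
  (forall Z : tensor R d, rank_le (fun k => 2 * r k)%N Z ->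
     `|\sum_i Z i * N i| <= K * normF Z) ->
  normF (tangent_proj C U G) <= M + K.
Proof.
move=> rT dT K0 GN hN; set PT := tangent_proj C U G.
have hK := hN PT (rank_le_tangent_proj C U G).
have [P0|Pn0] := eqVneq (normF PT) 0.
  by rewrite P0 addr_ge0 // (le_trans (normF_ge0 _) GN).
have Pp : 0 < normF PT by rewrite lt_neqAle eq_sym Pn0 normF_ge0.
rewrite -(ler_pM2r Pp) -expr2 normF_sq (dot_tangent_proj rT dT) -/PT.
have -> : dot PT G = dot PT (G - N) + \sum_i PT i * N i.
  by rewrite /dot -big_split; apply: eq_bigr => i _; rewrite !ffunE /=; ring.
rewrite mulrDl; apply: lerD; last exact: le_trans (ler_norm _) hK.
apply: le_trans (ler_norm _) _; apply: le_trans (dot_le _ _) _.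
by rewrite mulrC ler_wpM2r ?normF_ge0.
Qed.

(** * Choice of constants and the common good event *)

Theorem lemma1 (R : realType) :
  exists (c : R) (c1 : nat -> R) (c2 : R),
  [/\ 0 < c, (forall m, 0 < c1 m), 0 < c2 &
  forall (m : nat) (d r : 'I_m -> nat)
    (delta eps gamma b0 mustar : R)
    (Tstar : tensor R d) (Cstar : tensor R r) (Ustar : forall k, 'M[R]_(d k, r k))
    (disp0 : measure_display) (Omega0 : measurableType disp0)
    (P0 : probability Omega0 R) (xi : {RV P0 >-> R})
    (disp : measure_display) (Omega : measurableType disp)
    (P : probability Omega R) (Xi : tidx d -> {RV P >-> R}),
  (0 < m)%N ->
  (forall k, (0 < r k)%N) ->
  0 < delta ->
  tucker_rank r Tstar ->
  tucker_decomp Tstar Cstar Ustar ->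
  mustar = incoherence Ustar ->
  let radius := noise_radius_const m mustar (dim_prod r) * (6 * gamma + delta) in
  noise_condition_I xi eps gamma b0 radius ->
  iid_copies Xi xi ->
  exists2 E : set Omega, measurable E &
    (P E > (1 - c * \sum_k (d k)%:R * (codim d k)%:R `^ (- 1 - Num.min 1 eps)
              - expR (- ((DoF d r)%:R / 2)))%:E)%E
    /\
    forall w, E w ->
    let Y : tensor R d := Tstar + [ffun i => Xi i w] in
    (forall T G : tensor R d, huber_subgradient delta Y T G ->
      [/\ (tucker_rank r T ->
            forall (C : tensor R r) (U : forall k, 'M[R]_(d k, r k)),
            tucker_decomp T C U ->
            normF (tangent_proj C U G) <= Num.sqrt (dim_prod d)%:R),
          (norm_sup (T - Tstar))^-1 * normF (T - Tstar) ^+ 2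
            - 6 * (dim_prod d)%:R * gamma - (dim_prod d)%:R * delta
            <= pseudo_huber delta (T - Y) - pseudo_huber delta (Tstar - Y) &
          forall (mu : R) (C : tensor R r) (U : forall k, 'M[R]_(d k, r k)),
            tucker_rank r T -> tucker_decomp T C U -> incoherence U <= mu ->
            forall (k : 'I_m) (j : 'I_(d k)),
              norm_2sup (matricize k (tangent_proj C U G))
                <= Num.sqrt (3 * mu * (r k)%:R * (codim d k)%:R)
              /\
              (norm_sup (matricize k (T - Tstar) j))^-1
                  * normF (matricize k (T - Tstar) j) ^+ 2
                - 6 * (codim d k)%:R * gamma - (codim d k)%:R * delta
                <= pseudo_huber delta (matricize k (T - Y) j)
                   - pseudo_huber delta (matricize k (Tstar - Y) j)])
    /\
    (forall T G : tensor R d, rank_le r T ->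
      norm_sup (T - Tstar) <= radius ->
      c1 m * b0 * Num.sqrt (DoF d r)%:R <= normF (T - Tstar) ->
      huber_subgradient delta Y T G ->
      (tucker_rank r T ->
        forall (C : tensor R r) (U : forall k, 'M[R]_(d k, r k)),
        tucker_decomp T C U ->
        normF (tangent_proj C U G)
          <= c2 * delta^-1 * Num.sqrt (m%:R + 1) * normF (T - Tstar))
      /\
      (4 * b0)^-1 * normF (T - Tstar) ^+ 2
        <= pseudo_huber delta (T - Y) - pseudo_huber delta (Tstar - Y))].
Proof.
(* [theta ^ 2 >= 32 * (8 + 33 * 2 ^ m)] is what the chaining bound at level [tau] requires, and
   [c1] makes the peeled deviation [18 (m + 1) tau / a] equal to [1 / (2 b0)]. *)
pose theta m : R := 32 * (9 + 33 * 2 ^+ m).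
have theta1 m : 1 <= theta m.
  by have : 0 <= 2 ^+ m :> R; [exact: exprn_ge0|rewrite /theta; lra].
pose c1 m : R := 36 * (m%:R + 1) * theta m.
have c10 m : 0 < c1 m.
  have h1 : 0 < m%:R + 1 :> R by rewrite ltr_wpDl.
  by have h2 := theta1 m; rewrite !mulr_gt0 //; lra.
exists 6, c1, 2; split=> //.
move=> m d r delta eps gamma b0 mustar Tstar Cstar Ustar disp0 Omega0 P0 xi disp Omega P Xi.
move=> m0 r0 delta0 rTs dTs muE radius noise [indX lawX].
pose k0 := Ordinal m0.
have mu1 : 1 <= mustar by rewrite muE (incoherence_ge1 dTs (r0 k0)).
have rs0 : (0 < dim_prod r)%N by rewrite /dim_prod prodn_gt0.
have ncc := noise_radius_const_ge m mu1 rs0.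
have gamma_ge0 := noise_gamma_ge0 noise.
have radius72 : 72 * delta <= radius.
  by rewrite /radius; apply: ler_pM; lra.
have radius0 : 0 < radius by lra.
have gamma0 := noise_gamma_gt0 noise radius0.
have momp := noise_moment noise.
have [eps0 _ b00 [h [[mh h0 hL] heven hb]]] := noise.
pose L : probability R R := distribution P0 xi.
have b0r : 2 * radius <= b0 := b0_ge_radius mh hL delta0 b00 radius72 hb.
(* This comparison converts the assumed distance to [Tstar], proportional to [b0], into one
   proportional to [delta]. *)
have b0d : delta <= b0 by lra.
have dk k : (0 < d k)%N.
  have := rank_leq_row (matricize k Tstar); rewrite (rTs k); exact: leq_trans (r0 k).
pose D : R := (DoF d r)%:R.
have D1 : 1 <= D by rewrite /D ler1n /DoF addn_gt0 rs0.
pose sD := Num.sqrt D; have sD1 : 1 <= sD by rewrite -[leLHS]sqrtr1 ler_wsqrtr.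
have sD2 : sD ^+ 2 = D by rewrite sqr_sqrtr //; lra.
pose e k := (2 * r k)%N.
pose tau := theta m * sD.
have th1 := theta1 m.
have tau1 : 1 <= tau by apply: mulr_ege1.
(* With exponent [8 * D] the two chaining events together cost [12 * expR (- (8 * D))], below the
   allowed [expR (- (D / 2))]. *)
have v1 : 1 <= 8 * D by lra.
have tauv : 8 * D + 33 * (DoF d e)%:R <= tau ^+ 2 / 32.
  have hD : (DoF d e)%:R <= 2 ^+ m * D.
    by rewrite /D -natrX -natrM ler_nat DoF_double.
  apply: (@le_trans _ _ (theta m * D / 32)).
    have e2 : 0 <= 2 ^+ m :> R by exact: exprn_ge0.
    by rewrite /theta; lra.
  by rewrite ler_pM2r ?invr_gt0 // exprMn sD2 ler_pM2r; [rewrite expr2 ler_peMl; lra|lra].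
pose f (y : R) := dhub delta (- y).
have bf : mbdd f := mbdd_dhub delta0.
have Ef : mean L f = 0.
  by apply: (mean_odd mh h0 hL heven bf) => y; rewrite /f dhubN.
have sD0 : 0 < sD by lra.
pose a := c1 m * b0 * sD; have a0 : 0 < a by rewrite !mulr_gt0.
(* The entrywise bound on [T - Tstar] supplies the a priori norm bound that peeling needs. *)
pose M : R := #|tidx d|%:R * radius.
have lawXL i (B : set R) : measurable B -> distribution P (Xi i) B = L B by exact: lawX.
have [B1 [mB1 PB1 hB1]] := rows_event indX lawXL eps0 gamma0 dk momp.
have [B2 [mB2 PB2 hB2]] := linear_event indX lawXL tau1 v1 tauv bf (fun y => dhub_le1 delta0 (- y)) Ef.
have [B3 [mB3 PB3 hB3]] := peeling_event indX lawXL tau1 v1 tauv (hub_increment0 delta)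
  (measurable_hub_increment delta) (hub_increment_lip delta) M a0.
pose Sg : R := \sum_k (d k)%:R * (codim d k)%:R `^ (- 1 - Num.min 1 eps).
(* The required probability bound is strict: the rows cost [5 * Sg] while [c] is 6, and positivity
   of [Sg] gives the gap. *)
have Sg0 : 0 < Sg.
  rewrite /Sg (bigD1 k0) //=; apply: ltr_pwDl.
    by rewrite mulr_gt0 ?ltr0n ?powR_gt0 ?ltr0n ?prodn_cond_gt0.
  by apply: sumr_ge0 => k _; rewrite mulr_ge0 ?powR_ge0.
exists (~` (B1 `|` (B2 `|` B3))).
  by apply: measurableC; apply: measurableU => //; apply: measurableU.
split.
  have mB : measurable (B1 `|` (B2 `|` B3)) by apply: measurableU => //; apply: measurableU.
  have PB : (P (B1 `|` (B2 `|` B3)) <= (5 * Sg + (4 * expR (- (8 * D)) + 8 * expR (- (8 * D))))%:E)%E.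
    apply: le_trans (measureU2 _ mB1 (measurableU _ _ mB2 mB3)) _.
    rewrite EFinD; apply: leeD => //.
    by apply: le_trans (measureU2 _ mB2 mB3) _; rewrite EFinD; apply: leeD.
  have hexp : 12 * expR (- (8 * D)) <= expR (- (D / 2)).
    have h5 : 7 / 2 <= expR (5 / 2) :> R by apply: le_trans (expR_ge1Dx _); lra.
    have h12 : 12 <= expR (15 / 2 * D) :> R.
      apply: (@le_trans _ _ (expR (15 / 2))); last by rewrite ler_expR; lra.
      have -> : (15 / 2 : R) = 3%:R * (5 / 2) by lra.
      rewrite expRM_natl; apply: (@le_trans _ _ ((7 / 2) ^+ 3)); first by lra.
      by rewrite lerXn2r ?nnegrE ?expR_ge0 //; lra.
    have -> : - (D / 2) = 15 / 2 * D + - (8 * D) by lra.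
    by rewrite expRD ler_wpM2r ?expR_ge0.
  rewrite probability_setC // -(fineK (fin_num_measure P _ mB)) -EFinB lte_fin.
  have : fine (P (B1 `|` (B2 `|` B3))) <= 5 * Sg + (4 * expR (- (8 * D)) + 8 * expR (- (8 * D))).
    by rewrite -lee_fin fineK ?fin_num_measure.
  rewrite -/Sg -/D; lra.
move=> w nB Y.
have nB1 : ~ B1 w by move=> h1; apply: nB; left.
have nB2 : ~ B2 w by move=> h2; apply: nB; right; left.
have nB3 : ~ B3 w by move=> h3; apply: nB; right; right.
have hrow := hB1 w nB1; have hlin := hB2 w nB2; have hpeel := hB3 w nB3.
have TYE (T : tensor R d) i : (T - Y) i = (T - Tstar) i - Xi i w by rewrite /Y !ffunE; ring.
have TsYE i : (Tstar - Y) i = - Xi i w by rewrite /Y !ffunE; ring.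
have hall : \sum_i `|Xi i w| <= 3 * (dim_prod d)%:R * gamma.
  rewrite (sum_tensor_rows k0); apply: (@le_trans _ _ (\sum_(j < d k0) 3 * (codim d k0)%:R * gamma)).
    by apply: ler_sum => j _.
  rewrite sumr_const card_ord -[leLHS]mulr_natl /dim_prod (bigD1 k0) //= natrM /codim.
  by rewrite le_eqVlt; apply/orP; left; apply/eqP; ring.
have Gle T G : huber_subgradient delta Y T G -> forall i, `|G i| <= 1.
  by move=> hG i; rewrite (huber_subgradientE delta0 i hG) dhub_le1.
split=> [T G hG|T G rT hsup hF hG].
  split.
  - move=> rT C U dT; apply: le_trans (normF_tangent_proj rT dT G) _.
    by rewrite -card_tidx; apply: normF_unit_bounded; apply: Gle hG.
  - have := huber_gap_lower (u := T - Y) (v := Tstar - Y) (a := T - Tstar) delta0.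
    move=> /(_ (fun i => _)) hgap.
    have hs : \sum_i `|(Tstar - Y) i| = \sum_i `|Xi i w|.
      by apply: eq_bigr => i _; rewrite TsYE normrN.
    apply: le_trans (hgap _); last by move=> i; rewrite !ffunE; ring.
    by rewrite card_tidx hs; lra.
  - move=> mu C U rT dT hmu k j; split.
      apply/bigmax_leP; split=> [|j' _]; first exact: sqrtr_ge0.
      exact: (tangent_proj_row_bound rT dT j' (Gle T G hG) hmu (r0 k)).
    have := huber_gap_lower (u := matricize k (T - Y) j) (v := matricize k (Tstar - Y) j)
      (a := matricize k (T - Tstar) j) delta0.
    move=> hgap; apply: le_trans (hgap _); last by move=> c; rewrite !mxE !ffunE; ring.
    have hs : \sum_c `|matricize k (Tstar - Y) j c| = \sum_(i in row_set j) `|Xi i w|.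
      rewrite sum_row_set; apply: eq_bigr => c _; rewrite mxE TsYE normrN //.
    have hc : #|'I_#|cidx d k| |%:R = (codim d k)%:R :> R by rewrite card_ord card_cidx.
    by have := hrow k j; rewrite hs hc; lra.
pose Z := T - Tstar.
have rTs' : rank_le r Tstar by move=> k; rewrite rTs.
have rZ : rank_le e Z := rank_leB rT rTs'.
have nZ0 : 0 < normF Z by apply: lt_le_trans hF.
split.
  move=> rT' C U dT.
  (* The loss gradient at [Tstar], where the residuals are the negated noise; [G - N] is controlled
     by the Lipschitz bound on [dhub]. *)
  pose N : tensor R d := [ffun i => f (Xi i w)].
  have hm : 0 <= m%:R :> R by [].
  have GN : normF (G - N) <= delta^-1 * normF Z.
    rewrite -[delta^-1]ger0_norm ?invr_ge0 ?(ltW delta0) // -normFZ.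
    rewrite normF_le ?normF_ge0 // normF_sq; apply: ler_sum => i _.
    rewrite -!expr2 -(real_normK (num_real ((G - N) i))) -[leRHS](real_normK (num_real _)).
    rewrite lerXn2r ?nnegrE // ffunE [(- N) i]ffunE [N i]ffunE (huber_subgradientE delta0 i hG).
    rewrite /f TYE; apply: le_trans (dhub_lipschitz delta0 _ _) _.
    by rewrite opprK subrK normrM [`|delta^-1|]ger0_norm ?invr_ge0 ?(ltW delta0).
  have K0 : 0 <= 9 * (m%:R + 1) * tau by rewrite !mulr_ge0 //; lra.
  have hN (Z' : tensor R d) : rank_le e Z' -> `|\sum_i Z' i * N i| <= 9 * (m%:R + 1) * tau * normF Z'.
    by move=> rZ'; under eq_bigr do rewrite ffunE; exact: hlin.
  apply: le_trans (tangent_proj_noise_bound rT' dT K0 GN hN) _.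
  have di : 0 < delta^-1 by rewrite invr_gt0.
  (* The lower bound on [normF Z] together with [delta <= 4 * b0] absorbs the noise term into the
     Lipschitz term; the two equal contributions make [c2 = 2]. *)
  have hK : 9 * (m%:R + 1) * tau <= delta^-1 * normF Z.
    rewrite [leRHS]mulrC ler_pdivlMr //; apply: le_trans hF.
    have -> : 9 * (m%:R + 1) * tau * delta = (9 * (m%:R + 1) * theta m * sD) * delta.
      by rewrite /tau; ring.
    have -> : c1 m * b0 * Num.sqrt (DoF d r)%:R = (9 * (m%:R + 1) * theta m * sD) * (4 * b0).
      by rewrite /c1 -/D -/sD; ring.
    apply: ler_wpM2l; last by lra.
    by rewrite !mulr_ge0 //; lra.
  have hs1 : 1 <= Num.sqrt (m%:R + 1) :> R by rewrite -[leLHS]sqrtr1 ler_wsqrtr // lerDr.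
  have dZ : 0 <= delta^-1 * normF Z by rewrite mulr_ge0 ?ltW.
  apply: (@le_trans _ _ (2 * (delta^-1 * normF Z) * 1)); first by lra.
  have -> : 2 * delta^-1 * Num.sqrt (m%:R + 1) * normF (T - Tstar) =
     2 * (delta^-1 * normF Z) * Num.sqrt (m%:R + 1) by rewrite /Z; ring.
  by apply: ler_wpM2l; first lra.
have Zi i : `|Z i| <= radius.
  by apply: le_trans hsup; apply: (le_bigmax _ (fun i => `|Z i|)).
have ZM : normF Z <= M.
  apply: le_trans (normF_le_sum _) _; rewrite /M mulr_natl -sumr_const.
  by apply: ler_sum => i _.
have hp := hpeel Z rZ hF ZM.
have gapE : pseudo_huber delta (T - Y) - pseudo_huber delta (Tstar - Y) =
   centered_sum Xi L (hub_increment delta) Z w + \sum_i mean L (hub_increment delta (Z i)).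
  rewrite /centered_sum -big_split /pseudo_huber -sumrB; apply: eq_bigr => i _ /=.
  by rewrite subrK /hub_increment -TYE -TsYE.
have hmean : 9 / 10 * normF Z ^+ 2 / b0 <= \sum_i mean L (hub_increment delta (Z i)).
  rewrite normF_sq mulr_sumr mulr_suml; apply: ler_sum => i _; rewrite -expr2.
  exact: (huber_mean_lower mh h0 hL heven delta0 b00 radius72 hb (Zi i)).
have coef : 18 * (m%:R + 1) * tau / a = (2 * b0)^-1.
  have h1 : 0 < m%:R + 1 :> R by rewrite ltr_wpDl.
  have h2 : 0 < theta m by lra.
  by rewrite /a /tau /c1; field; rewrite !gt_eqF.
rewrite coef in hp; rewrite gapE -/Z.
have hb0 : 0 < b0^-1 by rewrite invr_gt0.
have Z2 : 0 <= normF Z ^+ 2 by rewrite sqr_ge0.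
have zb : 0 <= normF Z ^+ 2 / b0 by rewrite mulr_ge0 // ltW.
have e1 : (4 * b0)^-1 * normF Z ^+ 2 = 1 / 4 * (normF Z ^+ 2 / b0) by field; rewrite gt_eqF.
have e2 : (2 * b0)^-1 * normF Z ^+ 2 = 1 / 2 * (normF Z ^+ 2 / b0) by field; rewrite gt_eqF.
have e3 : 9 / 10 * normF Z ^+ 2 / b0 = 9 / 10 * (normF Z ^+ 2 / b0) by rewrite -[LHS]mulrA.
move: hp; rewrite e2 ler_norml => /andP[hp _].
(* The expected gap [9 / 10] less the fluctuation [1 / 2] exceeds [1 / 4]. *)
rewrite e1; rewrite e3 in hmean; lra.
Qed.
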